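(* Let $P$ be one of the following posets: (a) the lattice of flats of a uniform matroid; (b) the lattice of flats of a projective geometry or of a $q$-niform matroid; (c) the lattice of flats of an affine geometry, or any rank-selected subposet of it; (d) the lattice of flats of a braid matroid of type A, or any rank-selected subposet of it; (e) the lattice of flats of a braid matroid of type B, or any rank-selected subposet of it; (f) a Dowling geometry $\mathrm Q_n(G)$, or any rank-selected subposet of it; (g) a supersolvable rank-uniform geometric lattice, or any rank-selected subposet of it. Then the Chow polynomial $\underline{\mathrm H}_P(x)$, the augmented Chow polynomial $\mathrm H_P(x)$, and the $h$-polynomial of the order complex of $P$ (which, when $P$ is the lattice of flats of a matroid $M$, are the Chow polynomial of $M$, the augmented Chow polynomial of $M$, and the $h$-polynomial of the Bergman complex of $M$) are real-rooted. In particular, for all these matroids the Chow polynomial and the $h$-polynomial of the Bergman complex have only nonpositive real roots.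
   Context: All posets are finite, bounded (minimum $\hat 0$, maximum $\hat 1$) and graded with rank function $\mathrm{rk}$, $\mathrm{rk}(\hat 0)=0$; the rank of $P$ is $\mathrm{rk}(\hat 1)$. For $P$ of rank $r$ and $S\subseteq\{1,\dots,r-1\}$, the rank-selected subposet is the induced subposet $P_S=\{s\in P:\mathrm{rk}(s)\in S\cup\{0,r\}\}$. Chow polynomials. For $s<t$ let $\chi_{s,t}(x)=\sum_{w\in[s,t]}\mu(s,w)x^{\mathrm{rk}(t)-\mathrm{rk}(w)}$ ($\mu$ the Möbius function) and $\overline\chi_{s,t}(x)=\chi_{s,t}(x)/(x-1)$. The Chow polynomial is defined recursively by $\underline{\mathrm H}_P(x)=1$ if $|P|=1$ and $\underline{\mathrm H}_P(x)=\sum_{s\in P\setminus\{\hat 0\}}\overline\chi_{\hat 0,s}(x)\,\underline{\mathrm H}_{[s,\hat 1]}(x)$ otherwise. The augmented Chow polynomial is $\mathrm H_P(x)=\sum_{s\in P}x^{\mathrm{rk}(s)}\,\underline{\mathrm H}_{[s,\hat 1]}(x)$. For a matroid $M$, its (augmented) Chow polynomial is that of its lattice of flats $\mathcal L(M)$. $h$-polynomial. The order complex is the simplicial complex of all chains; omitting $\hat 0,\hat 1$ does not change the $h$-polynomial. The Bergman complex of $M$ is the order complex of the poset of proper nonempty flats of $M$. For a simplicial complex $\Delta$ of dimension $d-1$ with $f_i$ faces of cardinality $i$, $h(\Delta;y)=\sum_{i=0}^d f_i\,y^i(1-y)^{d-i}$. Families. - Uniform matroid of rank $k$ on $[n]$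 ($n\ge k\ge1$): its lattice of flats consists of the subsets of $[n]$ of cardinality at most $k-1$ together with $[n]$, ordered by inclusion. - Projective geometry: its lattice of flats is the lattice of all linear subspaces of $\mathbb F_q^n$, ordered by inclusion. A $q$-niform matroid is a truncation of a projective geometry: its lattice of flats consists of the subspaces of $\mathbb F_q^n$ of dimension less than $k$ together with $\mathbb F_q^n$, for some $k\le n$. - Affine geometry: its lattice of flats is the lattice of affine subspaces of $\mathbb F_q^n$, including the empty set, ordered by inclusion. - Braid matroid of type A: its lattice of flats is the lattice $\Pi_n$ of set partitions of $[n]$ ordered by refinement. - Dowling geometry $\mathrm Q_n(G)$, $n\ge1$, $G$ a finite group. A $G$-prepartition of $[n]$ is a pair $(\mu,\varphi)$ where $\{0\}\sqcup[n]=\mu_0\sqcup\mu_1\sqcup\cdots\sqcup\mu_k$ is a set partition with $0\in\mu_0$ (the zero block), and $\varphi:\mu_1\sqcup\cdots\sqcup\mu_k\to G$ is a function. Set $(\mu,\varphi)\ge(\mu',\varphi')$ if every non-zero block of $\mu$ is a union of non-zero blocks of $\mu'$ and the labelings coincide (on the non-zero blocks of $\mu$). Two prepartitions $(\mu,\varphi),(\mu',\varphi')$ are equivalent if $\mu=\mu'$ and for each non-zero block $\mu_i$ there is $g\in G$ with $\varphi|_{\mu_i}=g\cdot\varphi'|_{\mu_i}$. $\mathrm Q_n(G)$ is the set of equivalence classes of $G$-prepartitions with the induced order. For trivial $G$ it is $\Pi_{n+1}$. - Braid matroid of type B: its lattice of flats is $\mathrm Q_n(\mathbb Z/2\mathbb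 Z)$, the intersection lattice of the arrangement $\{x_i=\pm x_j\}_{i<j}\cup\{x_k=0\}$. - A geometric lattice is the lattice of flats of a matroid. A graded lattice $L$ is supersolvable if it has a maximal chain of left modular elements, where $s$ is left modular if $u\vee(s\wedge t)=(u\vee s)\wedge t$ for all $t$ and all $u\le t$. A poset is rank-uniform if for all $s,t$ of the same rank and all $k\geq 1$, the number of elements above $s$ of rank $\mathrm{rk}(s)+k$ equals the number of elements above $t$ of rank $\mathrm{rk}(t)+k$. *)

(* Defs.v *)
From HB Require Import structures.
From mathcomp Require Import all_boot all_order all_fingroup all_algebra.
From mathcomp Require Import reals complex.

Set Implicit Arguments.
Unset Strict Implicit.
Unset Printing Implicit Defensive.

Import Order.TTheory GRing.Theory Num.Theory.
Import Order.DefaultSetSubsetOrder.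
Local Open Scope ring_scope.

(* Finite bounded posets are [finTBPOrderType]s; \bot = \top is allowed.      *)

Section Posets.
Context {d : Order.disp_t} {P : finPOrderType d}.

Definition is_chain (C : {set P}) : bool :=
  [forall x in C, forall y in C, (x >=< y)%O].

Definition covers (s t : P) : bool :=
  (s < t)%O && [forall w : P, ~~ (s < w < t)%O].

End Posets.

Definition poset_iso d (P : porderType d) d' (Q : porderType d') : Prop :=
  exists f : P -> Q, bijective f /\ {mono f : x y / (x <= y)%O}.

Section Graded.
Context {d : Order.disp_t} {P : finTBPOrderType d}.

Definition is_rank_function (rho : P -> nat) : Prop :=
  rho \bot%O = 0%N /\ forall s t : P, covers s t -> rho t = (rho s).+1.

(* The length of a longest chain from \bot to s.  On a graded poset this is   *)
(* the rank function, see [rkE] below.                                        *)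
Definition rk (s : P) : nat :=
  (\max_(C : {set P} | is_chain C && [forall x in C, (x <= s)%O]) #|C|).-1.

End Graded.

Lemma card_downset_lt d (P : finPOrderType d) (s t : P) : (s < t)%O ->
  (#|[set w : P | (w <= s)%O]| < #|[set w : P | (w <= t)%O]|)%N.
Proof.
move=> st; apply/proper_card/properP; split.
  by apply/subsetP => w; rewrite !inE => /le_trans; apply; apply: ltW.
by exists t; rewrite !inE ?lexx // lt_geF.
Qed.

Lemma card_upset_lt d (P : finPOrderType d) (s t : P) : (s < t)%O ->
  (#|[set w : P | (t <= w)%O]| < #|[set w : P | (s <= w)%O]|)%N.
Proof.
move=> st; apply/proper_card/properP; split.
  by apply/subsetP => w; rewrite !inE; apply: le_trans; apply: ltW.
by exists s; rewrite !inE ?lexx // lt_geF.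
Qed.

Section RankFunction.
Variables (d : Order.disp_t) (P : finTBPOrderType d) (rho : P -> nat).
Hypothesis rhoP : is_rank_function rho.

Lemma covers_below (s : P) : s != \bot%O -> exists u, covers u s.
Proof.
rewrite -lt0x => s0.
case: (@arg_maxnP P \bot%O (fun u => (u < s)%O)
        (fun u => #|[set w : P | (w <= u)%O]|) s0) => u us umax.
exists u; rewrite /covers us; apply/forallP => w; apply/negP => /andP[uw ws].
by have := card_downset_lt uw; rewrite ltnNge (umax w ws : is_true (_ <= _)%N).
Qed.

Lemma rank_function_lt (s t : P) : (s < t)%O -> (rho s < rho t)%N.
Proof.
have [n] := ubnP #|[set w : P | (w <= t)%O]|.
elim: n s t => // n IHn s t tn st.
have t0 : t != \bot%O by apply: contraTneq st => ->; rewrite ltx0.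
have [m] := ubnP #|[set w : P | (s <= w)%O]|.
elim: m s st {t0} => // m IHm s st sm.
have [/existsP[w /andP[sw wt]]|/existsPn no] :=
  boolP [exists w : P, (s < w < t)%O].
  apply: (@ltn_trans (rho w)).
    by apply: IHn => //; apply: leq_trans (card_downset_lt wt) _.
  by apply: IHm => //; apply: leq_trans (card_upset_lt sw) _.
by rewrite (rhoP.2 s t) // /covers st; apply/forallP.
Qed.

Lemma rkE : rk =1 rho.
Proof.
move=> s; suff E : (\max_(C : {set P} | is_chain C && [forall x in C, (x <= s)%O])
    #|C|)%N = (rho s).+1 by rewrite /rk E.
apply/eqP; rewrite eqn_leq; apply/andP; split.
  apply/bigmax_leqP => C /andP[/forall_inP Cc /forall_inP Cs].
  rewrite -[X in (_ <= X)%N]card_ord.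
  have mono x : x \in C -> (rho x < (rho s).+1)%N.
    move/Cs; rewrite le_eqVlt => /orP[/eqP -> //|/rank_function_lt].
    by move/leqW.
  rewrite -(card_in_imset (f := fun x => inord (rho x) : 'I_(rho s).+1)) ?max_card //.
  move=> x y xC yC /(congr1 (@nat_of_ord _)); rewrite !inordK ?mono // => xy.
  have /forall_inP/(_ y yC) := Cc x xC.
  by case: comparableP => // /rank_function_lt; rewrite xy ltnn.
have [n] := ubnP (rho s); elim: n s => // n IHn s sn.
have [s0|s0] := eqVneq s \bot%O.
  apply: (bigop.bigmax_sup [set s]); last by rewrite cards1 s0 rhoP.1.
  by apply/andP; split; apply/forall_inP => x /set1P ->; rewrite ?lexx //;
    apply/forall_inP => y /set1P ->; rewrite comparablexx.
have [u us] := covers_below s0; have rs := rhoP.2 _ _ us.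
have ult : (u < s)%O by case/andP: us.
have := IHn u; rewrite rs; rewrite rs in sn => /(_ sn) le.
have C0 : is_chain (set0 : {set P}) && [forall x in (set0 : {set P}), (x <= u)%O].
  by apply/andP; split; apply/forall_inP => x; rewrite inE.
pose A (C : {set P}) := is_chain C && [forall x in C, (x <= u)%O].
have A0 : (0 < #|A|)%N by apply/card_gt0P; exists set0.
have [C /andP[/forall_inP Cc /forall_inP Cu] CE] :=
  eq_bigmax_cond (fun C : {set P} => #|C|) A0.
apply: (bigop.bigmax_sup (s |: C)); last first.
  rewrite cardsU1 -CE (_ : s \notin C) //.
  by apply/negP => sC; have := le_lt_trans (Cu _ sC) ult; rewrite ltxx.
have Cs x : x \in C -> (x <= s)%O by move/Cu/le_trans; apply; apply: ltW.
apply/andP; split; apply/forall_inP => x /setU1P[->|xC]; rewrite ?lexx ?Cs //;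
  apply/forall_inP => y /setU1P[->|yC]; rewrite ?comparablexx //.
- by rewrite ge_comparable ?Cs.
- by rewrite le_comparable ?Cs.
- by have /forall_inP := Cc x xC; apply.
Qed.

End RankFunction.

Definition graded d (P : finTBPOrderType d) : Prop :=
  exists rho : P -> nat, is_rank_function rho.

Definition rank_uniform d (P : finTBPOrderType d) : Prop :=
  forall (s t : P) (k : nat), rk s = rk t -> (1 <= k)%N ->
    #|[set w : P | (s <= w)%O && (rk w == rk s + k)%N]|
    = #|[set w : P | (t <= w)%O && (rk w == rk t + k)%N]|.

Record bounded_subset d (P : finPOrderType d) := BoundedSubset {
  bs_set : {set P};
  bs_min : P;
  bs_max : P;
  bs_min_in : bs_min \in bs_set;
  bs_max_in : bs_max \in bs_set;
  bs_minP : forall x, x \in bs_set -> (bs_min <= x)%O;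
  bs_maxP : forall x, x \in bs_set -> (x <= bs_max)%O
}.

Section Induced.
Variables (d : Order.disp_t) (P : finPOrderType d) (B : bounded_subset P).

Record induced : predArgType :=
  Induced { induced_val : P; _ : induced_val \in bs_set B }.

HB.instance Definition _ := [isSub for induced_val].
HB.instance Definition _ := [Finite of induced by <:].
HB.instance Definition _ := [SubChoice_isSubPOrder of induced by <: with d].

Fact induced_le0x (x : induced) : (Induced (bs_min_in B) <= x)%O.
Proof. by rewrite -Order.le_val; apply: bs_minP; apply: (valP x). Qed.
HB.instance Definition _ := Order.hasBottom.Build d induced induced_le0x.

Fact induced_lex1 (x : induced) : (x <= Induced (bs_max_in B))%O.
Proof. by rewrite -Order.le_val; apply: bs_maxP; apply: (valP x). Qed.
HB.instance Definition _ := Order.hasTop.Build d induced induced_lex1.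

End Induced.

Section RankSelection.
Variables (d : Order.disp_t) (P : finTBPOrderType d) (S : seq nat).

Definition rank_selected_set : {set P} :=
  [set s : P | rk s \in 0%N :: rk (\top%O : P) :: S].

Fact rk0 : rk (\bot%O : P) = 0%N.
Proof.
have : (\max_(C : {set P} | is_chain C && [forall x in C, (x <= \bot)%O]) #|C|
        <= 1)%N.
  apply/bigmax_leqP => C /andP[_ /forallP Cle].
  rewrite -(cards1 (\bot%O : P)); apply/subset_leq_card/subsetP => x xC.
  by have := Cle x; rewrite xC lex0 inE.
by rewrite /rk; case: (\max_(C | _) _)%N => [|[]].
Qed.

Fact rank_selected_min_in : \bot%O \in rank_selected_set.
Proof. by rewrite inE rk0. Qed.

Fact rank_selected_max_in : \top%O \in rank_selected_set.
Proof. by rewrite !inE eqxx orbT. Qed.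

Definition rank_selection : bounded_subset P :=
  BoundedSubset rank_selected_min_in rank_selected_max_in
    (fun x _ => le0x x) (fun x _ => lex1 x).

End RankSelection.

(* [P] is [Q] or one of its rank-selected subposets, up to isomorphism. *)
Definition selection_of d (P : finTBPOrderType d) d' (Q : finTBPOrderType d')
    : Prop :=
  poset_iso P Q \/
  exists S : seq nat, {in S, forall i, (0 < i < rk (\top%O : Q))%N} /\
    poset_iso P (induced (rank_selection Q S)).

Section ChowPolynomial.
Context {d : Order.disp_t} {P : finTBPOrderType d}.

(* The recursions on chains of P are bounded by a fuel argument, for which    *)
(* #|P| is enough; see [mobiusE] and [chow_fromE].                            *)
Fixpoint mobius_rec (n : nat) (s t : P) : int :=
  if n is n'.+1 then
    if s == t then 1 else - \sum_(w : P | (s <= w < t)%O) mobius_rec n' s w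
  else 0.

Definition mobius (s t : P) : int := mobius_rec #|P| s t.

Definition chi (s t : P) : {poly int} :=
  \sum_(w : P | (s <= w <= t)%O) mobius s w *: 'X^(rk t - rk w).

(* The division is exact for s < t, see [chibarK]. *)
Definition chibar (s t : P) : {poly int} := chi s t %/ ('X - 1).

Fixpoint chow_rec (n : nat) (s : P) : {poly int} :=
  if n is n'.+1 then
    if s == \top%O then 1
    else \sum_(t : P | (s < t)%O) chibar s t * chow_rec n' t
  else 0.

(* The Chow polynomial of the interval [s, \top]: Möbius functions and        *)
(* differences of ranks can be computed in P.                                 *)
Definition chow_from (s : P) : {poly int} := chow_rec #|P| s.

Lemma mobius_rec_eq m n (s t : P) :
  (#|[set w : P | (w <= t)%O]| <= m)%N -> (#|[set w : P | (w <= t)%O]| <= n)%N ->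
  mobius_rec m s t = mobius_rec n s t.
Proof.
have pos (u : P) : (0 < #|[set w : P | (w <= u)%O]|)%N.
  by apply/card_gt0P; exists u; rewrite inE lexx.
elim: m n t => [|m IHm] [|n] t /=; try by rewrite leqNgt pos.
  by move=> _; rewrite leqNgt pos.
move=> tm tn; case: eqP => // _; congr (- _); apply: eq_bigr => w /andP[_ wt].
by apply: IHm; rewrite -ltnS; apply: leq_trans (card_downset_lt wt) _.
Qed.

Lemma mobius_recS n (s t : P) : mobius_rec n.+1 s t =
  if s == t then 1 else - \sum_(w : P | (s <= w < t)%O) mobius_rec n s w.
Proof. by []. Qed.

Lemma mobiusE (s t : P) : mobius s t =
  if s == t then 1 else - \sum_(w : P | (s <= w < t)%O) mobius s w.
Proof.
have E : #|P| = #|P|.-1.+1 by rewrite prednK //; apply/card_gt0P; exists s.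
rewrite {1}/mobius E mobius_recS; case: eqP => // _; congr (- _).
apply: eq_bigr => w /andP[_ wt]; apply: mobius_rec_eq; last exact: max_card.
by rewrite -ltnS -E; apply: leq_trans (card_downset_lt wt) (max_card _).
Qed.

Lemma chibarK (s t : P) : (s < t)%O -> chibar s t * ('X - 1) = chi s t.
Proof.
move=> st; have : root (chi s t) 1.
  rewrite rootE /chi horner_sum (bigD1 t) /=; last by rewrite lexx (ltW st).
  rewrite hornerZ hornerXn expr1n mulr1 mobiusE (lt_eqF st) addrC subr_eq0.
  apply/eqP/eq_big => [w|w _]; last by rewrite hornerZ hornerXn expr1n mulr1.
  by rewrite -andbA [(w <= t)%O && _]andbC -lt_neqAle.
case/factor_theorem => q qE.
by rewrite /chibar qE polyC1 Pdiv.IdomainMonic.mulpK // -polyC1 monicXsubC.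
Qed.

Lemma chow_rec_eq m n (s : P) :
  (#|[set w : P | (s <= w)%O]| <= m)%N -> (#|[set w : P | (s <= w)%O]| <= n)%N ->
  chow_rec m s = chow_rec n s.
Proof.
have pos (u : P) : (0 < #|[set w : P | (u <= w)%O]|)%N.
  by apply/card_gt0P; exists u; rewrite inE lexx.
elim: m n s => [|m IHm] [|n] s /=; try by rewrite leqNgt pos.
  by move=> _; rewrite leqNgt pos.
move=> sm sn; case: eqP => // _; apply: eq_bigr => t st; congr (_ * _).
by apply: IHm; rewrite -ltnS; apply: leq_trans (card_upset_lt st) _.
Qed.

Lemma chow_recS n (s : P) : chow_rec n.+1 s =
  if s == \top%O then 1
  else \sum_(t : P | (s < t)%O) chibar s t * chow_rec n t.
Proof. by []. Qed.

Lemma chow_fromE (s : P) : chow_from s =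
  if s == \top%O then 1 else \sum_(t : P | (s < t)%O) chibar s t * chow_from t.
Proof.
have E : #|P| = #|P|.-1.+1 by rewrite prednK //; apply/card_gt0P; exists s.
rewrite {1}/chow_from E chow_recS; case: eqP => // _.
apply: eq_bigr => t st; congr (_ * _); apply: chow_rec_eq; last exact: max_card.
by rewrite -ltnS -E; apply: leq_trans (card_upset_lt st) (max_card _).
Qed.

End ChowPolynomial.

Definition chow d (P : finTBPOrderType d) : {poly int} :=
  chow_from (\bot%O : P).

Definition augmented_chow d (P : finTBPOrderType d) : {poly int} :=
  \sum_(s : P) 'X^(rk s) * chow_from s.

(* A simplicial complex is given by the set of its faces, including the empty *)
(* face; its dimension is d - 1 where d is the largest cardinality of a face. *)
Definition h_polynomial (V : finType) (Delta : {set {set V}}) : {poly int} :=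
  let d := (\max_(A in Delta) #|A|)%N in
  \sum_(i < d.+1) (#|[set A in Delta | #|A| == i]|)%:R
                  *: ('X^i * (1 - 'X) ^+ (d - i)).

Definition order_complex d (P : finPOrderType d) (A : {set P}) : {set {set P}} :=
  [set C : {set P} | (C \subset A) && is_chain C].

Definition all_roots_real (R : realType) (p : {poly int}) : Prop :=
  forall z : R[i], root (map_poly intr p) z -> complex.Im z = 0.

Definition all_roots_real_nonpos (R : realType) (p : {poly int}) : Prop :=
  forall z : R[i], root (map_poly intr p) z ->
    complex.Im z = 0 /\ complex.Re z <= 0.

Section Matroids.

Record matroid (E : finType) := Matroid {
  indep : {set {set E}};
  indep0 : set0 \in indep;
  indepS : forall I J : {set E}, I \subset J -> J \in indep -> I \in indep;
  indep_augment : forall I J : {set E}, I \in indep -> J \in indep ->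
    (#|I| < #|J|)%N -> exists2 x, x \in J :\: I & x |: I \in indep
}.

Variables (E : finType) (M : matroid E).

Definition mrank (A : {set E}) : nat :=
  \max_(I in indep M | I \subset A) #|I|.

Definition is_flat (F : {set E}) : bool :=
  [forall x, (x \notin F) ==> (mrank F < mrank (x |: F))%N].

Definition loops : {set E} := [set x | [set x] \notin indep M].

Lemma indep_loops (I : {set E}) x : I \in indep M -> x \in I -> x \notin loops.
Proof.
by move=> Iin xI; rewrite inE negbK; apply: indepS Iin; rewrite sub1set.
Qed.

Fact loops_in : loops \in [set F | is_flat F].
Proof.
rewrite inE; apply/forallP => x; apply/implyP; rewrite inE negbK => xin.
have -> : mrank loops = 0%N.
  apply/eqP; rewrite -leqn0; apply/bigmax_leqP => I /andP[Iin /subsetP Il].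
  rewrite leqn0 cards_eq0; apply/eqP/setP => y; rewrite in_set0.
  by apply/negbTE/negP => yI; have := indep_loops Iin yI; rewrite Il.
rewrite -(cards1 x).
rewrite /mrank; apply: (bigop.bigmax_sup [set x]) => //.
by rewrite xin sub1set setU11.
Qed.

Fact setT_flat_in : [set: E] \in [set F | is_flat F].
Proof. by rewrite inE; apply/forallP => x; rewrite in_setT. Qed.

Fact loops_min (F : {set E}) : F \in [set F | is_flat F] -> (loops <= F)%O.
Proof.
rewrite inE Order.SetSubsetOrder.leEsubset => /forallP Ff; apply/subsetP => x xl.
apply/negPn/negP => xF; have := Ff x; rewrite xF /= ltnNge => /negP; apply.
apply/bigmax_leqP => I /andP[Iin Isub].
apply: (bigop.bigmax_sup I) => //; rewrite Iin.
apply/subsetP => y yI; have /setU1P[yx|//] := subsetP Isub y yI.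
by have := indep_loops Iin yI; rewrite yx xl.
Qed.

Fact setT_max (T : finType) (A : {set T}) : (A <= setT)%O.
Proof. by rewrite Order.SetSubsetOrder.leEsubset subsetT. Qed.

Definition flat_family : bounded_subset {set E} :=
  BoundedSubset loops_in setT_flat_in loops_min (fun A _ => setT_max A).

End Matroids.

Definition flats (E : finType) (M : matroid E) := induced (flat_family M).
HB.instance Definition _ (E : finType) (M : matroid E) :=
  Order.FinTBPOrder.on (flats M).

Definition bergman_complex (E : finType) (M : matroid E) : {set {set flats M}} :=
  order_complex [set F : flats M | (val F != set0) && (val F != setT)].

Definition geometric d (L : finTBLatticeType d) : Prop :=
  exists (E : finType) (M : matroid E), poset_iso L (flats M).

Definition left_modular d (L : finTBLatticeType d) (s : L) : Prop :=
  forall t u : L, (u <= t)%O -> (u `|` (s `&` t) = (u `|` s) `&` t)%O.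

Definition supersolvable d (L : finTBLatticeType d) : Prop :=
  graded L /\ exists C : {set L},
    maxset is_chain C /\ {in C, forall s, left_modular s}.

Section UniformLattice.
Variables n k : nat.

Definition uniform_set : {set {set 'I_n}} :=
  [set A : {set 'I_n} | (#|A| <= k.-1)%N || (A == setT)].

Fact uniform_min_in : set0 \in uniform_set.
Proof. by rewrite inE cards0. Qed.

Fact uniform_max_in : setT \in uniform_set.
Proof. by rewrite inE eqxx orbT. Qed.

Fact set0_min (T : finType) (A : {set T}) : (set0 <= A)%O.
Proof. by rewrite Order.SetSubsetOrder.leEsubset sub0set. Qed.

Definition uniform_lattice : bounded_subset {set 'I_n} :=
  BoundedSubset uniform_min_in uniform_max_in
    (fun A _ => set0_min A) (fun A _ => setT_max A).

End UniformLattice.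

Section Geometries.
Variables (F : finFieldType) (n : nat).

(* The linear subspace of F^n spanned by the rows of U, of dimension \rank U. *)
Definition row_space (U : 'M[F]_n) : {set 'rV[F]_n} :=
  [set v : 'rV[F]_n | (v <= U)%MS].

Lemma row_space0 : row_space 0 = [set 0].
Proof. by apply/setP => v; rewrite !inE submx0. Qed.

Lemma row_space1 : row_space 1%:M = setT.
Proof. by apply/setP => v; rewrite !inE submx1. Qed.

Lemma row_space_min U : (row_space 0 <= row_space U)%O.
Proof. by rewrite Order.SetSubsetOrder.leEsubset row_space0 sub1set inE sub0mx. Qed.

Definition linear_subspaces : {set {set 'rV[F]_n}} :=
  [set row_space U | U : 'M[F]_n].

Fact linear_min_in : row_space 0 \in linear_subspaces.
Proof. exact: imset_f. Qed.

Fact linear_max_in : setT \in linear_subspaces.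
Proof. by rewrite -row_space1; exact: imset_f. Qed.

Fact linear_minP A : A \in linear_subspaces -> (row_space 0 <= A)%O.
Proof. by case/imsetP => U _ ->; exact: row_space_min. Qed.

Definition projective_lattice : bounded_subset {set 'rV[F]_n} :=
  BoundedSubset linear_min_in linear_max_in linear_minP
    (fun A _ => setT_max A).

Variable k : nat.

Definition qniform_set : {set {set 'rV[F]_n}} :=
  setT |: [set row_space U | U : 'M[F]_n & (\rank U < k)%N].

(* For k = 0 the poset has a single element. *)
Definition qniform_min : {set 'rV[F]_n} :=
  if (0 < k)%N then row_space 0 else setT.

Fact qniform_min_in : qniform_min \in qniform_set.
Proof.
rewrite /qniform_min; case: ifP => k0; last exact: setU11.
by apply/setU1P; right; apply: imset_f; rewrite inE mxrank0.
Qed.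

Fact qniform_max_in : setT \in qniform_set.
Proof. exact: setU11. Qed.

Fact qniform_minP A : A \in qniform_set -> (qniform_min <= A)%O.
Proof.
case/setU1P => [->|/imsetP[U]]; first exact: setT_max.
rewrite inE => Uk ->; rewrite /qniform_min (leq_ltn_trans _ Uk) //.
exact: row_space_min.
Qed.

Definition qniform_lattice : bounded_subset {set 'rV[F]_n} :=
  BoundedSubset qniform_min_in qniform_max_in qniform_minP
    (fun A _ => setT_max A).

Definition affine_set : {set {set 'rV[F]_n}} :=
  set0 |: [set [set a + v | v in row_space U] | a : 'rV[F]_n, U : 'M[F]_n].

Fact affine_min_in : set0 \in affine_set.
Proof. exact: setU11. Qed.

Fact affine_max_in : setT \in affine_set.
Proof.
apply/setU1P; right; apply/imset2P.
exists 0 1%:M => //; apply/esym/setP => v; rewrite in_setT; apply/imsetP.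
by exists v; rewrite ?add0r // row_space1.
Qed.

Definition affine_lattice : bounded_subset {set 'rV[F]_n} :=
  BoundedSubset affine_min_in affine_max_in
    (fun A _ => set0_min A) (fun A _ => setT_max A).

End Geometries.

Section PartitionLattice.
Variable n : nat.

Record setpart : predArgType :=
  SetPart { blocks : {set {set 'I_n}}; _ : partition blocks [set: 'I_n] }.

HB.instance Definition _ := [isSub for blocks].
HB.instance Definition _ := [Finite of setpart by <:].

Definition refines (p q : setpart) : bool :=
  [forall A in blocks p, exists B in blocks q, A \subset B].

Lemma refinesP p q :
  reflect (forall A, A \in blocks p -> exists2 B, B \in blocks q & A \subset B)
          (refines p q).
Proof. exact: 'forall_in_exists_inP. Qed.

Fact refines_refl : reflexive refines.
Proof. by move=> p; apply/refinesP => A Ap; exists A. Qed.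

Fact refines_anti : antisymmetric refines.
Proof.
have sub p q : refines p q -> refines q p -> blocks p \subset blocks q.
  move=> /refinesP pq /refinesP qp; apply/subsetP => A Ap.
  have [B Bq AB] := pq _ Ap; have [C Cp BC] := qp _ Bq.
  case: p q Ap Cp Bq {pq qp} => [p pP] [q qP] /= Ap Cp Bq.
  have /and3P[_ tp p0] := pP.
  have [x xA] : exists x, x \in A.
    by apply/set0Pn; apply: contraNneq p0 => <-.
  have xC : x \in C by apply: (subsetP BC); apply: (subsetP AB).
  have AC : A = C by rewrite -(def_pblock tp Ap xA) (def_pblock tp Cp xC).
  suff -> : A = B by [].
  by apply/eqP; rewrite eqEsubset AB AC.
move=> p q /andP[pq qp]; apply: val_inj; apply/eqP.
by rewrite eqEsubset !sub.
Qed.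

Fact refines_trans : transitive refines.
Proof.
move=> q p r /refinesP pq /refinesP qr; apply/refinesP => A /pq[B /qr[C Cr BC]].
by move=> AB; exists C => //; apply: subset_trans BC.
Qed.

Fact setpart_display : Order.disp_t. Proof. exact: (Order.Disp tt tt). Qed.

HB.instance Definition _ := Order.Le_isPOrder.Build setpart_display setpart
  refines_refl refines_anti refines_trans.

Definition setpart_bot : setpart := SetPart (preim_partitionP id setT).
Definition setpart_top : setpart := SetPart (preim_partitionP (fun=> tt) setT).

Fact setpart_le0x (p : setpart) : (setpart_bot <= p)%O.
Proof.
apply/refinesP => _ /imsetP[x _ ->].
case: p => p pP /=; have /and3P[/eqP cp tp _] := pP.
exists (pblock p x); first by rewrite pblock_mem // cp.
apply/subsetP => y; rewrite !inE /= => /eqP <-.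
by rewrite mem_pblock cp.
Qed.
HB.instance Definition _ :=
  Order.hasBottom.Build setpart_display setpart setpart_le0x.

Fact setpart_lex1 (p : setpart) : (p <= setpart_top)%O.
Proof.
apply/refinesP => A Ap; case: p Ap => p pP /= Ap.
have /and3P[_ _ p0] := pP.
have [x xA] : exists x, x \in A by apply/set0Pn; apply: contraNneq p0 => <-.
exists [set: 'I_n] => //; apply/imsetP; exists x => //.
by apply/esym/setP => y; rewrite !inE.
Qed.
HB.instance Definition _ :=
  Order.hasTop.Build setpart_display setpart setpart_lex1.

End PartitionLattice.

Section Dowling.
Variables (n : nat) (G : finGroupType).

(* {0} |_| [n] is encoded by [option 'I_n], with [None] for 0.  The labeling  *)
(* is a partial function, defined exactly outside of the zero block.          *)
Record prepartition : predArgType := PrePartition {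
  pp_data : {set {set option 'I_n}} * {ffun 'I_n -> option G};
  _ : partition pp_data.1 setT &&
      [forall i, (pp_data.2 i == None) == (Some i \in pblock pp_data.1 None)]
}.

HB.instance Definition _ := [isSub for pp_data].
HB.instance Definition _ := [Finite of prepartition by <:].

Definition pp_blocks (p : prepartition) := (pp_data p).1.
Definition pp_label (p : prepartition) := (pp_data p).2.

Definition nonzero_blocks (p : prepartition) : {set {set option 'I_n}} :=
  [set B in pp_blocks p | None \notin B].

Definition pp_le (p' p : prepartition) : bool :=
  [forall B in nonzero_blocks p,
     [exists S : {set {set option 'I_n}},
        (S \subset nonzero_blocks p') && (B == cover S)]] &&
  [forall i, (pp_label p i != None) ==> (pp_label p' i == pp_label p i)].

Definition pp_equiv (p p' : prepartition) : bool :=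
  (pp_blocks p == pp_blocks p') &&
  [forall B in nonzero_blocks p, exists g : G, forall i,
     (Some i \in B) ==> (pp_label p i == omap (mulg g) (pp_label p' i))].

(* Equivalence classes, with the order induced by [pp_le]. *)
Record dowling : predArgType := Dowling {
  dw_class : {set prepartition};
  _ : dw_class \in [set [set q | pp_equiv p q] | p : prepartition]
}.

HB.instance Definition _ := [isSub for dw_class].
HB.instance Definition _ := [Finite of dowling by <:].

Definition dowling_le (x y : dowling) : bool :=
  [exists p in dw_class x, exists q in dw_class y, pp_le p q].

Lemma pp_partition p : partition (pp_blocks p) setT.
Proof. by case/andP: (valP p). Qed.

Lemma pp_labelE p i :
  (pp_label p i == None) = (Some i \in pblock (pp_blocks p) None).
Proof. by case/andP: (valP p) => _ /forallP/(_ i)/eqP. Qed.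

Lemma pp_cover p x : x \in cover (pp_blocks p).
Proof. by case/and3P: (pp_partition p) => /eqP->; rewrite inE. Qed.

Lemma pp_triv p : trivIset (pp_blocks p).
Proof. by case/and3P: (pp_partition p). Qed.

Lemma nonzeroW p B : B \in nonzero_blocks p -> B \in pp_blocks p.
Proof. by rewrite inE => /andP[]. Qed.

Lemma pp_label_nonzero p B i :
  B \in nonzero_blocks p -> Some i \in B -> pp_label p i != None.
Proof.
rewrite inE => /andP[Bp BN] iB; rewrite pp_labelE; apply: contra BN => iZ.
have Z : pblock (pp_blocks p) None \in pp_blocks p by rewrite pblock_mem ?pp_cover.
by rewrite -(def_pblock (pp_triv p) Bp iB) (def_pblock (pp_triv p) Z iZ)
  mem_pblock pp_cover.
Qed.

Lemma nonzero_block_of p i : pp_label p i != None ->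
  exists2 B, B \in nonzero_blocks p & Some i \in B.
Proof.
rewrite pp_labelE => iZ; exists (pblock (pp_blocks p) (Some i)); last first.
  by rewrite mem_pblock pp_cover.
rewrite inE pblock_mem ?pp_cover //=; apply: contra iZ => NB.
have Bin : pblock (pp_blocks p) (Some i) \in pp_blocks p.
  by rewrite pblock_mem ?pp_cover.
by rewrite (def_pblock (pp_triv p) Bin NB) mem_pblock pp_cover.
Qed.

Lemma pp_nonempty p B : B \in pp_blocks p -> exists x, x \in B.
Proof.
by case/and3P: (pp_partition p) => _ _ p0 Bp; apply/set0Pn; apply: contraNneq p0 => <-.
Qed.

Lemma pp_blocks_inj p B C x :
  B \in pp_blocks p -> C \in pp_blocks p -> x \in B -> x \in C -> B = C.
Proof.
move=> Bp Cp xB xC.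
by rewrite -(def_pblock (pp_triv p) Bp xB) (def_pblock (pp_triv p) Cp xC).
Qed.

Lemma pp_leP p' p : reflect
  ((forall B x, B \in nonzero_blocks p -> x \in B ->
      exists D, [/\ D \in nonzero_blocks p', x \in D & D \subset B]) /\
   (forall i, pp_label p i != None -> pp_label p' i = pp_label p i))
  (pp_le p' p).
Proof.
apply: (iffP andP) => [[/forall_inP H /forall_inP L]|[H L]]; split.
- move=> B x Bp xB; have /existsP[S /andP[/subsetP Sp /eqP BE]] := H _ Bp.
  move: (xB); rewrite BE => /bigcupP[D DS xD]; exists D; split=> //.
    exact: Sp.
  by apply/subsetP => y yD; apply/bigcupP; exists D.
- by move=> i /L /eqP.
- apply/forall_inP => B Bp; apply/existsP.
  exists [set D in nonzero_blocks p' | D \subset B]; apply/andP; split.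
    by apply/subsetP => D; rewrite inE => /andP[].
  apply/eqP/setP => x; apply/idP/bigcupP => [xB|[D]].
    by have [D [Dp xD DB]] := H _ _ Bp xB; exists D; rewrite // inE Dp.
  by rewrite inE => /andP[_ /subsetP]; apply.
- by apply/forall_inP => i /L ->.
Qed.

Lemma pp_le_refl p : pp_le p p.
Proof. by apply/pp_leP; split=> // B x Bp xB; exists B. Qed.

Lemma pp_le_trans q p r : pp_le p q -> pp_le q r -> pp_le p r.
Proof.
move=> /pp_leP[H1 L1] /pp_leP[H2 L2]; apply/pp_leP; split=> [B x Br xB|i ri].
  have [D [Dq xD DB]] := H2 _ _ Br xB; have [E [Ep xE ED]] := H1 _ _ Dq xD.
  by exists E; split=> //; apply: subset_trans DB.
by rewrite L1 ?L2.
Qed.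

Lemma pp_eq p q : pp_blocks p = pp_blocks q ->
  (forall i, pp_label p i = pp_label q i) -> p = q.
Proof.
move=> bE lE; apply: val_inj => /=.
rewrite [pp_data p]surjective_pairing [pp_data q]surjective_pairing.
by congr (_, _); [exact: bE | apply/ffunP => i; exact: lE].
Qed.

Lemma pp_zeroE p x :
  (x \in pblock (pp_blocks p) None) = if x is Some i then pp_label p i == None else true.
Proof. by case: x => [i|]; rewrite -?pp_labelE // mem_pblock pp_cover. Qed.

Lemma pp_blocksE p :
  pp_blocks p = pblock (pp_blocks p) None |: nonzero_blocks p.
Proof.
apply/setP => B; rewrite !inE; have [->|BZ] /= := eqVneq B _.
  by rewrite pblock_mem ?pp_cover.
case Bp: (B \in _) => //=; apply/esym; apply: contraNN BZ => BN.
by rewrite (def_pblock (pp_triv p) Bp BN).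
Qed.

Lemma pp_le_anti p q : pp_le p q -> pp_le q p -> p = q.
Proof.
have sub a b : pp_le a b -> pp_le b a -> nonzero_blocks b \subset nonzero_blocks a.
  move=> /pp_leP[H1 _] /pp_leP[H2 _]; apply/subsetP => B Bb.
  have [x xB] := pp_nonempty (nonzeroW Bb).
  have [D [Da xD DB]] := H1 _ _ Bb xB; have [E [Eb xE ED]] := H2 _ _ Da xD.
  have EB := pp_blocks_inj (nonzeroW Eb) (nonzeroW Bb) xE xB.
  suff -> : B = D by [].
  by apply/eqP; rewrite eqEsubset DB -EB ED.
move=> pq qp.
have lE i : pp_label p i = pp_label q i.
  have [qi|/negPn/eqP qi] := boolP (pp_label q i != None).
    by case/pp_leP: pq => _ ->.
  have [pi|/negPn/eqP ->] := boolP (pp_label p i != None); last by rewrite qi.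
  by case/pp_leP: qp => _ ->.
apply: pp_eq => //; rewrite pp_blocksE [RHS]pp_blocksE; congr (_ |: _).
  by apply/setP => -[i|]; rewrite !pp_zeroE // lE.
by apply/eqP; rewrite eqEsubset !sub.
Qed.

Lemma pp_equivP p q : reflect
  (pp_blocks p = pp_blocks q /\
   forall B, B \in nonzero_blocks p -> exists g : G, forall i, Some i \in B ->
     pp_label p i = omap (mulg g) (pp_label q i))
  (pp_equiv p q).
Proof.
apply: (iffP andP) => [[/eqP bE /forall_inP H]|[bE H]]; split=> //.
- move=> B /H /existsP[g /forall_inP gP].
  by exists g => i /gP /eqP.
- exact/eqP.
- apply/forall_inP => B /H[g gP]; apply/existsP; exists g.
  by apply/forall_inP => i /gP ->.
Qed.

Lemma nonzero_eq p q : pp_blocks p = pp_blocks q ->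
  nonzero_blocks p = nonzero_blocks q.
Proof. by move=> bE; rewrite /nonzero_blocks bE. Qed.

Lemma pp_label_eq0 p q i : pp_blocks p = pp_blocks q ->
  (pp_label p i == None) = (pp_label q i == None).
Proof. by move=> bE; rewrite !pp_labelE bE. Qed.

Lemma pp_equiv_refl p : pp_equiv p p.
Proof.
apply/pp_equivP; split=> // B _; exists 1%g => i _.
by case: (pp_label p i) => //= x; rewrite mul1g.
Qed.

Lemma pp_equiv_sym p q : pp_equiv p q -> pp_equiv q p.
Proof.
case/pp_equivP => bE H; apply/pp_equivP; split=> // B.
rewrite -(nonzero_eq bE) => /H[g gP]; exists g^-1%g => i /gP ->.
by case: (pp_label _ i) => //= x; rewrite mulKg.
Qed.

Lemma pp_equiv_trans q p r : pp_equiv p q -> pp_equiv q r -> pp_equiv p r.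
Proof.
case/pp_equivP => bE H /pp_equivP[bE' H']; apply/pp_equivP; split.
  by rewrite bE.
move=> B Bp; have [g gP] := H _ Bp; rewrite (nonzero_eq bE) in Bp.
have [h hP] := H' _ Bp; exists (g * h)%g => i iB; rewrite gP // hP //.
by case: (pp_label _ i) => //= x; rewrite mulgA.
Qed.

Lemma dw_equiv x p q : p \in dw_class x -> (q \in dw_class x) = pp_equiv p q.
Proof.
case: x => C /= /imsetP[r _ ->]; rewrite !inE => rp; apply/idP/idP.
  exact/pp_equiv_trans/pp_equiv_sym.
exact: pp_equiv_trans.
Qed.

Lemma dw_inj x y p : p \in dw_class x -> p \in dw_class y -> x = y.
Proof.
move=> px py; apply: val_inj; apply/setP => q /=.
by rewrite (dw_equiv _ px) (dw_equiv _ py).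
Qed.

Lemma dw_rep x : exists p, p \in dw_class x.
Proof.
by case: x => C /= /imsetP[r _ ->]; exists r; rewrite inE pp_equiv_refl.
Qed.

Fact dw_of_subproof (p : prepartition) :
  [set q | pp_equiv p q] \in [set [set q | pp_equiv p q] | p : prepartition].
Proof. exact: imset_f. Qed.

Definition dw_of (p : prepartition) : dowling := Dowling (dw_of_subproof p).

Lemma mem_dw_of p q : (q \in dw_class (dw_of p)) = pp_equiv p q.
Proof. by rewrite inE. Qed.

Lemma pp_lift a b b' : pp_le a b -> pp_equiv b b' ->
  exists2 a', pp_equiv a a' & pp_le a' b'.
Proof.
move=> /pp_leP[H L] /pp_equivP[bE E].
pose l := [ffun i => if pp_label b i != None then pp_label b' i else pp_label a i].
have lP : partition (pp_blocks a) setT &&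
  [forall i, (l i == None) == (Some i \in pblock (pp_blocks a) None)].
  rewrite pp_partition; apply/forallP => i; rewrite ffunE -pp_labelE.
  case: ifP => // bi; rewrite -(pp_label_eq0 _ bE).
  by rewrite (L _ bi).
pose a' : prepartition := PrePartition (pp_data := (pp_blocks a, l)) lP.
have lE i : pp_label a' i = l i by [].
exists a'.
  apply/pp_equivP; split=> // D Da.
  have [/existsP[j /andP[jD bj]]|/existsPn no] :=
    boolP [exists j, (Some j \in D) && (pp_label b j != None)]; last first.
    exists 1%g => i iD; rewrite lE ffunE ifN; last by have := no i; rewrite iD.
    by case: (pp_label _ i) => //= x; rewrite mul1g.
  have [B Bb jB] := nonzero_block_of bj; have [g gP] := E _ Bb.
  exists g => i iD.
  have [D' [D'a jD' D'B]] := H _ _ Bb jB.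
  have iB : Some i \in B.
    by apply: (subsetP D'B); rewrite (pp_blocks_inj (nonzeroW D'a) (nonzeroW Da) jD' jD).
  have bi := pp_label_nonzero Bb iB.
  by rewrite lE ffunE bi -gP // L.
apply/pp_leP; split=> [B x|i]; first by rewrite -(nonzero_eq bE); apply: H.
by rewrite -(pp_label_eq0 _ bE) lE ffunE => ->.
Qed.

Lemma pp_le_equiv p q : pp_le p q -> pp_equiv p q -> p = q.
Proof.
move=> /pp_leP[_ L] /pp_equivP[bE _]; apply: pp_eq => // i.
have [/eqP qi|qi] := boolP (pp_label q i == None); last exact: L.
by rewrite qi; apply/eqP; rewrite (pp_label_eq0 _ bE) qi.
Qed.

Lemma dowling_leP x y : reflect
  (exists p q, [/\ p \in dw_class x, q \in dw_class y & pp_le p q])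
  (dowling_le x y).
Proof.
apply: (iffP exists_inP) => [[p px /exists_inP[q qy pq]]|[p [q [px qy pq]]]].
  by exists p, q.
by exists p => //; apply/exists_inP; exists q.
Qed.

Fact dowling_le_refl : reflexive dowling_le.
Proof.
move=> x; have [p px] := dw_rep x.
by apply/dowling_leP; exists p, p; rewrite pp_le_refl.
Qed.

Fact dowling_le_anti : antisymmetric dowling_le.
Proof.
move=> x y /andP[/dowling_leP[p [q [px qy pq]]] /dowling_leP[q' [p' [q'y p'x qp']]]].
have [p1 pp1 p1q'] : exists2 p1, pp_equiv p p1 & pp_le p1 q'.
  by apply: pp_lift pq _; rewrite -(dw_equiv _ qy).
have p1x : p1 \in dw_class x by rewrite (dw_equiv _ px).
have E : p1 = p'.
  by apply: pp_le_equiv (pp_le_trans p1q' qp') _; rewrite -(dw_equiv _ p1x).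
subst p1; have E : p' = q' by apply: pp_le_anti.
by subst q'; apply: dw_inj p'x q'y.
Qed.

Fact dowling_le_trans : transitive dowling_le.
Proof.
move=> y x z /dowling_leP[p [q [px qy pq]]] /dowling_leP[q' [r [q'y rz qr]]].
have [p' pp' p'q'] : exists2 p', pp_equiv p p' & pp_le p' q'.
  by apply: pp_lift pq _; rewrite -(dw_equiv _ qy).
apply/dowling_leP; exists p', r; split=> //.
  by rewrite (dw_equiv _ px).
exact: pp_le_trans qr.
Qed.

Fact dowling_display : Order.disp_t. Proof. exact: (Order.Disp tt tt). Qed.

HB.instance Definition _ := Order.Le_isPOrder.Build dowling_display dowling
  dowling_le_refl dowling_le_anti dowling_le_trans.

Lemma pblock_preim (rT : eqType) (f : option 'I_n -> rT) x y :
  (y \in pblock (preim_partition f setT) x) = (f x == f y).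
Proof.
rewrite (pblock_equivalence_partition (R := fun x y => f x == f y)) ?inE //.
by split=> // /eqP ->.
Qed.

Fact pp_singletons_subproof (f : 'I_n -> G) :
  let b := preim_partition id [set: option 'I_n] in
  let l := [ffun i => Some (f i)] in
  partition b setT && [forall i, (l i == None) == (Some i \in pblock b None)].
Proof.
apply/andP; split; first exact: preim_partitionP.
apply/forallP => i; by rewrite ffunE pblock_preim.
Qed.

Definition pp_singletons (f : 'I_n -> G) : prepartition :=
  PrePartition (pp_data := (_, _)) (pp_singletons_subproof f).

Fact pp_zero_subproof :
  let b := preim_partition (fun=> tt) [set: option 'I_n] in
  let l := [ffun i : 'I_n => None : option G] in
  partition b setT && [forall i, (l i == None) == (Some i \in pblock b None)].
Proof.
apply/andP; split; first exact: preim_partitionP.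
apply/forallP => i; by rewrite ffunE pblock_preim.
Qed.

Definition pp_zero : prepartition :=
  PrePartition (pp_data := (_, _)) pp_zero_subproof.

Definition dowling_bot : dowling := dw_of (pp_singletons (fun=> 1%g)).
Definition dowling_top : dowling := dw_of pp_zero.

Lemma singletons_blocks f B : B \in pp_blocks (pp_singletons f) ->
  exists x, B = [set x].
Proof.
case/imsetP => x _ ->; exists x; apply/setP => y.
by rewrite !inE /= eq_sym.
Qed.

Fact dowling_le0x (x : dowling) : (dowling_bot <= x)%O.
Proof.
have [q qx] := dw_rep x; apply/dowling_leP.
exists (pp_singletons (fun i => odflt 1%g (pp_label q i))), q; split=> //.
  rewrite mem_dw_of; apply/pp_equivP; split=> // B /nonzeroW/singletons_blocks[y ->].
  case: y => [i|]; last by exists 1%g => i; rewrite inE.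
  exists (odflt 1%g (pp_label q i))^-1%g => j; rewrite inE => /eqP[->].
  by rewrite /pp_label /= !ffunE /= mulVg.
apply/pp_leP; split=> [B y Bq yB|i]; last first.
  by rewrite [in LHS]/pp_label /= ffunE; case: (pp_label q i).
exists [set y]; rewrite set11 sub1set; split=> //.
rewrite inE; apply/andP; split.
  by apply/imsetP; exists y => //; apply/setP => z; rewrite !inE /= eq_sym.
by rewrite inE; apply: contraTneq yB => <-; move: Bq; rewrite inE => /andP[].
Qed.
HB.instance Definition _ :=
  Order.hasBottom.Build dowling_display dowling dowling_le0x.

Fact dowling_lex1 (x : dowling) : (x <= dowling_top)%O.
Proof.
have [p px] := dw_rep x; apply/dowling_leP; exists p, pp_zero.
rewrite mem_dw_of pp_equiv_refl; split=> //; apply/pp_leP; split=> [B y|i].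
  rewrite inE => /andP[/imsetP[z _ ->]]; by rewrite !inE.
by rewrite /pp_label /= ffunE.
Qed.
HB.instance Definition _ :=
  Order.hasTop.Build dowling_display dowling dowling_lex1.

End Dowling.

(* Every poset is taken up to isomorphism; the dowling disjunct for 'Z_2, the  *)
(* additive group Z/2Z, is the braid matroid of type B.                        *)
Definition listed_poset d (P : finTBPOrderType d) : Prop :=
  (exists n k : nat, (1 <= k <= n)%N /\ poset_iso P (induced (uniform_lattice n k)))
  \/ (exists (F : finFieldType) (n : nat),
        poset_iso P (induced (projective_lattice F n)) \/
        exists k : nat, (k <= n)%N /\ poset_iso P (induced (qniform_lattice F n k)))
  \/ (exists (F : finFieldType) (n : nat),
        selection_of P (induced (affine_lattice F n)))
  \/ (exists n : nat, selection_of P (setpart n))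
  \/ (exists n : nat, (1 <= n)%N /\ selection_of P (dowling n 'Z_2))
  \/ (exists (n : nat) (G : finGroupType), (1 <= n)%N /\
        selection_of P (dowling n G))
  \/ (exists d' (L : finTBLatticeType d'),
        [/\ geometric L, supersolvable L, rank_uniform L & selection_of P L]).

(* Main.v *)
Require Import Defs.
From HB Require Import structures.
From mathcomp Require Import all_boot all_order all_fingroup all_algebra.
From mathcomp Require Import reals complex.
From mathcomp Require Import ring lra zify.

(** Everything reduces to counting elements above a given one.  In a poset of
rank r let the corank of s be r minus its rank.  A poset is [resolvable] when
the number of elements of corank i above an element of corank n depends on n
and i only, and is a sum over walks from n down to i, one unit at a time, whose
steps carry weakly increasing labels with nonnegative weights.  All the listed
posets are resolvable or are rank-selected subposets of a resolvable poset:
a uniform matroid selects ranks in a Boolean lattice, a q-niform matroid in a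
projective geometry.

Let P consist of the elements of a resolvable poset at the selected ranks.
Möbius inversion turns the definition of the Chow polynomial into
  H_s = 1 + sum over w > s of (x + x^2 + ... + x^(rk w - rk s - 1)) H_w
([chow_from_rec]), and enumerating chains by their least element gives a
recursion of the same kind for the h-polynomial ([above_sumE]).  The summands
depend on coranks only, so walks can be substituted for elements.  Recording
the smallest label still allowed then makes both recursions linear and one step
long: the h-polynomial enumerates words of labels by their descents at the
selected coranks ([hvec]), and the Chow polynomials, divided by a power of
1 + x, enumerate by y = x / (1 + x)^2 the words in which no two such descents
follow each other ([chow_pair]).  The latter is a gamma-expansion.

Real-rootedness is proved by evaluating at one complex number y at a time.  Two
values are related, [interl], when the imaginary parts of g / f and of
y f / g have weakly the sign of the imaginary part of y.  This is additive in
each argument, survives nonnegative factors, and passes from (f, g) to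
(g, y f); hence each step of the recursions keeps the entries pairwise related
([hvec_interl], [chow_pair_interl]).  Related values with sum 0 vanish if y is
not real, so the polynomials do not vanish there; they are positive for
y >= 0.  Thus y < 0 at a zero.  For the Chow polynomials a further argument is
needed: x / (1 + x)^2 is real only if x is real or |x| = 1, and it is positive
in the second case ([real_root_of_quotient]).

It remains to resolve the families.  Except at the bottom of an affine geometry
the weight of label k is a number e k, and being resolvable means that the
counts obey N(n + 1, i) = N(n, i - 1) + e_i N(n, i).
 - Boolean lattices have e = 1 and binomial coefficients.
 - Projective geometries have e k = q^k: for a hyperplane H containing s, the
   flats above s are those below H and those meeting H in a hyperplane of
   themselves, and both parts are counted from a cover of s outside H
   ([local_step]).
 - An affine geometry looks like a projective one above each nonempty flat; the
   weights above the empty flat solve a triangular system ([affine_res]).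
 - For set partitions e k = k + 1, and for Dowling geometries e k = 1 + |G| k.
   Functions into a set with t points are counted by their kernels, which
   expands t^n in the products of the t - e_j; these form a basis of the
   polynomials ([kernel_method]).
 - In a supersolvable geometric lattice a left modular coatom plays the part of
   the hyperplane, and rank-uniformity makes the counts independent of the
   element ([modular_count]). *)

Set Implicit Arguments.
Unset Strict Implicit.
Unset Printing Implicit Defensive.

Import Order.TTheory GRing.Theory Num.Theory.
Import Order.DefaultSetSubsetOrder.
Local Open Scope ring_scope.

(** * Interlacing of complex values and descent recursions *)

Section Interlacing.
Variables (C : numClosedFieldType) (y : C).
Implicit Types f g : C.

(** For nonzero values and y in the upper half plane: the directions of f, g and
y f follow each other by turns of at most a half turn.  Multiplying by
conjugates instead of dividing keeps the relation additive when values vanish. *)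
Definition interl f g : bool :=
  (0 <= 'Im y * 'Im (g * f^*)) && (0 <= 'Im y * 'Im (y * f * g^*)).

Lemma interl_refl f : interl f f.
Proof.
have n2 : `|f| ^+ 2 \is Num.real by rewrite rpredX ?normr_real.
rewrite /interl -mulrA -normCK (Creal_ImP _ n2) mulr0 lexx /= ImMr // mulrA.
by rewrite mulr_ge0 ?exprn_ge0 // -[_ * _]expr2 real_exprn_even_ge0 ?Creal_Im.
Qed.

Lemma interlDl f1 f2 g : interl f1 g -> interl f2 g -> interl (f1 + f2) g.
Proof.
case/andP=> a1 b1 /andP[a2 b2]; rewrite /interl rmorphD !(mulrDr, mulrDl) !raddfD.
by rewrite !(mulrDr, mulrDl) !addr_ge0.
Qed.

Lemma interlDr f g1 g2 : interl f g1 -> interl f g2 -> interl f (g1 + g2).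
Proof.
case/andP=> a1 b1 /andP[a2 b2]; rewrite /interl rmorphD !(mulrDr, mulrDl) !raddfD.
by rewrite !(mulrDr, mulrDl) !addr_ge0.
Qed.

Lemma interl0l g : interl 0 g.
Proof. by rewrite /interl rmorph0 !(mulr0, mul0r) raddf0 mulr0 lexx. Qed.

Lemma interl0r f : interl f 0.
Proof. by rewrite /interl rmorph0 !(mulr0, mul0r) raddf0 mulr0 lexx. Qed.

Lemma interlZ a b f g : 0 <= a -> 0 <= b -> interl f g -> interl (a * f) (b * g).
Proof.
move=> a0 b0 /andP[h1 h2].
have e1 : b * g * (a * f)^* = (a * b) * (g * f^*).
  by rewrite rmorphM /= (CrealP (ger0_real a0)); ring.
have e2 : y * (a * f) * (b * g)^* = (a * b) * (y * f * g^*).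
  by rewrite rmorphM /= (CrealP (ger0_real b0)); ring.
have ab0 := mulr_ge0 a0 b0.
have im z : 'Im y * 'Im (a * b * z) = a * b * ('Im y * 'Im z).
  by rewrite ImMl ?ger0_real // mulrCA.
by rewrite /interl e1 e2 !im !(mulr_ge0 ab0).
Qed.

Lemma interl_shift f g : interl f g -> interl g (y * f).
Proof.
case/andP=> h1 h2; rewrite /interl h2 /=.
have -> : y * g * (y * f)^* = `|y| ^+ 2 * (g * f^*) by rewrite normCK rmorphM /=; ring.
rewrite ImMl ?rpredX ?normr_real // mulrCA mulr_ge0 ?exprn_ge0 //.
Qed.

Lemma interl_mul f g : interl f g -> interl (y * f) (y * g).
Proof. by move/interl_shift/interl_shift. Qed.

Lemma interl_sum (I J : finType) (p : pred I) (q : pred J) (f : I -> C) (g : J -> C) :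
  (forall i j, p i -> q j -> interl (f i) (g j)) ->
  interl (\sum_(i | p i) f i) (\sum_(j | q j) g j).
Proof.
move=> h; elim/big_ind: _ => [|f1 f2|i pi]; [exact: interl0l|exact: interlDl|].
by elim/big_ind: _ => [|g1 g2|j qj]; [exact: interl0r|exact: interlDr|exact: h].
Qed.

(** If g = - f then y f / g = - y, on the wrong side of the real axis. *)
Lemma interl_cancel f g : 'Im y != 0 -> interl f g -> f + g = 0 -> f = 0.
Proof.
move=> y0 /andP[_ h] /eqP; rewrite addr_eq0 => /eqP fE; subst f.
have e : y * - g * g^* = - `|g| ^+ 2 * y by rewrite normCK; ring.
have y2 : 0 < 'Im y ^+ 2 by rewrite real_exprn_even_gt0 ?Creal_Im.
move: h; rewrite e ImMl ?rpredN ?rpredX ?normr_real // mulrCA -expr2.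
rewrite mulNr oppr_ge0 pmulr_lle0 // real_exprn_even_le0 ?normr_real //=.
by rewrite normr_eq0 => /eqP ->; rewrite oppr0.
Qed.

End Interlacing.

Section Recursion.
Variables (C : numClosedFieldType) (y : C).
Variables (T : pred nat) (lam : nat -> nat -> C).
Hypothesis lam_ge0 : forall n k, 0 <= lam n k.
Hypothesis lam1 : forall n, lam n 0%N = 1.

(** Words k, j_(n-1), ..., j_0 of labels j_m <= m, with weight [lam m] for j_m and
y for each descent.  The comparison of j_m with its left neighbour takes place
at corank m + 1.  Descents are allowed only at coranks in [T], and not twice in
a row among these.  The first component collects the words whose leftmost
comparison at a corank in [T] is not a descent, the second the others. *)
Fixpoint chow_pair (n : nat) : (nat -> C) * (nat -> C) :=
  if n is m.+1 then
    let u := (chow_pair m).1 in let d := (chow_pair m).2 in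
    if T m.+1 then
      (fun k => \sum_(j < m.+1 | (k <= j)%N) lam m j * (u j + d j),
       fun k => y * \sum_(j < m.+1 | (j < k)%N) lam m j * u j)
    else
      (fun k => \sum_(j < m.+1 | (k <= j)%N) lam m j * u j,
       fun k => \sum_(j < m.+1 | (k <= j)%N) lam m j * d j)
  else (fun k => (k == 0%N)%:R, fun=> 0).

(** The same words without the ban on consecutive descents. *)
Fixpoint hvec (n : nat) : nat -> C :=
  if n is m.+1 then
    fun k => \sum_(j < m.+1 | (k <= j)%N) lam m j * hvec m j
       + (if T m.+1 then y * \sum_(j < m.+1 | (j < k)%N) lam m j * hvec m j else 0)
  else fun k => (k == 0%N)%:R.

Local Notation "f <~ g" := (interl y f g) (at level 70).

Lemma delta_interl (i j : nat) : (i == 0%N)%:R <~ (j == 0%N)%:R.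
Proof.
case: eqP => _; last exact: interl0l.
by case: eqP => _; [exact: interl_refl|exact: interl0r].
Qed.

Lemma suffix_split (M k l : nat) (F : nat -> C) : (k <= l)%N ->
  \sum_(j < M | (k <= j)%N) F j =
  \sum_(j < M | (k <= j < l)%N) F j + \sum_(j < M | (l <= j)%N) F j.
Proof.
move=> kl; rewrite (bigID (fun j : 'I_M => (j < l)%N)) /=; congr (_ + _).
by apply: eq_bigl => j; rewrite -leqNgt andbC; case: leqP => //= /(leq_trans kl).
Qed.

Lemma prefix_split (M k l : nat) (F : nat -> C) : (k <= l)%N ->
  \sum_(j < M | (j < l)%N) F j =
  \sum_(j < M | (j < k)%N) F j + \sum_(j < M | (k <= j < l)%N) F j.
Proof.
move=> kl; rewrite (bigID (fun j : 'I_M => (j < k)%N)) /=; congr (_ + _).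
  by apply: eq_bigl => j; rewrite andbC; case: ltnP => //= /leq_trans ->.
by apply: eq_bigl => j; rewrite -leqNgt andbC.
Qed.

Lemma suffix_interl M (F : nat -> C) : (forall i j, (i <= j)%N -> F i <~ F j) ->
  forall i j, (i <= j)%N ->
  \sum_(m < M | (i <= m)%N) F m <~ \sum_(m < M | (j <= m)%N) F m.
Proof.
move=> FF i j ij; rewrite (suffix_split _ _ ij); apply: interlDl (interl_refl _ _).
apply: interl_sum => a b /andP[_ aj] jb; apply: FF.
exact: leq_trans (ltnW aj) jb.
Qed.

(** When the prefix and the suffix overlap, the common part is related to
itself. *)
Lemma prefix_suffix_interl M (F : nat -> C) : (forall i j, (i <= j)%N -> F i <~ F j) ->
  forall i j, \sum_(m < M | (m < i)%N) F m <~ \sum_(m < M | (j <= m)%N) F m.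
Proof.
move=> FF i j; have [ij|/ltnW ji] := leqP i j.
  apply: interl_sum => a b ai jb; apply: FF.
  exact: leq_trans (ltnW ai) (leq_trans ij jb).
rewrite (prefix_split _ _ ji) (suffix_split _ _ ji).
set S := \sum_(m < M | (j <= m < i)%N) F m.
have h1 : \sum_(m < M | (m < j)%N) F m <~ S.
  by apply: interl_sum => a b aj /andP[jb _]; apply/FF/(leq_trans (ltnW aj) jb).
have h2 : \sum_(m < M | (m < j)%N) F m <~ \sum_(m < M | (i <= m)%N) F m.
  apply: interl_sum => a b aj ib.
  exact/FF/(leq_trans (ltnW aj) (leq_trans ji ib)).
have h3 : S <~ \sum_(m < M | (i <= m)%N) F m.
  by apply: interl_sum => a b /andP[_ ai] ib; apply/FF/(leq_trans (ltnW ai) ib).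
exact: interlDl (interlDr h1 h2) (interlDr (interl_refl y S) h3).
Qed.

(** What happens between index i and index j >= i at a selected corank: X is the
prefix before i, Z the suffix from j, and the middle part enters as V in the
suffix sum at i but as y U in the prefix sum at j.  Both sides share
P = Z + y X, and V, P, y U are related in this order. *)
Lemma exchange_interl X U V Z : X <~ V -> X <~ U -> V <~ Z -> U <~ Z -> U <~ V ->
  V + Z + y * X <~ Z + y * (X + U).
Proof.
move=> XV XU VZ UZ UV; rewrite -addrA mulrDr [Z + (_ + _)]addrA.
set P := Z + y * X.
have VP : V <~ P := interlDr VZ (interl_shift XV).
have VU : V <~ y * U := interl_shift UV.
have PU : P <~ y * U := interlDl (interl_shift UZ) (interl_mul XU).
exact: interlDl (interlDr VP VU) (interlDr (interl_refl y P) PU).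
Qed.

Lemma hvec_interl n i j : (i <= j)%N -> hvec n i <~ hvec n j.
Proof.
elim: n i j => [|n IHn] i j ij /=; first exact: delta_interl.
pose F m := lam n m * hvec n m.
have FF a b : (a <= b)%N -> F a <~ F b by move=> ab; apply: interlZ => //; apply: IHn.
case: ifP => _; last by rewrite !addr0; apply: (@suffix_interl _ F).
rewrite (suffix_split _ F ij) (prefix_split _ F ij).
apply: exchange_interl;
  [apply: interl_sum => a b..|exact: interl_refl].
- by move=> ai /andP[ib _]; apply/FF/(leq_trans (ltnW ai) ib).
- by move=> ai /andP[ib _]; apply/FF/(leq_trans (ltnW ai) ib).
- by case/andP=> _ aj jb; apply/FF/(leq_trans (ltnW aj) jb).
- by case/andP=> _ aj jb; apply/FF/(leq_trans (ltnW aj) jb).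
Qed.

(** The first term has weight 1, and it is related to the sum of the others. *)
Lemma first_eq0 n (F : nat -> C) : 'Im y != 0 ->
  (forall i j, (i <= j)%N -> F i <~ F j) ->
  \sum_(j < n.+1) lam n j * F j = 0 -> F 0%N = 0.
Proof.
move=> y0 FF; rewrite big_ord_recl lam1 mul1r; apply: (interl_cancel y0).
rewrite -[X in X <~ _](big_pred1_eq +%R tt (fun=> F 0%N)).
apply: interl_sum => a b _ _; rewrite -[F 0%N]mul1r.
by apply: interlZ => //; apply: FF.
Qed.

Lemma hvec_neq0 n : 'Im y != 0 -> hvec n 0%N != 0.
Proof.
move=> y0; elim: n => [|n IHn] /=; first by rewrite oner_eq0.
have -> : (if T n.+1 then y * \sum_(j < n.+1 | (j < 0)%N) lam n j * hvec n j
  else 0) = 0 by rewrite big_pred0_eq mulr0 if_same.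
rewrite addr0; apply: contra IHn => /eqP s0; apply/eqP.
exact: first_eq0 y0 (@hvec_interl n) s0.
Qed.

Local Notation u n := (chow_pair n).1.
Local Notation d n := (chow_pair n).2.

(** The sums u + d must be carried along, since they are what the next suffix
sums are made of; the relation of u to d for all pairs of indices is what the
ban on consecutive descents provides. *)
Lemma chow_pair_interl n :
  [/\ forall i j, (i <= j)%N -> u n i <~ u n j,
      forall i j, (i <= j)%N -> u n i + d n i <~ u n j + d n j &
      forall i j, u n i <~ d n j].
Proof.
elim: n => [|n [IHu IHc IHd]] /=.
  split=> i j; first by move=> _; exact: delta_interl.
    by move=> _; rewrite !addr0; exact: delta_interl.
  exact: interl0r.
pose U j := lam n j * u n j; pose D j := lam n j * d n j.
pose F j := lam n j * (u n j + d n j).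
have FE j : F j = U j + D j by rewrite -mulrDr.
have UU a b : (a <= b)%N -> U a <~ U b by move=> ab; apply: interlZ => //; apply: IHu.
have FF a b : (a <= b)%N -> F a <~ F b by move=> ab; apply: interlZ => //; apply: IHc.
have UD a b : U a <~ D b by apply: interlZ.
have UF a b : (a <= b)%N -> U a <~ F b.
  by move=> ab; rewrite FE; apply: interlDr => //; apply: UU.
have sumF M (p : pred 'I_M) :
    \sum_(j < M | p j) F j = \sum_(j < M | p j) U j + \sum_(j < M | p j) D j.
  by rewrite -big_split /=; apply: eq_bigr => j _; apply: FE.
have SUF M (p : pred 'I_M) : \sum_(j < M | p j) U j <~ \sum_(j < M | p j) F j.
  by rewrite sumF; apply: interlDr; [exact: interl_refl|apply: interl_sum].
case: ifP => _ /=; split=> i j.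
- by move=> ij; apply: (@suffix_interl _ F).
- move=> ij; rewrite (suffix_split _ F ij) (prefix_split _ U ij).
  apply: exchange_interl;
    [apply: interl_sum => a b..|exact: SUF].
  + by move=> ai /andP[ib _]; apply/UF/(leq_trans (ltnW ai) ib).
  + by move=> ai /andP[ib _]; apply/UU/(leq_trans (ltnW ai) ib).
  + by case/andP=> _ aj jb; apply/FF/(leq_trans (ltnW aj) jb).
  + by case/andP=> _ aj jb; apply/UF/(leq_trans (ltnW aj) jb).
- apply: interl_shift; rewrite sumF.
  have h2 : \sum_(m < n.+1 | (m < j)%N) U m <~ \sum_(m < n.+1 | (i <= m)%N) D m.
    by apply: interl_sum => a b _ _; apply: UD.
  exact: interlDr (prefix_suffix_interl n.+1 UU j i) h2.
- by move=> ij; apply: (@suffix_interl _ U).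
- move=> ij; rewrite -!sumF; exact: (@suffix_interl _ F).
- by apply: interl_sum => a b _ _; apply: UD.
Qed.

Lemma u_neq0 n : 'Im y != 0 -> u n 0%N != 0.
Proof.
move=> y0; elim: n => [|n IHn] /=; first by rewrite oner_eq0.
have [IHu IHc IHd] := chow_pair_interl n.
apply: contra IHn; case: ifP => _ /= /eqP s0; apply/eqP.
  by apply: (interl_cancel y0 (IHd 0%N 0%N)); apply: first_eq0 IHc s0.
exact: first_eq0 IHu s0.
Qed.

Lemma sum_u_neq0 n : 'Im y != 0 -> \sum_(j < n.+1) lam n j * u n j != 0.
Proof.
move=> y0; apply: contraNneq (u_neq0 n y0) => s0; apply/eqP.
by apply: first_eq0 s0 => //; case: (chow_pair_interl n).
Qed.

Section Positive.
Hypothesis y_ge0 : 0 <= y.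

Lemma hvec_ge0 n k : 0 <= hvec n k.
Proof.
elim: n k => [|n IHn] k /=; first by rewrite ler0n.
apply: addr_ge0; first by apply: sumr_ge0 => j _; apply: mulr_ge0.
case: ifP => // _; apply: mulr_ge0 => //.
by apply: sumr_ge0 => j _; apply: mulr_ge0.
Qed.

Lemma first_le_sum n (F : nat -> C) : (forall i, 0 <= F i) ->
  F 0%N <= \sum_(j < n.+1) lam n j * F j.
Proof.
move=> F0; rewrite big_ord_recl lam1 mul1r lerDl.
by apply: sumr_ge0 => j _; apply: mulr_ge0.
Qed.

Lemma hvec_gt0 n : 0 < hvec n 0%N.
Proof.
elim: n => [|n IHn] /=; first by rewrite ltr01.
apply: lt_le_trans IHn _; apply: le_trans (first_le_sum n (hvec_ge0 n)) _.
rewrite lerDl; case: ifP => // _; apply: mulr_ge0 => //.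
by apply: sumr_ge0 => j _; apply: mulr_ge0 => //; apply: hvec_ge0.
Qed.

Lemma chow_pair_ge0 n k : 0 <= u n k /\ 0 <= d n k.
Proof.
elim: n k => [|n IHn] k /=; first by rewrite ler0n lexx.
have IHu j := (IHn j).1; have IHd j := (IHn j).2.
by case: ifP => _ /=; split; rewrite ?mulr_ge0 //; apply: sumr_ge0 => j _;
  apply: mulr_ge0 => //; apply: addr_ge0.
Qed.

Lemma u_gt0 n : 0 < u n 0%N.
Proof.
elim: n => [|n IHn] /=; first by rewrite ltr01.
have IHu j := (chow_pair_ge0 n j).1; have IHd j := (chow_pair_ge0 n j).2.
case: ifP => _ /=; apply: lt_le_trans IHn _; last exact: (first_le_sum n IHu).
apply: (@le_trans _ _ (u n 0%N + d n 0%N)); first by rewrite lerDl.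
by apply: (first_le_sum n (F := fun j => u n j + d n j)) => j; apply: addr_ge0.
Qed.

Lemma sum_u_gt0 n : 0 < \sum_(j < n.+1) lam n j * u n j.
Proof.
apply: lt_le_trans (u_gt0 n) _.
by apply: first_le_sum => j; case: (chow_pair_ge0 n j).
Qed.

End Positive.

End Recursion.

(** * Walk sums and their generating functions *)

Section Resolution.
Variables (C : numClosedFieldType) (lam : nat -> nat -> C).

(** Walks from n down to i.  The step from m + 1 to m carries a label j <= m of
weight [lam m j]; labels weakly increase along the walk, starting from at
least k. *)
Fixpoint resolution (n k i : nat) : C :=
  if n is m.+1 then
    (i == n)%:R + \sum_(j < m.+1 | (k <= j)%N) lam m j * resolution m j i
  else (i == 0%N)%:R.

Lemma res_gt n k i : (n < i)%N -> resolution n k i = 0.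
Proof.
elim: n k => [|n IHn] k /=; first by case: i.
move=> ni; rewrite gtn_eqF // add0r big1 // => j _.
by rewrite IHn ?mulr0 // ltnW.
Qed.

Variable T : pred nat.

(** Coranks in [T] are renumbered by [tau]: these are the coranks in the
rank-selected poset. *)
Definition tau (n : nat) : nat := \sum_(i < n) T i.+1.

Lemma tau0 : tau 0 = 0%N. Proof. by rewrite /tau big_ord0. Qed.

Lemma tauS n : tau n.+1 = (tau n + T n.+1)%N.
Proof. by rewrite /tau big_ord_recr. Qed.

Lemma leq_tau m n : (m <= n)%N -> (tau m <= tau n)%N.
Proof.
move=> mn; elim: n mn => [|n IHn]; first by rewrite leqn0 => /eqP ->.
rewrite leq_eqVlt => /orP[/eqP -> //|]; rewrite ltnS => /IHn h.
by rewrite tauS (leq_trans h) ?leq_addr.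
Qed.

Definition res_sum n k (psi : nat -> C) : C :=
  \sum_(i < n.+1 | T i) resolution n k i * psi i.

Lemma eq_res_sum n k f g : (forall i, (i <= n)%N -> f i = g i) ->
  res_sum n k f = res_sum n k g.
Proof. by move=> fg; apply: eq_bigr => i _; rewrite fg // -ltnS. Qed.

Lemma res_sumZ n k a f : res_sum n k (fun i => a * f i) = a * res_sum n k f.
Proof. by rewrite mulr_sumr; apply: eq_bigr => i _; rewrite mulrCA. Qed.

Lemma res_sumD n k f g :
  res_sum n k (fun i => f i + g i) = res_sum n k f + res_sum n k g.
Proof. by rewrite -big_split; apply: eq_bigr => i _; rewrite mulrDr. Qed.

Lemma res_sumS n k psi : res_sum n.+1 k psi =
  (if T n.+1 then psi n.+1 else 0) +
  \sum_(j < n.+1 | (k <= j)%N) lam n j * res_sum n j psi.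
Proof.
rewrite /res_sum [LHS]big_mkcond big_ord_recr /= eqxx addrC; congr (_ + _).
  case: ifP => // _; rewrite big1 ?addr0 ?mul1r // => j _.
  by rewrite res_gt ?mulr0.
rewrite -big_mkcond /=; under eq_bigr => i _.
  rewrite ltn_eqF // add0r mulr_suml; over.
rewrite exchange_big /=; apply: eq_bigr => j _.
by rewrite mulr_sumr; apply: eq_bigr => i _; rewrite mulrA.
Qed.

Hypothesis lam1 : forall n, lam n 0%N = 1.
Hypothesis T0 : T 0%N.

Lemma res_sum0 k psi : res_sum 0 k psi = psi 0%N.
Proof. by rewrite /res_sum big_mkcond big_ord1 T0 /= mul1r. Qed.

Lemma split_at m k (F : nat -> C) : \sum_(j < m) F j =
  \sum_(j < m | (j < k)%N) F j + \sum_(j < m | (k <= j)%N) F j.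
Proof.
rewrite (bigID (fun j : 'I_m => (j < k)%N)) /=; congr (_ + _).
by apply: eq_bigl => j; rewrite -leqNgt.
Qed.

Lemma suffix_delta m k :
  \sum_(j < m.+1 | (k <= j)%N) lam m j * (j == 0%N :> nat)%:R = (k == 0%N)%:R.
Proof.
rewrite big_mkcond big_ord_recl /= leqn0 lam1 mul1r big1 ?addr0; first by case: eqP.
by move=> j _; rewrite mulr0 if_same.
Qed.

Section Chow.
Variable x : C.
Let w := 1 + x.
Hypothesis w0 : w != 0.
Let y := x / w ^+ 2.

Local Notation u n := (chow_pair y T lam n).1.
Local Notation d n := (chow_pair y T lam n).2.

(** The Chow polynomial of an interval from an element of corank n to the top.
The words now start with a label j_m that is not compared with anything; the
power of 1 + x clears the denominators of y. *)
Definition chow_seq (n : nat) : C :=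
  if n is m.+1 then w ^+ tau m * \sum_(j < m.+1) lam m j * u m j else 1.

Definition geo (m : nat) : C := \sum_(j < m) x ^+ j.

Let b n k := res_sum n k (fun i => geo (tau n - tau i) * chow_seq i).
Let a n k := res_sum n k (fun i => x ^+ (tau n - tau i) * chow_seq i).

Lemma geoS m : geo m.+1 = geo m + x ^+ m.
Proof. by rewrite /geo big_ord_recr. Qed.

Let bS n k : b n.+1 k =
  \sum_(j < n.+1 | (k <= j)%N) lam n j * (b n j + (if T n.+1 then a n j else 0)).
Proof.
rewrite /b res_sumS subnn /geo big_ord0 mul0r if_same add0r.
apply: eq_bigr => j _; congr (_ * _).
rewrite -[if _ then _ else _](_ : res_sum n j (fun i =>
  (T n.+1)%:R * (x ^+ (tau n - tau i) * chow_seq i)) = _); last first.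
  by rewrite res_sumZ; case: (T _); rewrite ?mul1r ?mul0r.
rewrite -res_sumD; apply: eq_res_sum => i i_n; have ti := leq_tau i_n.
rewrite tauS; case: (T _); rewrite ?addn0 ?mul0r ?addr0 ?mul1r //.
by rewrite addn1 subSn // -/(geo _) geoS mulrDl.
Qed.

Let aS n k : a n.+1 k = (if T n.+1 then chow_seq n.+1 else 0) +
  x ^+ T n.+1 * \sum_(j < n.+1 | (k <= j)%N) lam n j * a n j.
Proof.
rewrite /a res_sumS subnn expr0 mul1r; congr (_ + _).
rewrite mulr_sumr; apply: eq_bigr => j _; rewrite mulrCA; congr (_ * _).
rewrite -res_sumZ; apply: eq_res_sum => i i_n; have ti := leq_tau i_n.
by rewrite tauS addnC -addnBA // exprD mulrA.
Qed.

(** With b and a the sums over selected end points weighted by geometric sums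
and by powers of x, the pair (u, d) is an affine change of coordinates of
(b, a), up to powers of 1 + x.  The prefix sum in d is the difference between
the complete sum, which is [chow_seq], and the suffix sum. *)
Let chow_pairE n k : (k <= n)%N ->
  w ^+ tau n * u n k = x * b n k + (k == 0%N)%:R /\
  w ^+ (tau n).+1 * d n k = x * (a n k - x * b n k - (k == 0%N)%:R).
Proof.
elim: n k => [|n IHn] k kn.
  move: kn; rewrite leqn0 => /eqP ->; rewrite /b /a.
  by rewrite !res_sum0 /= tau0 /geo big_ord0 !expr0; split; ring.
have IHu (j : 'I_n.+1) : w ^+ tau n * u n j = x * b n j + (j == 0%N :> nat)%:R.
  by apply: (IHn j _).1; rewrite -ltnS.
have IHd (j : 'I_n.+1) : w ^+ (tau n).+1 * d n j =
    x * (a n j - x * b n j - (j == 0%N :> nat)%:R).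
  by apply: (IHn j _).2; rewrite -ltnS.
rewrite /= bS aS tauS; case: ifP => _ /=; last first.
  rewrite addn0 expr0 mul1r add0r -(suffix_delta n k); split.
    rewrite !mulr_sumr -big_split /=; apply: eq_bigr => j _.
    by rewrite addr0 mulrCA IHu; ring.
  rewrite !mulr_sumr -!sumrB mulr_sumr /=; apply: eq_bigr => j _.
  by rewrite addr0 mulrCA IHd; ring.
rewrite addn1 expr1 -(suffix_delta n k); split.
  rewrite !mulr_sumr -big_split /=; apply: eq_bigr => j _.
  rewrite mulrCA mulrDr IHd exprS -mulrA IHu /w; ring.
have -> : w ^+ (tau n).+2 * (y * \sum_(j < n.+1 | (j < k)%N) lam n j * u n j) =
   x * \sum_(j < n.+1 | (j < k)%N) lam n j * (w ^+ tau n * u n j).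
  under [in RHS]eq_bigr => j _ do rewrite mulrCA.
  by rewrite -mulr_sumr !exprS /y; field; exact: w0.
congr (_ * _).
rewrite (eq_bigr (fun j : 'I__ => lam n j * (x * b n j + (j == 0%N :> nat)%:R))); last first.
  by move=> j _; rewrite IHu.
have -> : w ^+ tau n * (\sum_(j < n.+1) lam n j * u n j) =
   \sum_(j < n.+1) lam n j * (x * b n j + (j == 0%N :> nat)%:R).
  by rewrite mulr_sumr; apply: eq_bigr => j _; rewrite mulrCA IHu.
rewrite (split_at n.+1 k (fun j => lam n j * (x * b n j + (j == 0%N :> nat)%:R))).
rewrite -[LHS]addr0 -!addrA; congr (_ + _); apply/esym.
rewrite !mulr_sumr -!sumrN -!big_split big1 //= => j _.
ring.
Qed.

Let chow_seqS n : chow_seq n.+1 = 1 + x * \sum_(j < n.+1) lam n j * b n j.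
Proof.
rewrite /chow_seq mulr_sumr (eq_bigr (fun j : 'I__ =>
  x * (lam n j * b n j) + lam n j * (j == 0%N :> nat)%:R)).
  by rewrite big_split -mulr_sumr /= (suffix_delta n 0) addrC.
move=> j _; rewrite mulrCA (chow_pairE (k := j) _).1 -1?ltnS //; ring.
Qed.

(** This is the recursion of [chow_from_rec] with the elements grouped by
corank, and it determines the sequence. *)
Lemma chow_seq_rec n : T n -> chow_seq n =
  1 + \sum_(i < n | T i) resolution n 0 i * (x * geo (tau n - tau i).-1 * chow_seq i).
Proof.
case: n => [_|n Tn]; first by rewrite big_ord0 addr0.
rewrite chow_seqS; congr (_ + _); rewrite mulr_sumr.
under eq_bigr => j _ do rewrite mulrCA /b -res_sumZ /res_sum mulr_sumr.
rewrite exchange_big /=; apply: eq_bigr => i _.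
rewrite ltn_eqF // add0r [RHS]mulr_suml; apply: eq_bigr => j _.
have ti : (tau i <= tau n)%N by rewrite leq_tau // -ltnS.
by rewrite tauS Tn addn1 subSn //=; ring.
Qed.

(** At a selected corank the step for b adds up the previous b and a, while the
step for a adds x times the previous a to [chow_seq], which is 1 plus x times
the previous b.  So a is 1 + x b there, and this is the first component. *)
Lemma aug_seq n : T n ->
  \sum_(i < n.+1 | T i) resolution n 0 i * (x ^+ (tau n - tau i) * chow_seq i)
  = w ^+ tau n * u n 0%N.
Proof.
move=> Tn; rewrite (chow_pairE _).1 // eqxx -[LHS]/(a n 0).
case: n Tn => [_|n Tn].
  by rewrite /a /b !res_sum0 /= tau0 /geo big_ord0; ring.
rewrite aS bS Tn chow_seqS expr1 -addrA addrC; congr (_ + _).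
rewrite -mulrDr -big_split /=; congr (_ * _); apply: eq_bigr => j _.
by rewrite mulrDr.
Qed.

End Chow.

Section HPolynomial.
Variable y : C.
Let w := 1 - y.
Local Notation q n := (hvec y T lam n).

Definition h_seq (n : nat) : C :=
  if n is m.+1 then \sum_(j < m.+1) lam m j * q m j else 1.

Let A n k := res_sum n k (fun i => w ^+ (tau n - tau i) * h_seq i).

Let AS n k : A n.+1 k = (if T n.+1 then h_seq n.+1 else 0) +
  w ^+ T n.+1 * \sum_(j < n.+1 | (k <= j)%N) lam n j * A n j.
Proof.
rewrite /A res_sumS subnn expr0 mul1r; congr (_ + _).
rewrite mulr_sumr; apply: eq_bigr => j _; rewrite mulrCA; congr (_ * _).
rewrite -res_sumZ; apply: eq_res_sum => i i_n; have ti := leq_tau i_n.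
by rewrite tauS addnC -addnBA // exprD mulrA.
Qed.

(** The analogue of the change of coordinates above, with a single sequence. *)
Let hvecE n k : (k <= n)%N ->
  q n k = y * A n k + (k == 0%N)%:R * w ^+ (tau n).+1.
Proof.
elim: n k => [|n IHn] k kn.
  move: kn; rewrite leqn0 => /eqP ->.
  by rewrite /A res_sum0 tau0 /= /w; ring.
have IHq (j : 'I_n.+1) :
    q n j = y * A n j + (j == 0%N :> nat)%:R * w ^+ (tau n).+1.
  by apply: IHn; rewrite -ltnS.
rewrite /= AS tauS -(suffix_delta n k); case: ifP => _ /=; last first.
  rewrite addn0 expr0 mul1r add0r addr0 mulr_sumr mulr_suml -big_split /=.
  by apply: eq_bigr => j _; rewrite IHq; ring.
rewrite addn1 expr1 (split_at n.+1 k (fun j => lam n j * q n j)) !mulrDr.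
rewrite addrC -!addrA; congr (_ + _).
rewrite !mulr_sumr mulr_suml -!big_split /=; apply: eq_bigr => j _.
by rewrite IHq !exprS /w; ring.
Qed.

Lemma h_seq_rec n : T n.+1 -> h_seq n.+1 = w ^+ tau n.+1 +
  y * \sum_(i < n.+1 | T i) resolution n.+1 0 i * (w ^+ (tau n.+1 - tau i).-1 * h_seq i).
Proof.
move=> Tn; rewrite /= (eq_bigr (fun j : 'I__ =>
  y * (lam n j * A n j) + (lam n j * (j == 0%N :> nat)%:R) * w ^+ (tau n).+1)); last first.
  by move=> j _; rewrite hvecE -1?ltnS //; ring.
rewrite big_split -mulr_sumr -mulr_suml /= (suffix_delta n 0) mul1r addrC.
rewrite tauS Tn addn1; congr (_ + y * _).
under eq_bigr => j _ do rewrite /A /res_sum mulr_sumr.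
rewrite exchange_big /=; apply: eq_bigr => i _.
rewrite ltn_eqF // add0r [RHS]mulr_suml; apply: eq_bigr => j _.
have ti : (tau i <= tau n)%N by rewrite leq_tau // -ltnS.
by rewrite subSn //=; ring.
Qed.

Lemma h_seqE n : h_seq n.+1 = q n.+1 0%N.
Proof. by rewrite /= big_pred0_eq mulr0 if_same addr0. Qed.

End HPolynomial.
End Resolution.

(** * The Chow polynomial without Möbius functions *)

Section UpInduction.
Variables (d : Order.disp_t) (P : finPOrderType d).

Lemma up_ind (Q : P -> Prop) :
  (forall s, (forall t, (s < t)%O -> Q t) -> Q s) -> forall s, Q s.
Proof.
move=> h s; have [n] := ubnP #|[set w : P | (s <= w)%O]|.
elim: n s => // n IHn s sn; apply: h => t st; apply: IHn.
exact: leq_trans (card_upset_lt st) _.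
Qed.

End UpInduction.

Section Moebius.
Variables (d : Order.disp_t) (P : finTBPOrderType d).

Lemma sum_mobius (s t : P) : (s <= t)%O ->
  \sum_(w : P | (s <= w <= t)%O) mobius s w = (s == t)%:R.
Proof.
move=> st; rewrite (bigD1 t) /=; last by rewrite st lexx.
rewrite mobiusE; have [->|nst] := eqVneq s t.
  rewrite big1 ?addr0 // => w /andP[/andP[tw wt] wNt].
  by case/eqP: wNt; apply/le_anti; rewrite tw wt.
rewrite addrC; apply/eqP; rewrite subr_eq0; apply/eqP; apply: eq_bigl => w.
by rewrite -andbA [(w <= t)%O && _]andbC -lt_neqAle.
Qed.

(** The function t |-> sum of G over the elements above t has the same transform
G as F, and a function is determined by its transform from the top down, since
mu(s, s) = 1.  This uses the defining identity of mu on one side only. *)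
Lemma mobius_inversion (F G : P -> {poly int}) :
  (forall s, G s = \sum_(w : P | (s <= w)%O) mobius s w *: F w) ->
  forall s, F s = \sum_(t : P | (s <= t)%O) G t.
Proof.
move=> GE; pose F' s := \sum_(t : P | (s <= t)%O) G t.
have GE' s : G s = \sum_(w : P | (s <= w)%O) mobius s w *: F' w.
  transitivity (\sum_(w : P | (s <= w)%O) \sum_(t : P | (w <= t)%O) mobius s w *: G t).
    rewrite (exchange_big_dep (fun t : P => (s <= t)%O)) /=; last first.
      by move=> w t; apply: le_trans.
    rewrite [in RHS](eq_bigr (fun t => (s == t)%:R *: G t)); last first.
      by move=> t st; rewrite -scaler_suml sum_mobius // scaler_nat scaleMnl.
    rewrite (bigD1 s) //= eqxx scale1r big1 ?addr0 // => t /andP[_].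
    by rewrite eq_sym => /negbTE ->; rewrite scale0r.
  by apply: eq_bigr => w _; rewrite scaler_sumr.
apply: up_ind => s IH; have := GE' s; rewrite [LHS]GE.
rewrite (bigD1 s) //= [RHS](bigD1 s) //=.
rewrite [X in _ + X = _](eq_bigr (fun w => mobius s w *: F' w)); last first.
  by move=> w /andP[sw ws]; rewrite IH // lt_neqAle eq_sym ws.
by move/addIr; rewrite mobiusE eqxx !scale1r.
Qed.

Hypothesis rk_lt : forall s t : P, (s < t)%O -> (rk s < rk t)%N.

(** Let F_w be the sum of x^(rk t - rk w) H_t over t >= w.  Its Möbius transform
at t is the sum of chi_{t,w} H_w over w >= t, and the defining recursion,
multiplied by x - 1, evaluates that sum to x H_t, up to the correction 1 - x at
the top where the recursion does not apply.  Inverting and solving for H_s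
gives the result. *)
Lemma chow_from_rec (s : P) : chow_from s =
  1 + \sum_(w : P | (s < w)%O)
        'X * (\sum_(j < (rk w - rk s).-1) 'X^j) * chow_from w.
Proof.
have rk_le (a b : P) : (a <= b)%O -> (rk a <= rk b)%N.
  by rewrite le_eqVlt => /orP[/eqP -> //|/rk_lt/ltnW].
pose F (w : P) : {poly int} := \sum_(t : P | (w <= t)%O) 'X^(rk t - rk w) * chow_from t.
pose G (t : P) : {poly int} := 'X * chow_from t + (t == \top%O)%:R * (1 - 'X).
have GE t : G t = \sum_(w : P | (t <= w)%O) mobius t w *: F w.
  (* Exchanging the sums in the Möbius transform of F produces chi. *)
  transitivity (\sum_(w : P | (t <= w)%O) chi t w * chow_from w); last first.
    rewrite [RHS](eq_bigr (fun w => \sum_(v : P | (w <= v)%O)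
      (mobius t w *: 'X^(rk v - rk w)) * chow_from v)); last first.
      by move=> w _; rewrite scaler_sumr; apply: eq_bigr => v _; rewrite scalerAl.
    rewrite (exchange_big_dep (fun v : P => (t <= v)%O)) /=; last first.
      by move=> w v; apply: le_trans.
    by apply: eq_bigr => v _; rewrite mulr_suml.
  rewrite (bigD1 t) //=.
  have -> : chi t t = 1.
    rewrite /chi (bigD1 t) ?lexx //= big1 ?addr0.
      by rewrite subnn expr0 mobiusE eqxx scale1r.
    by move=> w /andP[/le_anti -> /eqP].
  have [->|tT] := eqVneq t \top%O.
    rewrite big1 ?addr0; last first.
      by move=> w /andP[Tw wT]; case/eqP: wT; apply/le_anti; rewrite lex1.
    by rewrite /G eqxx chow_fromE eqxx mulr1 !mul1r addrC subrK.
  rewrite /G (negbTE tT) mul0r addr0 mul1r.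
  have -> : \sum_(w | (t <= w)%O && (w != t)) chi t w * chow_from w =
      ('X - 1) * chow_from t.
    rewrite [in RHS]chow_fromE (negbTE tT) mulr_sumr; apply: eq_big => w.
      by rewrite lt_neqAle andbC eq_sym.
    by move=> tw; rewrite mulrA [_ * chibar _ _]mulrC chibarK // lt_neqAle andbC eq_sym.
  by ring.
have := mobius_inversion GE s; rewrite /F /G big_split /= -mulr_sumr -mulr_suml.
rewrite (_ : \sum_(t : P | (s <= t)%O) (t == \top%O)%:R = 1); last first.
  rewrite (bigD1 \top%O) ?lex1 //= eqxx big1 ?addr0 // => w /andP[_ /negbTE ->] //.
rewrite mul1r mulr_sumr (bigD1 s) //= subnn expr0 mul1r [in RHS](bigD1 s) //=.
move=> h; apply: (@mulfI _ (1 - 'X)).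
  by rewrite -opprB oppr_eq0 -polyC1 polyXsubC_eq0.
rewrite mulrDr mulr1 mulr_sumr.
have -> : \sum_(w | (s < w)%O) (1 - 'X) *
     ('X * (\sum_(j < (rk w - rk s).-1) 'X^j) * chow_from w) =
   \sum_(w : P | (s <= w)%O && (w != s)) ('X * chow_from w
      - 'X^(rk w - rk s) * chow_from w).
  apply: eq_big => w; first by rewrite lt_neqAle andbC eq_sym.
  move=> /rk_lt; rewrite -subn_gt0; case: (rk w - rk s)%N => // k _ /=.
  rewrite exprS; have := subrX1 ('X : {poly int}) k.
  move/(congr1 -%R); rewrite opprB -mulNr opprB => e.
  by rewrite mulrA mulrCA -e; ring.
by rewrite sumrB /=; move: h; set A := \sum_(_ | _) _; set B := \sum_(_ | _) _ => h;
  rewrite mulrBl mul1r -[A](addKr (chow_from s)) h; ring.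
Qed.

End Moebius.

(** * The h-polynomial of an order complex *)

Section HSum.
Variable V : finType.
Implicit Types Delta : {set {set V}}.

Lemma h_polynomialE Delta (D := (\max_(A in Delta) #|A|)%N) :
  h_polynomial Delta = \sum_(A in Delta) 'X^#|A| * (1 - 'X) ^+ (D - #|A|).
Proof.
rewrite /h_polynomial -/D.
have le_D A : A \in Delta -> (#|A| < D.+1)%N.
  by rewrite ltnS => AD; apply: (bigop.bigmax_sup A).
rewrite [RHS](partition_big (fun A : {set V} => inord #|A| : 'I_D.+1) predT) //=.
apply: eq_bigr => i _.
rewrite (eq_bigr (fun=> 'X^i * (1 - 'X) ^+ (D - i))); last first.
  by move=> A /andP[/le_D AD /eqP <-]; rewrite inordK.
rewrite big_const iter_addr_0 -scaler_nat; congr (_%:R *: _).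
apply: eq_card => A; rewrite inE [RHS]unfold_in; case AD: (A \in Delta) => //=.
by rewrite -[RHS]val_eqE /= inordK ?le_D.
Qed.

End HSum.

Section Chains.
Variables (d : Order.disp_t) (P : finPOrderType d).
Implicit Types C : {set P}.

Lemma chainP C : reflect {in C &, forall x y, (x >=< y)%O} (is_chain C).
Proof.
apply: (iffP forall_inP) => [h x y xC yC|h x xC].
  by have /forall_inP := h x xC; apply.
by apply/forall_inP => y yC; apply: h.
Qed.

Lemma sub_chain C C' : C' \subset C -> is_chain C -> is_chain C'.
Proof.
move=> /subsetP CC /chainP h; apply/chainP => x y /CC xC /CC yC; exact: h.
Qed.

Lemma chainU1 x C : {in C, forall z, (x >=< z)%O} -> is_chain C -> is_chain (x |: C).
Proof.
move=> xC /chainP h; apply/chainP => a b.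
case/setU1P=> [->|aC] /setU1P[->|bC]; rewrite ?comparablexx ?xC //.
  by rewrite comparable_sym xC.
exact: h.
Qed.

Lemma chain_min C : is_chain C -> C != set0 ->
  exists2 v, v \in C & {in C, forall z, (v <= z)%O}.
Proof.
move=> /chainP h /set0Pn[x0 x0C].
case: (@arg_minnP P x0 (mem C) (fun u => #|[set w : P | (w <= u)%O]|) x0C) => v vC vmin.
exists v => // z zC; case/orP: (h _ _ vC zC) => // zv.
have [-> //|zNv] := eqVneq v z.
have /card_downset_lt : (z < v)%O by rewrite lt_neqAle eq_sym zNv.
by rewrite ltnNge (vmin z zC).
Qed.

End Chains.
Section Cone.
Variables (d : Order.disp_t) (P : finPOrderType d).

(** The faces come in pairs C, v |: C, and the two contributions to the
h-polynomial have factors 1 - y and y. *)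
Lemma h_cone (A : {set P}) (v : P) : {in A, forall x, (v >=< x)%O} ->
  h_polynomial (order_complex (A :\ v)) = h_polynomial (order_complex A).
Proof.
move=> vA; have [vinA|vninA] := boolP (v \in A); last first.
  by congr (h_polynomial (order_complex _)); apply/setDidPl; rewrite disjoint_sym disjoints1.
set D1 := order_complex (A :\ v); set D2 := order_complex A.
have inD1 C : (C \in D1) = (C \in D2) && (v \notin C).
  by rewrite !inE subsetD1 andbAC.
have vD1 C : C \in D1 -> v |: C \in D2.
  rewrite inD1 !inE -andbA => /and3P[CA Cc vC]; apply/andP; split.
    by apply/subsetP => x /setU1P[->//|/(subsetP CA)].
  by apply: chainU1 Cc => z /(subsetP CA); apply: vA.
have Dv C : C \in D2 -> C :\ v \in D1.
  rewrite inD1 !inE eqxx /= andbT => /andP[CA Cc]; apply/andP; split.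
    by apply: subset_trans CA; apply: subD1set.
  by apply: sub_chain Cc; apply: subD1set.
rewrite !h_polynomialE; set m1 := (\max_(C in D1) _)%N; set m2 := (\max_(C in D2) _)%N.
have m2E : m2 = m1.+1.
  apply/eqP; rewrite eqn_leq; apply/andP; split.
    apply/bigmax_leqP => C CD; rewrite (cardsD1 v) -add1n leq_add ?leq_b1 //.
    by apply: (bigop.bigmax_sup (C :\ v)) => //; apply: Dv.
  have s0 : set0 \in D1 by rewrite !inE sub0set; apply/chainP => x y; rewrite inE.
  have D0 : (0 < #|D1|)%N by apply/card_gt0P; exists set0.
  have [C CD CE] := eq_bigmax_cond (fun C : {set P} => #|C|) D0; rewrite /m1 CE.
  apply: (bigop.bigmax_sup (v |: C)); first exact: vD1.
  by rewrite cardsU1 (_ : v \notin C) //; move: CD; rewrite inD1 => /andP[].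
have le_m1 C : C \in D1 -> (#|C| <= m1)%N by move=> CD; apply: (bigop.bigmax_sup C).
rewrite [RHS](bigID (fun C : {set P} => v \notin C)) /=.
rewrite [X in _ = X + _](eq_bigl (fun C => C \in D1)) /=; last by move=> C; rewrite inD1.
rewrite [X in _ = _ + X](reindex_onto (fun C => v |: C) (fun C => C :\ v)) /=; last first.
  by move=> C /andP[_]; rewrite negbK => vC; rewrite setD1K.
rewrite [X in _ = _ + X](eq_big (fun C => C \in D1)
  (fun C => 'X * ('X^#|C| * (1 - 'X) ^+ (m1 - #|C|)))); first last.
- move=> C /andP[/andP[vC _] /eqP Ce].
  have vC' : v \notin C by rewrite -Ce !inE eqxx.
  by rewrite cardsU1 vC' add1n m2E subSS exprS mulrA.
- move=> C; rewrite setU11 andbT; apply/andP/idP => [[vC /eqP <-]|CD].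
    exact: Dv.
  rewrite vD1 //; split=> //; apply/eqP/setU1K.
  by move: CD; rewrite inD1 => /andP[].
rewrite -mulr_sumr [X in _ = X + _](eq_bigr (fun C : {set P} => (1 - 'X) * ('X^#|C| * (1 - 'X) ^+ (m1 - #|C|)))).
  by rewrite -mulr_sumr; ring.
by move=> C /le_m1 Cm; rewrite m2E subSn // exprS mulrCA.
Qed.

End Cone.

Section ChainSums.
Variables (d : Order.disp_t) (P : finTBPOrderType d) (R : comPzRingType).

(** Nonempty chains are split by their least element. *)
Lemma sum_chains (Q : pred P) (F : {set P} -> R) :
  \sum_(C | is_chain C && [forall z in C, Q z]) F C =
  F set0 + \sum_(v | Q v) \sum_(C | is_chain C && [forall z in C, Q z && (v < z)%O]) F (v |: C).
Proof.
pose m (C : {set P}) : P := odflt \bot%O [pick v in C | [forall z in C, (v <= z)%O]].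
have mP C : is_chain C -> C != set0 -> m C \in C /\ {in C, forall z, (m C <= z)%O}.
  move=> Cc C0; rewrite /m; case: pickP => [v /andP[vC /forall_inP h] //|no].
  have [v vC vle] := chain_min Cc C0; have := no v; rewrite vC /= => /negP[].
  exact/forall_inP.
rewrite (bigD1 set0) /=; last first.
  by apply/andP; split; [apply/chainP => x y|apply/forall_inP => x]; rewrite inE.
congr (_ + _).
rewrite (partition_big m Q) /=; last first.
  by move=> C /andP[/andP[Cc /forall_inP CQ] C0]; apply: CQ; case: (mP C).
apply: eq_bigr => v Qv.
rewrite (reindex_onto (fun C => v |: C) (fun C => C :\ v)) /=; last first.
  move=> C /andP[/andP[/andP[Cc _] C0] /eqP <-].
  by rewrite setD1K //; case: (mP C).
apply: eq_bigl => C; apply/andP/andP.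
  case=> /andP[/andP[/andP[Cc /forall_inP CQ] C0] /eqP mv] /eqP CE.
  have vC : v \notin C by rewrite -CE !inE eqxx.
  split; first by apply: sub_chain Cc; apply: subsetUr.
  apply/forall_inP => z zC; rewrite CQ ?inE ?zC ?orbT //= lt_neqAle.
  have [_ h] := mP _ Cc C0; move: (h z); rewrite mv inE zC orbT => -> //.
  by rewrite andbT; apply: contraNneq vC => ->.
case=> Cc /forall_inP CQ.
have vC : v \notin C by apply/negP => /CQ; rewrite ltxx andbF.
have Cc' : is_chain (v |: C).
  by apply: chainU1 Cc => z /CQ/andP[_ /ltW]; apply: le_comparable.
have C0 : v |: C != set0 by apply/set0Pn; exists v; rewrite setU11.
split; last by rewrite setU1K.
rewrite Cc' C0 andbT /=; apply/andP; split.
  by apply/forall_inP => z /setU1P[->//|/CQ/andP[]].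
have [mC h] := mP _ Cc' C0; case/setU1P: mC => [-> //|/CQ/andP[_ lt]].
by have := le_lt_trans (h v (setU11 _ _)) lt; rewrite ltxx.
Qed.

Variable y : R.
Let w := 1 - y.
Hypothesis rk_lt : forall s t : P, (s < t)%O -> (rk s < rk t)%N.
Let N := rk (\top%O : P).

Lemma rk_leN (s : P) : (rk s <= N)%N.
Proof.
by have := lex1 s; rewrite le_eqVlt => /orP[/eqP -> //|/rk_lt/ltnW].
Qed.

Lemma card_chain_above (s : P) C : is_chain C -> [forall z in C, (s < z)%O] ->
  (#|C| <= N - rk s)%N.
Proof.
move=> /chainP Cc /forall_inP Cs.
have rkC z : z \in C -> ((rk z - rk s).-1 < N - rk s)%N.
  move/Cs/rk_lt => sz; have := rk_leN z; lia.
have [->|/set0Pn[z0 z0C]] := eqVneq C set0; first by rewrite cards0.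
case NE : (N - rk s)%N (rkC) => [|k] {}rkC; first by have := rkC _ z0C.
rewrite -[X in (_ <= X)%N](card_ord k.+1).
rewrite -(card_in_imset (f := fun z => inord (rk z - rk s).-1 : 'I_k.+1)) ?max_card //.
move=> a b aC bC /(congr1 (@nat_of_ord _)); rewrite !inordK ?rkC // => ab.
have := Cs _ aC; have := Cs _ bC; move/rk_lt => sb /rk_lt sa.
have rab : rk a = rk b by lia.
by have := Cc _ _ aC bC; case: comparableP => // /rk_lt; rewrite rab ltnn.
Qed.

(** The value at y of the h-polynomial of the half-open interval from s, excluded,
to the top. *)
Definition above_sum (s : P) : R :=
  \sum_(C | is_chain C && [forall z in C, (s < z)%O]) y ^+ #|C| * w ^+ (N - rk s - #|C|).

Lemma above_sumE (s : P) : above_sum s = w ^+ (N - rk s) +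
  \sum_(v | (s < v)%O) y * w ^+ (rk v - rk s).-1 * above_sum v.
Proof.
rewrite /above_sum (sum_chains (fun z => (s < z)%O)) cards0 subn0 expr0 mul1r.
congr (_ + _); apply: eq_bigr => v sv; rewrite mulr_sumr; apply: eq_big => C.
  congr (_ && _); apply: eq_forallb_in => z zC.
  by case vz: (v < z)%O; rewrite ?andbF // (lt_trans sv vz).
move=> /andP[Cc Ca]; have {}Ca : [forall z in C, (v < z)%O].
  by apply/forall_inP => z /(forall_inP Ca)/andP[].
have vC : v \notin C by apply/negP => /(forall_inP Ca); rewrite ltxx.
have Cle := card_chain_above Cc Ca; have rsv := rk_lt sv; have rvN := rk_leN v.
rewrite cardsU1 vC add1n exprS -!mulrA; congr (y * _); rewrite mulrCA -exprD.
by congr (_ * _ ^+ _); lia.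
Qed.

Lemma sum_all_chains :
  \sum_(C : {set P} | is_chain C) y ^+ #|C| * w ^+ (N.+1 - #|C|) =
  w ^+ N.+1 + \sum_(v : P) y * w ^+ rk v * above_sum v.
Proof.
rewrite (eq_bigl (fun C : {set P} => is_chain C && [forall z in C, predT z])); last first.
  by move=> C; rewrite (_ : [forall z in C, _]) ?andbT //; apply/forall_inP.
rewrite (sum_chains predT) cards0 subn0 expr0 mul1r; congr (_ + _).
apply: eq_bigr => v _; rewrite mulr_sumr; apply: eq_bigr => C /andP[Cc Ca].
have vC : v \notin C by apply/negP => /(forall_inP Ca); rewrite ltxx.
have Cle := card_chain_above Cc Ca; have rvN := rk_leN v.
rewrite cardsU1 vC add1n exprS -!mulrA; congr (y * _); rewrite mulrCA -exprD.
congr (_ * _ ^+ _); move: Cle rvN; rewrite subSS; move: (rk v) #|C| => a c; clear; lia.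
Qed.

End ChainSums.

Section MaxChain.
Variables (d : Order.disp_t) (P : finTBPOrderType d).

Lemma max_chain_card :
  (\max_(C in order_complex [set: P]) #|C|)%N = (rk (\top%O : P)).+1.
Proof.
have E : (\max_(C in order_complex [set: P]) #|C| =
   \max_(C : {set P} | is_chain C && [forall x in C, (x <= \top)%O]) #|C|)%N.
  apply: eq_bigl => C; rewrite !inE subsetT /=.
  by rewrite (_ : [forall x in C, _]) ?andbT //; apply/forall_inP => x; rewrite lex1.
rewrite /rk -E prednK //.
apply: (bigop.bigmax_sup [set \top%O]); last by rewrite cards1.
rewrite !inE subsetT; apply/chainP => x y /set1P -> /set1P ->.
exact: comparablexx.
Qed.

End MaxChain.

(** * Rank-selected subposets of resolvable posets *)

Section RankFunctions.
Variables (d : Order.disp_t) (L : finTBPOrderType d) (rho : L -> nat).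

Lemma cover_above (s t : L) : (s < t)%O -> exists2 u, covers s u & (u <= t)%O.
Proof.
move=> st; have t_in : (s < t <= t)%O by rewrite st lexx.
case: (@arg_minnP L t (fun u => (s < u <= t)%O)
        (fun u => #|[set w : L | (w <= u)%O]|) t_in) => u /andP[su ut] umin.
exists u => //; rewrite /covers su; apply/forallP => w; apply/negP => /andP[sw wu].
have := card_downset_lt wu; rewrite ltnNge umin //= sw.
exact: le_trans (ltW wu) ut.
Qed.

(** Covering relations are awkward to produce in concrete posets; it is enough
to find an element one rank higher between any two comparable ones. *)
Lemma is_rank_functionI : rho \bot%O = 0%N ->
  (forall s t : L, (s < t)%O -> (rho s < rho t)%N) ->
  (forall s t : L, (s < t)%O -> exists w, [/\ (s < w)%O, (w <= t)%O & rho w = (rho s).+1]) ->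
  is_rank_function rho.
Proof.
move=> r0 mono ref; split=> // s t /andP[st /forallP no].
have [w [sw wt wE]] := ref s t st; have := no w; rewrite sw /= => /negP wNt.
by move: wt; rewrite le_eqVlt => /orP[/eqP <- //|/wNt].
Qed.

Hypothesis rhoP : is_rank_function rho.

Lemma rank_function_le (s t : L) : (s <= t)%O -> (rho s <= rho t)%N.
Proof. by rewrite le_eqVlt => /orP[/eqP -> //|/(rank_function_lt rhoP)/ltnW]. Qed.

Lemma rank_between (s t : L) i : (s <= t)%O -> (rho s <= i <= rho t)%N ->
  exists w, [/\ (s <= w)%O, (w <= t)%O & rho w = i].
Proof.
move=> st /andP[/subnKC <-]; move: (i - rho s)%N => k.
elim: k s st => [|k IHk] s st; first by exists s; rewrite addn0.
move=> kt; have st' : (s < t)%O.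
  by rewrite lt_neqAle st andbT; apply: contraTneq kt => ->; rewrite -ltnNge addnS ltnS leq_addr.
have [u su ut] := cover_above st'.
have := IHk u ut; rewrite (rhoP.2 _ _ su) addSnnS => /(_ kt)[w [uw wt wE]].
exists w; split=> //; apply: le_trans uw; apply: ltW; by case/andP: su.
Qed.

End RankFunctions.

(** The label 0 must have weight 1 so that the first terms of the recursions can
be compared with their predecessors. *)
Definition resolvable (C : numClosedFieldType) d (L : finTBPOrderType d) : Prop :=
  exists rho : L -> nat, is_rank_function rho /\
  exists lam : nat -> nat -> C,
    [/\ forall n k, 0 <= lam n k, forall n, lam n 0%N = 1 &
      forall (s : L) i,
       #|[set w : L | (s <= w)%O && (rho w + i == rho \top%O)%N]|%:R
         = resolution lam (rho \top%O - rho s) 0 i].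

Section Evaluation.
Variables (C : numClosedFieldType) (x : C).

Definition peval (p : {poly int}) : C := (map_poly intr p).[x].

Lemma pevalD p q : peval (p + q) = peval p + peval q.
Proof. by rewrite /peval rmorphD hornerD. Qed.

Lemma pevalM p q : peval (p * q) = peval p * peval q.
Proof. by rewrite /peval rmorphM hornerM. Qed.

Lemma peval1 : peval 1 = 1.
Proof. by rewrite /peval rmorph1 hornerE. Qed.

Lemma peval_sum I (r : seq I) (Q : pred I) (F : I -> {poly int}) :
  peval (\sum_(i <- r | Q i) F i) = \sum_(i <- r | Q i) peval (F i).
Proof. by rewrite /peval rmorph_sum horner_sum. Qed.

Lemma pevalX : peval 'X = x.
Proof. by rewrite /peval map_polyX hornerX. Qed.

Lemma pevalXn p n : peval (p ^+ n) = peval p ^+ n.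
Proof. by rewrite /peval rmorphXn horner_exp. Qed.

Lemma peval_1subX : peval (1 - 'X) = 1 - x.
Proof. by rewrite /peval rmorphB /= rmorph1 map_polyX !hornerE. Qed.

End Evaluation.

Section NegativeRoot.
Variable C : numClosedFieldType.

(** Comparing z (1 + z^* )^2 with its conjugate gives (z - z^* )(1 - z z^* ) = 0.
If z lies on the unit circle then y = 1 / |1 + z|^2 is positive. *)
Lemma real_root_of_quotient (z y : C) : 1 + z != 0 -> y = z / (1 + z) ^+ 2 ->
  'Im y = 0 -> ~~ (0 <= y) -> z <= 0.
Proof.
move=> w0 yE Iy yN; have yr : y \is Num.real by apply/Creal_ImP.
have y_lt0 : y < 0.
  by move: yr; rewrite realE (negbTE yN) /= le_eqVlt => /orP[/eqP y0|//];
     rewrite y0 lexx in yN.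
have zE : z = y * (1 + z) ^+ 2 by rewrite yE divfK ?expf_eq0.
suff zr : z \is Num.real.
  rewrite [X in X <= _]zE (mulr_le0_ge0 (ltW y_lt0)) // real_exprn_even_ge0 //.
  by rewrite rpredD ?rpred1.
pose K := z * (1 + z^*) ^+ 2.
have KE : K = y * (`|1 + z| ^+ 2) ^+ 2.
  rewrite /K {1}zE normCK rmorphD /= rmorph1; ring.
have K_lt0 : K < 0.
  by rewrite KE nmulr_rlt0 // exprn_gt0 // exprn_gt0 // normr_gt0.
have Kr : K^* = K by apply/CrealP/ltr0_real.
have : (z - z^*) * (1 - z * z^*) = 0.
  rewrite -[RHS](subrr K) -{2}Kr /K rmorphM rmorphXn rmorphD rmorph1 /= conjCK.
  by ring.
move/eqP; rewrite mulf_eq0 subr_eq0 => /orP[/eqP e|]; first by apply/CrealP.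
rewrite subr_eq0 eq_sym => /eqP e.
have KE' : K = (1 + z) * (1 + z^*).
  by rewrite /K expr2 mulrA [z * _]mulrDr mulr1 e [z + 1]addrC.
have : 0 <= K.
  by rewrite KE' -[1 + z^*](_ : (1 + z)^* = _) ?mul_conjC_ge0 // rmorphD rmorph1.
by move=> /le_lt_trans/(_ K_lt0); rewrite ltxx.
Qed.

End NegativeRoot.

Section Embedding.
Variables (C : numClosedFieldType).
Variables (d' : Order.disp_t) (L : finTBPOrderType d') (rho : L -> nat).
Hypothesis rhoP : is_rank_function rho.
Let r := rho \top%O.
Variable lam : nat -> nat -> C.
Hypothesis lam_ge0 : forall n k, 0 <= lam n k.
Hypothesis lam1 : forall n, lam n 0%N = 1.
Hypothesis countL : forall (s : L) i,
  #|[set w : L | (s <= w)%O && (rho w + i == r)%N]|%:R = resolution lam (r - rho s) 0 i.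

Variables (d : Order.disp_t) (P : finTBPOrderType d) (f : P -> L) (S : pred nat).
Hypothesis f_mono : {mono f : x y / (x <= y)%O}.
Hypothesis fS : forall x, S (rho (f x)).
Hypothesis f_surj : forall y, S (rho y) -> exists x, f x = y.
Hypothesis S0 : S 0%N.
Hypothesis Sr : S r.

Let T : pred nat := fun n => S (r - n)%N.
Let cork (x : P) := (r - rho (f x))%N.

Let T0 : T 0%N. Proof. by rewrite /T subn0. Qed.
Let Tr : T r. Proof. by rewrite /T subnn. Qed.

Let f_inj : injective f.
Proof. by move=> x y xy; apply/le_anti; rewrite -!f_mono xy lexx. Qed.

Let f_lt x y : (f x < f y)%O = (x < y)%O.
Proof. exact: (leW_mono f_mono). Qed.

Let f_bot : f \bot%O = \bot%O.
Proof.
have [x xE] : exists x, f x = \bot%O by apply: f_surj; rewrite rhoP.1.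
by apply/le_anti; rewrite le0x andbT -[X in (_ <= X)%O]xE f_mono le0x.
Qed.

Let f_top : f \top%O = \top%O.
Proof.
have [x xE] : exists x, f x = \top%O by apply: f_surj.
by apply/le_anti; rewrite lex1 /= -[X in (X <= _)%O]xE f_mono lex1.
Qed.

Let rho_r y : (rho y <= r)%N.
Proof. by apply: (rank_function_le rhoP); apply: lex1. Qed.

Let Tcork x : T (cork x).
Proof. by rewrite /T /cork subKn. Qed.

Let cork_bot : cork \bot%O = r.
Proof. by rewrite /cork f_bot rhoP.1 subn0. Qed.

Let cork_top : cork \top%O = 0%N.
Proof. by rewrite /cork f_top subnn. Qed.

Let cork_lt x y : (x < y)%O -> (cork y < cork x)%N.
Proof.
rewrite -f_lt => /(rank_function_lt rhoP) xy; rewrite /cork.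
by have := rho_r (f y); lia.
Qed.

Let tau_gap m n : (m < n)%N -> T n -> (forall i, (m < i < n)%N -> ~~ T i) ->
  tau T n = (tau T m).+1.
Proof.
move=> mn Tn no; case: n mn Tn no => // n mn Tn no; rewrite tauS Tn addn1; congr _.+1.
elim: n mn no {Tn} => [|n IHn] mn no; first by case: m mn {no}.
move: mn; rewrite ltnS leq_eqVlt => /orP[/eqP -> //|mn].
rewrite tauS (negbTE (no n.+1 _)) ?ltnSn ?andbT // addn0 IHn // => i /andP[mi i_n].
by rewrite no // mi ltnW.
Qed.

(** Between consecutive selected ranks of the large poset no element of P is
skipped: a saturated chain passes through every rank. *)
Lemma embed_rank_function :
  is_rank_function (fun x => (tau T r - tau T (cork x))%N).
Proof.
split; first by rewrite cork_bot subnn.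
move=> s t /andP[st /forallP no].
have tle : (tau T (cork s) <= tau T r)%N by rewrite leq_tau ?leq_subr.
suff e : tau T (cork s) = (tau T (cork t)).+1 by rewrite -subnSK -?e.
apply: tau_gap; [exact: cork_lt|exact: Tcork|] => i /andP[ti i_s].
apply/negP => Ti.
have fst : (f s <= f t)%O by rewrite f_mono ltW.
have rs := rho_r (f s); have rt := rho_r (f t).
have [|w [sw wt wE]] := rank_between rhoP (i := (r - i)%N) fst.
  by move: ti i_s; rewrite /cork; lia.
have [x xE] : exists x, f x = w by apply: f_surj; rewrite wE.
have := no x; rewrite -!f_lt xE !lt_neqAle sw wt !andbT => /negP[].
apply/andP; split; apply: contraTneq isT => e; move: ti i_s; rewrite /cork.
  by rewrite e wE; lia.
by rewrite -e wE; lia.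
Qed.

Let rkP := rkE embed_rank_function.

Let rk_lt (s t : P) : (s < t)%O -> (rk s < rk t)%N.
Proof. by rewrite !rkP; apply: (rank_function_lt embed_rank_function). Qed.

Let rk_sub (s t : P) : (s <= t)%O -> (rk t - rk s = tau T (cork s) - tau T (cork t))%N.
Proof.
move=> st; rewrite !rkP.
have le1 : (tau T (cork t) <= tau T (cork s))%N.
  by apply: leq_tau; move: st; rewrite le_eqVlt => /orP[/eqP -> //|/cork_lt/ltnW].
have le2 : (tau T (cork s) <= tau T r)%N by rewrite leq_tau ?leq_subr.
by move: (tau T _) (tau T _) (tau T _) le1 le2 => a b c; lia.
Qed.

Let rk_top : rk (\top%O : P) = tau T r.
Proof. by rewrite rkP cork_top tau0 subn0. Qed.

(** This is where resolvability enters: sums over the elements above s become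
sums over walks that end at a selected corank. *)
Lemma sum_above (s : P) (phi : nat -> C) :
  \sum_(w : P | (s <= w)%O) phi (cork w) =
  \sum_(i < (cork s).+1 | T i) resolution lam (cork s) 0 i * phi i.
Proof.
have le_cork w : (s <= w)%O -> (cork w < (cork s).+1)%N.
  by rewrite ltnS le_eqVlt => /orP[/eqP -> //|/cork_lt/ltnW].
rewrite (partition_big (fun w => inord (cork w) : 'I_(cork s).+1) (fun i => T i)) /=; last first.
  by move=> w /le_cork sw; rewrite inordK.
apply: eq_bigr => i Ti.
rewrite (eq_bigr (fun=> phi i)); last by move=> w /andP[/le_cork sw /eqP <-]; rewrite inordK.
rewrite big_const iter_addr_0 -mulr_natl; congr (_ * _).
rewrite -countL; congr _%:R; rewrite -(card_imset _ f_inj); apply: eq_card => y.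
rewrite inE; apply/imsetP/andP.
  case=> w; rewrite unfold_in => /andP[sw /eqP wi] ->; rewrite f_mono; split=> //.
  by move/(congr1 val): wi; rewrite /= inordK ?le_cork // => <-; rewrite /cork subnKC.
case=> sy /eqP yi; have yr : (r - rho y = i)%N by rewrite -yi addKn.
have [w wE] : exists w, f w = y by apply: f_surj; rewrite -(subKn (rho_r y)) yr.
exists w => //; rewrite unfold_in -f_mono wE sy /=.
by apply/eqP/val_inj; rewrite /= inordK /cork wE yr.
Qed.

Section Chow.
Variable x : C.
Hypothesis w0 : 1 + x != 0.

Lemma peval_chow s : peval x (chow_from s) = chow_seq lam T x (cork s).
Proof.
elim/(@up_ind _ P): s => s IH.
rewrite chow_from_rec // pevalD peval1 peval_sum chow_seq_rec //; congr (_ + _).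
pose n := cork s.
pose phi i := x * geo x (tau T n - tau T i).-1 * chow_seq lam T x i.
have phi_n : phi n = 0 by rewrite /phi subnn /geo big_ord0 mulr0 mul0r.
transitivity (\sum_(w : P | (s <= w)%O) phi (cork w)); last first.
  rewrite sum_above big_mkcond big_ord_recr /= -big_mkcond /=.
  by rewrite -/n phi_n mulr0 if_same addr0.
rewrite [RHS](bigD1 s) //= -/n phi_n add0r.
apply: eq_big => w; first by rewrite lt_neqAle andbC eq_sym.
move=> sw; rewrite !pevalM pevalX IH // rk_sub ?ltW // peval_sum.
by congr (_ * _ * _); apply: eq_bigr => j _; rewrite pevalXn pevalX.
Qed.

Lemma peval_augmented : peval x (augmented_chow P) =
  (1 + x) ^+ tau T r * (chow_pair (x / (1 + x) ^+ 2) T lam r).1 0%N.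
Proof.
rewrite -(aug_seq lam1 T0 w0 Tr) /augmented_chow peval_sum.
have := sum_above \bot%O (fun i => x ^+ (tau T r - tau T i) * chow_seq lam T x i).
rewrite cork_bot => <-; apply: eq_big => s; first by rewrite le0x.
move=> _; rewrite pevalM pevalXn pevalX peval_chow; congr (_ ^+ _ * _).
by rewrite -[LHS]subn0 -(rk0 P) rk_sub ?le0x // cork_bot.
Qed.

End Chow.

Lemma peval_h y : peval y (h_polynomial (order_complex [set: P])) =
  h_seq lam T y r.
Proof.
rewrite h_polynomialE max_chain_card peval_sum.
rewrite (eq_big (fun C => is_chain C) (fun A : {set P} =>
   y ^+ #|A| * (1 - y) ^+ ((rk (\top%O : P)).+1 - #|A|))); first last.
- by move=> A _; rewrite pevalM !pevalXn pevalX peval_1subX.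
- by move=> A; rewrite inE subsetT.
rewrite sum_all_chains //.
have above s : above_sum y s = h_seq lam T y (cork s).
  elim/(@up_ind _ P): s => s IH.
  rewrite above_sumE // rk_sub ?lex1 // cork_top tau0 subn0.
  pose n := cork s.
  pose phi i := if (i < n)%N then y * ((1 - y) ^+ (tau T n - tau T i).-1 * h_seq lam T y i) else 0.
  have phi_n : phi n = 0 by rewrite /phi ltnn.
  have -> : \sum_(v | (s < v)%O) y * (1 - y) ^+ (rk v - rk s).-1 * above_sum y v
     = \sum_(v : P | (s <= v)%O) phi (cork v).
    rewrite [RHS](bigD1 s) //= -/n phi_n add0r.
    apply: eq_big => v; first by rewrite lt_neqAle andbC eq_sym.
    by move=> sv; rewrite IH // rk_sub ?ltW // /phi cork_lt // mulrA.
  rewrite sum_above big_mkcond big_ord_recr /= -big_mkcond /= -/n phi_n mulr0 if_same addr0.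
  have : T n := Tcork s; rewrite /phi; move: (n) => [|m] Tm.
    by rewrite tau0 big_ord0 addr0 expr0.
  rewrite h_seq_rec //; congr (_ + _); rewrite mulr_sumr; apply: eq_bigr => i _.
  by rewrite ltn_ord mulrCA.
have -> : \sum_(v : P) y * (1 - y) ^+ rk v * above_sum y v =
   \sum_(i < r.+1 | T i) resolution lam r 0 i *
      (y * (1 - y) ^+ (tau T r - tau T i) * h_seq lam T y i).
  have := sum_above \bot%O (fun i => y * (1 - y) ^+ (tau T r - tau T i) * h_seq lam T y i).
  rewrite cork_bot => <-; apply: eq_big => s; first by rewrite le0x.
  move=> _; rewrite above; congr (_ * _ ^+ _ * _).
  by rewrite -[LHS]subn0 -(rk0 P) rk_sub ?le0x // cork_bot.
(* The bottom contributes y h and, by the recursion for h at the bottom, the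
   other elements contribute (1 - y) (h - (1 - y)^tau). *)
rewrite rk_top big_mkcond big_ord_recr /= -big_mkcond /= Tr.
have resrr : resolution lam r 0 r = 1.
  case: (r) => // m /=; rewrite eqxx big1 ?addr0 // => j _.
  by rewrite res_gt ?mulr0.
rewrite resrr subnn expr0 mul1r mulr1.
have [rE|] := posnP r.
  by rewrite rE big_ord0 tau0 expr1 /= mulr1 add0r subrK.
have := Tr; move: (r) => [//|m] Tm _; rewrite [in LHS]exprS.
have -> : \sum_(i < m.+1 | T i) resolution lam m.+1 0 i *
    (y * (1 - y) ^+ (tau T m.+1 - tau T i) * h_seq lam T y i) =
   (1 - y) * (h_seq lam T y m.+1 - (1 - y) ^+ tau T m.+1).
  rewrite [in RHS]h_seq_rec // [_ + y * _]addrC addrK !mulr_sumr; apply: eq_bigr => i _.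
  have : (tau T i < tau T m.+1)%N by rewrite tauS Tm addn1 ltnS leq_tau // -ltnS.
  rewrite -subn_gt0; case: (tau T m.+1 - tau T i)%N => // k _ /=.
  by rewrite exprS; ring.
by ring.
Qed.

Lemma chow_root (z : C) : root (map_poly intr (chow P)) z -> z <= 0.
Proof.
move=> /rootP; rewrite -/(peval z _) => hz.
have [w0|w0] := eqVneq (1 + z) 0.
  by rewrite -(addKr 1 z) w0 addr0 oppr_le0.
move: hz; rewrite /chow peval_chow // cork_bot.
case: (r) => [/eqP|m /= /eqP]; first by rewrite oner_eq0.
rewrite mulf_eq0 expf_eq0 (negbTE w0) andbF /= => sE.
apply: (real_root_of_quotient w0 erefl).
  by apply/eqP; apply: contraTT sE => Iy; apply: sum_u_neq0.
by apply: contraTN sE => y0; rewrite gt_eqF // sum_u_gt0.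
Qed.

Lemma augmented_root (z : C) : root (map_poly intr (augmented_chow P)) z -> z <= 0.
Proof.
move=> /rootP; rewrite -/(peval z _) => hz.
have [w0|w0] := eqVneq (1 + z) 0.
  by rewrite -(addKr 1 z) w0 addr0 oppr_le0.
move: hz => /eqP; rewrite peval_augmented //.
rewrite mulf_eq0 expf_eq0 (negbTE w0) andbF /= => sE.
apply: (real_root_of_quotient w0 erefl).
  by apply/eqP; apply: contraTT sE => Iy; apply: u_neq0.
by apply: contraTN sE => y0; rewrite gt_eqF // u_gt0.
Qed.

Lemma h_root (z : C) :
  root (map_poly intr (h_polynomial (order_complex [set: P]))) z -> z <= 0.
Proof.
move=> /rootP; rewrite -/(peval z _) peval_h.
case: (r) => [/eqP|m]; first by rewrite oner_eq0.
rewrite h_seqE => /eqP sE.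
have zr : z \is Num.real.
  by apply/Creal_ImP/eqP; apply: contraTT sE => Iz; apply: hvec_neq0.
move: zr; rewrite realE => /orP[z0|//].
by move: sE; rewrite gt_eqF // hvec_gt0.
Qed.

End Embedding.

(** * Resolutions with label weights; Boolean lattices; q-analogues *)

Lemma resolvable_roots (C : numClosedFieldType) d' (L : finTBPOrderType d')
    (rho : L -> nat) d (P : finTBPOrderType d) (f : P -> L) (S : pred nat) :
  resolvable C L -> is_rank_function rho ->
  {mono f : x y / (x <= y)%O} -> (forall x, S (rho (f x))) ->
  (forall y, S (rho y) -> exists x, f x = y) -> S 0%N -> S (rho \top%O) ->
  graded P /\ forall z : C,
    [/\ root (map_poly intr (chow P)) z -> z <= 0,
        root (map_poly intr (augmented_chow P)) z -> z <= 0 &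
        root (map_poly intr (h_polynomial (order_complex [set: P]))) z -> z <= 0].
Proof.
case=> rho' [rho'P [lam [lam0 lam1 cnt]]] rhoP f_mono fS f_surj S0 Sr.
have rr : rho =1 rho' by move=> x; rewrite -(rkE rhoP) (rkE rho'P).
have fS' x : S (rho' (f x)) by rewrite -rr.
have f_surj' y : S (rho' y) -> exists x, f x = y by rewrite -rr; apply: f_surj.
have Sr' : S (rho' \top%O) by rewrite -rr.
split.
  by eexists; apply: (embed_rank_function rho'P f_mono fS' f_surj' S0 Sr').
move=> z; split=> zr.
- exact: (chow_root rho'P lam0 lam1 cnt f_mono fS' f_surj' S0 Sr' zr).
- exact: (augmented_root rho'P lam0 lam1 cnt f_mono fS' f_surj' S0 Sr' zr).
- exact: (h_root rho'P lam0 lam1 cnt f_mono fS' f_surj' S0 Sr' zr).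
Qed.

Lemma resS (C : numClosedFieldType) (lam : nat -> nat -> C) n k i :
  resolution lam n.+1 k i =
  (i == n.+1)%:R + \sum_(j < n.+1 | (k <= j)%N) lam n j * resolution lam n j i.
Proof. by []. Qed.

Section Whitney.
Variable e : nat -> nat.

(** The complete homogeneous symmetric polynomial of degree n - i in e 0, ...,
e i: binomial coefficients for e = 1, Gaussian ones for e k = q^k, Stirling
numbers of the second kind for e k = k + 1 up to a shift. *)
Fixpoint whitney (n i : nat) : nat :=
  if n is m.+1 then
    ((if i is j.+1 then whitney m j else 0) + e i * whitney m i)%N
  else (i == 0%N).

Lemma whitney_gt n i : (n < i)%N -> whitney n i = 0%N.
Proof.
elim: n i => [|n IHn] [|i] //= ni.
by rewrite (IHn i) // (IHn i.+1) ?muln0 // ltnW.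
Qed.

Variable C : numClosedFieldType.
Let lam (n k : nat) : C := (e k)%:R.

(** A walk from n to i takes its last step with a label at most i, so all its
labels are at most i and the bound on labels along the walk is automatic.
Walks are thus multisets of n - i labels between k and i, and the recursion
asks whether the label i occurs. *)
Lemma res_step n k i : (k <= n)%N ->
  resolution lam n.+1 k i = (if i is j.+1 then resolution lam n k j else 0) + (e i)%:R * resolution lam n k i.
Proof.
elim: n k i => [|n IHn] k i kn.
  move: kn; rewrite leqn0 => /eqP ->.
  rewrite /= big_mkcond big_ord1 /=; case: i => [|[|i]] /=; rewrite ?eqxx /lam /=; ring.
rewrite [LHS]/= big_mkcond big_ord_recr /= -big_mkcond /= kn /=.
have E0 : \sum_(j < n.+1 | (n < j)%N) lam n j * resolution lam n j i = 0.
  by rewrite big_pred0 // => j; rewrite ltnNge -ltnS ltn_ord.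
rewrite E0 addr0 (eq_bigr (fun j : 'I__ => lam n j *
   ((if i is j'.+1 then resolution lam n j j' else 0) + (e i)%:R * resolution lam n j i))); last first.
  by move=> j _; rewrite -IHn // -ltnS.
have -> : lam n.+1 n.+1 * (i == n.+1)%:R = (e i)%:R * (i == n.+1)%:R.
  by case: eqP => [->|]; rewrite ?mulr0.
case: i {E0} => [|i] /=.
  rewrite !mulr0 !add0r addr0 mulr_sumr.
  by apply: eq_bigr => j _; rewrite add0r mulrCA.
rewrite eqSS -addrA; congr (_ + _); rewrite mulrDr mulr_sumr addrCA addrA addrC.
rewrite -addrA -big_split; congr (_ + _); apply: eq_bigr => j _ /=; ring.
Qed.

Lemma res_lt n k i : (i < k)%N -> (k <= n)%N -> resolution lam n k i = 0.
Proof.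
elim: n k => [|n IHn] k ik kn; first by case: k ik kn.
rewrite /= ltn_eqF ?(leq_trans ik) // add0r big1 // => j kj.
by rewrite IHn ?mulr0 // ?(leq_trans ik) // -ltnS.
Qed.

Lemma res_whitney n i : resolution lam n 0 i = (whitney n i)%:R.
Proof.
elim: n i => [|n IHn] i //; rewrite res_step // natrD natrM -IHn.
by case: i => [|i] /=; rewrite ?IHn.
Qed.

Lemma resolvable_whitney d (L : finTBPOrderType d) (rho : L -> nat) :
  is_rank_function rho -> e 0%N = 1%N ->
  (forall (s : L) i, #|[set w : L | (s <= w)%O && (rho w + i == rho \top%O)%N]|
     = whitney (rho \top%O - rho s) i) ->
  resolvable C L.
Proof.
move=> rhoP e0 cnt; exists rho; split=> //; exists lam; split=> [n k|n|s i].
- exact: ler0n.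
- by rewrite /lam e0.
- by rewrite cnt res_whitney.
Qed.

End Whitney.

Section Boolean.

Lemma whitney_bin n i : whitney (fun=> 1%N) n i = 'C(n, i).
Proof.
elim: n i => [|n IHn] [|i] //=; rewrite ?mul1n ?IHn ?bin0 // ?bin0n //.
by rewrite binS addnC.
Qed.

Lemma lt_proper (T : finType) (A B : {set T}) : (A < B)%O = (A \proper B).
Proof. by rewrite lt_neqAle Order.SetSubsetOrder.leEsubset properEneq. Qed.

Variable n : nat.

Lemma boolean_rank : is_rank_function (fun A : {set 'I_n} => #|A|).
Proof.
apply: is_rank_functionI => [|A B AB|A B AB]; first exact: cards0.
  by apply: proper_card; rewrite -lt_proper.
move: AB; rewrite lt_proper => /properP[AB [x xB xA]].
exists (x |: A); rewrite lt_proper Order.SetSubsetOrder.leEsubset.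
split; last by rewrite cardsU1 xA.
  by apply/properP; split; [exact: subsetUr|exists x; rewrite ?setU11].
by rewrite subUset sub1set xB.
Qed.

Lemma boolean_resolvable (C : numClosedFieldType) : resolvable C {set 'I_n}.
Proof.
apply: (@resolvable_whitney (fun=> 1%N) C _ _ _ boolean_rank) => // A i.
have -> : #|(\top%O : {set 'I_n})| = n by rewrite cardsT card_ord.
have <- : #|~: A| = (n - #|A|)%N by rewrite cardsCs setCK card_ord.
rewrite whitney_bin -cards_draws.
rewrite -(card_imset _ (can_inj (@setCK _))); apply: eq_card => B.
rewrite inE Order.SetSubsetOrder.leEsubset; apply/andP/imsetP.
  case=> AB /eqP nB; exists (~: B); rewrite ?setCK // inE setCS AB.
  by apply/eqP; have := cardsC B; rewrite card_ord; lia.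
case=> D; rewrite inE => /andP[DA /eqP Di] ->; rewrite -setCS setCK; split=> //.
by apply/eqP; have := cardsC D; rewrite card_ord; lia.
Qed.

End Boolean.

Section QBinomial.
Variables (C : numClosedFieldType) (q : nat).
Hypothesis q_gt1 : (1 < q)%N.
Let e k := (q ^ k)%N.
Let lam (n k : nat) : C := (e k)%:R.
Local Notation Q := (q%:R : C).

Let Q0 : Q != 0. Proof. by rewrite pnatr_eq0 -lt0n ltnW. Qed.
Let Q1 n : Q ^+ n.+1 - 1 != 0.
Proof.
by rewrite subr_eq0 -natrX pnatr_eq1 -(expn0 q) eqn_exp2l.
Qed.

(** The product formula for Gaussian binomial coefficients, cleared of
denominators. *)
Lemma whitney_qE n i : (whitney e n i)%:R * \prod_(l < i) (Q ^+ l.+1 - 1) =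
  \prod_(l < i) (Q ^+ (n - l) - 1).
Proof.
elim: n i => [|n IHn] [|i] /=; rewrite ?big_ord0 ?mulr1 //.
- by rewrite mul0r big_ord_recl sub0n expr0 subrr mul0r.
- by rewrite add0n /e mul1n -[LHS]mulr1; have := IHn 0%N; rewrite !big_ord0.
rewrite natrD natrM mulrDl -mulrA IHn {1}big_ord_recr /= mulrA IHn.
rewrite [X in _ + _ * X]big_ord_recr [RHS]big_ord_recl /= subn0 /e natrX.
under [in RHS]eq_bigr => l _ do rewrite /bump /= subSS.
set p := \prod_(l < i) _; have [i_n|n_i] := leqP i n.
  have -> : Q ^+ n.+1 = Q ^+ i.+1 * Q ^+ (n - i) by rewrite -exprD addSn subnKC.
  by ring.
have -> : p = 0; last by rewrite !(mul0r, mulr0) addr0.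
by rewrite /p (bigD1 (Ordinal n_i)) //= subnn expr0 subrr mul0r.
Qed.

Let fact_neq0 i : \prod_(l < i) (Q ^+ l.+1 - 1) != 0.
Proof. by apply/prodf_neq0 => l _; apply: Q1. Qed.

Lemma whitney_q_absorb n i :
  (Q ^+ i.+1 - 1) * (whitney e n.+1 i.+1)%:R = (Q ^+ n.+1 - 1) * (whitney e n i)%:R.
Proof.
apply: (mulIf (fact_neq0 i)); rewrite -[RHS]mulrA whitney_qE.
have := whitney_qE n.+1 i.+1; rewrite big_ord_recr big_ord_recl /= subn0.
under [in RHS]eq_bigr => l _ do rewrite /bump /= subSS.
by move=> <-; ring.
Qed.

Let sum_shift m k (F : nat -> C) :
  \sum_(j < m.+1 | (k < j)%N) F j = \sum_(j < m | (k <= j)%N) F j.+1.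
Proof. by rewrite big_mkcond big_ord_recl /= add0r -big_mkcond. Qed.

(** Raising every label of a walk by one multiplies each of the n - i weights
by q. *)
Lemma res_q_shift n k i : (i <= n)%N ->
  resolution lam n.+1 k.+1 i.+1 = Q ^+ (n - i) * resolution lam n k i.
Proof.
elim: n k i => [|n IHn] k i.
  by rewrite leqn0 => /eqP -> /=; rewrite big_mkcond big_ord1 /= addr0 mul1r.
rewrite leq_eqVlt => /orP[/eqP ->|].
  rewrite subnn mul1r !resS !eqxx; congr (_ + _).
  by rewrite !big1 // => j _; rewrite res_gt ?mulr0.
rewrite ltnS => i_n; rewrite resS [in RHS]resS eqSS ltn_eqF ?ltnS // !add0r.
rewrite (sum_shift n.+1 k (fun j => lam n.+1 j * resolution lam n.+1 j i.+1)) mulr_sumr.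
apply: eq_bigr => j _.
rewrite IHn // /lam /e subSn // !natrX !exprS; ring.
Qed.

(** The weights of the step at the bottom of an affine geometry: the solution of the
triangular system in [affine_res]. *)
Definition affine_lam (n k : nat) : C := \prod_(l < k) (Q - Q ^+ l.+1 / Q ^+ n).

Lemma affine_lamSS n k :
  affine_lam n.+1 k.+1 = (Q - (Q ^+ n)^-1) * affine_lam n k.
Proof.
rewrite /affine_lam big_ord_recl /=; congr (_ * _).
  by rewrite expr1 exprS; field; rewrite expf_neq0.
apply: eq_bigr => l _; rewrite /bump /= add1n exprS [Q ^+ n.+1]exprS.
by field; rewrite expf_neq0.
Qed.

Lemma affine_lam_ge0 n k : (k <= n)%N -> 0 <= affine_lam n k.
Proof.
move=> kn; apply: prodr_ge0 => l _; rewrite subr_ge0 ler_pdivrMr; last first.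
  by rewrite exprn_gt0 // ltr0n ltnW.
have ln : (l.+1 <= n.+1)%N by rewrite ltnS ltnW // (leq_trans _ kn).
have := leq_pexp2l (ltnW q_gt1) ln; rewrite -(ler_nat C) !natrX => h.
by rewrite -[Q * _]exprS.
Qed.

(** The right-hand side is the number of affine subspaces of codimension i.
Splitting off the label 0 and lowering the other labels by one with
[res_q_shift] leaves the same identity in one dimension less; the factors match
by [whitney_q_absorb]. *)
Lemma affine_res n i : (i <= n)%N ->
  \sum_(j < n.+1) affine_lam n j * resolution lam n j i = Q ^+ i * resolution lam n 0 i.
Proof.
elim: n i => [|n IHn] i i_n.
  by move: i_n; rewrite leqn0 => /eqP ->; rewrite big_ord1 /affine_lam big_ord0.
rewrite big_ord_recl {1}/affine_lam big_ord0 mul1r.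
case: i i_n => [|i] i_n.
  rewrite big1 ?addr0 ?mul1r // => j _.
  by rewrite res_lt ?mulr0 // lift0.
rewrite (eq_bigr (fun j : 'I__ => ((Q - (Q ^+ n)^-1) * Q ^+ (n - i)) *
   (affine_lam n j * resolution lam n j i))); last first.
  by move=> j _; rewrite lift0 affine_lamSS res_q_shift //; ring.
rewrite -mulr_sumr IHn // !res_whitney.
have -> : (Q - (Q ^+ n)^-1) * Q ^+ (n - i) * (Q ^+ i * (whitney e n i)%:R) =
   (Q ^+ n.+1 - 1) * (whitney e n i)%:R.
  rewrite mulrA -[_ * _ * Q ^+ i]mulrA -exprD subnK // exprS.
  by congr (_ * _); field; rewrite expf_neq0.
by rewrite -whitney_q_absorb; ring.
Qed.

End QBinomial.

(** * Projective geometries *)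

Lemma card_fibers (T U : finType) (A : {pred T}) (B : {pred U}) (m : T -> U) :
  (forall w, w \in A -> m w \in B) ->
  #|A| = (\sum_(v in B) #|[set w in A | m w == v]|)%N.
Proof.
move=> AB; rewrite -sum1_card (partition_big m (mem B)) //=.
apply: eq_bigr => v _; rewrite -sum1_card; apply: eq_bigl => w.
by rewrite inE.
Qed.

(** The hyperplane step.  The elements above s are split by a predicate h, being
below a fixed coatom, and m is the meet with this coatom.  For a cover a of s
outside the coatom, m is a bijection from the elements above a onto those above
s satisfying h ([fiber_a]), while above s its fibres outside h have sizes
depending on the corank ([fiber_s]). *)
Section LocalStep.
Variables (d : Order.disp_t) (L : finPOrderType d) (cork : L -> nat).

Definition whitney_number (s : L) (i : nat) : nat :=
  #|[set w : L | (s <= w)%O && (cork w == i)]|.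

Variables (s a : L) (h : pred L) (m : L -> L) (e : nat -> nat).
Hypothesis above_a : forall w, (a <= w)%O -> (s <= w)%O && ~~ h w.
Hypothesis mP : forall w, (s <= w)%O -> ~~ h w ->
  [/\ (s <= m w)%O, h (m w) & cork (m w) = (cork w).+1].
Hypothesis fiber_a : forall v, (s <= v)%O -> h v ->
  #|[set w : L | (a <= w)%O && (m w == v)]| = 1%N.

Lemma count_below_hyper i :
  #|[set w : L | [&& (s <= w)%O, h w & cork w == i]]| =
  (if i is j.+1 then whitney_number a j else 0)%N.
Proof.
case: i => [|j].
  apply: eq_card0 => v; rewrite !inE; apply/negP => /and3P[sv hv cv].
  have : (0 < #|[set w : L | (a <= w)%O && (m w == v)]|)%N by rewrite fiber_a.
  case/card_gt0P => w; rewrite inE => /andP[/above_a/andP[sw hw] /eqP mw].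
  by have [_ _] := mP sw hw; rewrite mw (eqP cv).
rewrite /whitney_number [RHS](card_fibers (m := m)
  (B := [set w : L | [&& (s <= w)%O, h w & cork w == j.+1]])); last first.
  move=> w; rewrite !inE => /andP[/above_a/andP[sw hw] /eqP <-].
  by case: (mP sw hw) => -> -> ->; rewrite eqxx.
rewrite -[LHS]sum1_card; apply: eq_bigr => v; rewrite inE => /and3P[sv hv cv].
rewrite -(fiber_a sv hv); apply: eq_card => w; rewrite !inE.
case aw: (a <= w)%O => //=; case: eqP => [mw|_]; last by rewrite andbF.
have /andP[sw hw] := above_a aw; have [_ _] := mP sw hw.
by rewrite mw (eqP cv) => -[->]; rewrite eqxx.
Qed.

Hypothesis fiber_s : forall v, (s <= v)%O -> h v ->
  #|[set w : L | [&& (s <= w)%O, ~~ h w & m w == v]]| = e (cork v).-1.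

Lemma local_step i : whitney_number s i =
  ((if i is j.+1 then whitney_number a j else 0) + e i * whitney_number a i)%N.
Proof.
have -> : whitney_number s i =
    (#|[set w : L | [&& (s <= w)%O, h w & cork w == i]]| + #|[set w : L | [&& (s <= w)%O, ~~ h w & cork w == i]]|)%N.
  rewrite /whitney_number -(cardsID [set w | h w]); congr (_ + _)%N;
    apply: eq_card => w; rewrite !inE; case: (h w); rewrite ?andbT ?andbF //=.
rewrite count_below_hyper; congr (_ + _)%N.
rewrite -[whitney_number a i](count_below_hyper i.+1) [LHS](card_fibers (m := m)
    (B := [set w : L | [&& (s <= w)%O, h w & cork w == i.+1]])); last first.
  move=> w; rewrite !inE => /and3P[sw hw /eqP <-].
  by case: (mP sw hw) => -> -> ->; rewrite eqxx.
rewrite (eq_bigr (fun=> e i)) ?sum_nat_const ?[(e i * _)%N]mulnC // => v.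
rewrite inE => /and3P[sv hv /eqP cv].
rewrite (_ : e i = e (cork v).-1) ?cv // -cv -(fiber_s sv hv).
apply: eq_card => w; rewrite !inE.
case sw: (s <= w)%O => //=; case hw: (h w) => //=.
case: (m w =P v) => [mw|]; rewrite ?andbF ?andbT //.
by have [_ _] := mP sw (negbT hw); rewrite mw cv => -[->]; rewrite eqxx.
Qed.

End LocalStep.

Section Projective.
Variables (F : finFieldType) (n : nat).
Local Notation L := (induced (projective_lattice F n)).
Local Notation q := #|F|.

Lemma row_spaceS (U V : 'M[F]_n) : (row_space U \subset row_space V) = (U <= V)%MS.
Proof.
apply/subsetP/idP => [h|UV v]; last by rewrite !inE => /submx_trans; apply.
by apply/rV_subP => v vU; have := h v; rewrite !inE; apply.
Qed.

Lemma card_row_space (U : 'M[F]_n) : #|row_space U| = (q ^ \rank U)%N.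
Proof.
have -> : row_space U = [set v *m row_base U | v : 'rV[F]_(\rank U)].
  apply/setP => v; rewrite inE; apply/idP/imsetP => [|[w _ ->]].
    by rewrite -(eq_row_base U) => /submxP[w ->]; exists w.
  by rewrite -(eq_row_base U) submxMl.
rewrite card_imset ?card_mx ?mul1n //.
by apply: row_free_inj; apply: row_base_free.
Qed.

Lemma submx_cap_eq (U V : 'M[F]_n) : (U <= V)%MS -> (\rank V <= \rank U)%N -> (V <= U)%MS.
Proof. by move=> UV; rewrite (geq_leqif (mxrank_leqif_sup UV)). Qed.

(** The elements of the lattice are sets of vectors; matrices of generators give
access to the theory of ranks.  The default 0 is not reached. *)
Definition mx_of (x : L) : 'M[F]_n :=
  odflt 0 [pick U : 'M[F]_n | row_space U == val x].

Lemma mx_ofE x : row_space (mx_of x) = val x.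
Proof.
rewrite /mx_of; case: pickP => [U /eqP //|no].
have /imsetP[U _ UE] : val x \in linear_subspaces F n := valP x.
by have := no U; rewrite UE eqxx.
Qed.

Lemma row_space_in (U : 'M[F]_n) : row_space U \in bs_set (projective_lattice F n).
Proof. exact: imset_f. Qed.

Definition of_mx (U : 'M[F]_n) : L := Induced (row_space_in U).

Lemma proj_le x y : (x <= y)%O = (mx_of x <= mx_of y)%MS.
Proof.
by rewrite -row_spaceS !mx_ofE -Order.le_val Order.SetSubsetOrder.leEsubset.
Qed.

Lemma le_of_mx U y : (of_mx U <= y)%O = (U <= mx_of y)%MS.
Proof.
by rewrite -row_spaceS mx_ofE -Order.le_val Order.SetSubsetOrder.leEsubset.
Qed.

Lemma ge_of_mx U y : (y <= of_mx U)%O = (mx_of y <= U)%MS.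
Proof.
by rewrite -row_spaceS mx_ofE -Order.le_val Order.SetSubsetOrder.leEsubset.
Qed.

Lemma of_mxK U : (mx_of (of_mx U) :=: U)%MS.
Proof. by apply/eqmxP; rewrite -!row_spaceS mx_ofE subxx. Qed.

Definition proj_rank (x : L) := \rank (mx_of x).

Lemma proj_rank_of U : proj_rank (of_mx U) = \rank U.
Proof. by rewrite /proj_rank of_mxK. Qed.

Lemma rank_adds_row (U : 'M[F]_n) (v : 'rV[F]_n) : ~~ (v <= U)%MS ->
  \rank (U + v)%MS = (\rank U).+1.
Proof.
move=> vU; apply/eqP; rewrite eqn_leq; apply/andP; split.
  apply: leq_trans (mxrank_adds_leqif U v).1 _; rewrite -[X in (_ <= X)%N]addn1 leq_add2l.
  exact: rank_leq_row.
have : (U < U + v)%MS.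
  by rewrite /ltmx addsmxSl /=; apply: contra vU; apply: submx_trans; apply: addsmxSr.
exact: rank_ltmx.
Qed.

Lemma proj_top : proj_rank \top%O = n.
Proof.
have -> : \top%O = of_mx 1%:M.
  by apply: val_inj; rewrite /= row_space1.
by rewrite proj_rank_of mxrank1.
Qed.

Lemma proj_rank_function : is_rank_function proj_rank.
Proof.
apply: is_rank_functionI => [|x y xy|x y xy].
- have -> : \bot%O = of_mx 0 by apply: val_inj.
  by rewrite proj_rank_of mxrank0.
- by apply: rank_ltmx; rewrite /ltmx -!proj_le -lt_leAnge.
have /row_subPn[i vx] : ~~ (mx_of y <= mx_of x)%MS by rewrite -proj_le lt_geF.
set v := row i _ in vx; exists (of_mx (mx_of x + v)%MS); split.
- rewrite lt_leAnge ge_of_mx le_of_mx addsmxSl /=.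
  by apply: contra vx; apply: submx_trans; apply: addsmxSr.
- by rewrite le_of_mx addsmx_sub -proj_le (ltW xy) row_sub.
- by rewrite proj_rank_of rank_adds_row.
Qed.

Section Hyperplane.
Variable H : 'M[F]_n.
Hypothesis rkH : (\rank H).+1 = n.

Lemma rank_cap_hyper (W : 'M[F]_n) : ~~ (W <= H)%MS ->
  \rank W = (\rank (W :&: H)%MS).+1.
Proof.
move=> WH; have := mxrank_sum_cap W H.
have -> : \rank (W + H)%MS = n.
  apply/eqP; rewrite eqn_leq rank_leq_row -{1}rkH rank_ltmx // /ltmx addsmxSr /=.
  by apply: contra WH; apply: submx_trans; apply: addsmxSl.
by rewrite -[X in (X + _)%N]rkH addSnnS addnC => /addIn.
Qed.

(** If W is not below H then W has dimension one more than W :&: H, so a vector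
of W outside H and W :&: H generate W. *)
Lemma hyper_unique (V W : 'M[F]_n) (v : 'rV[F]_n) : (V <= H)%MS -> ~~ (v <= H)%MS ->
  ((v <= W)%MS && (W :&: H == V)%MS) = (W == V + v)%MS.
Proof.
move=> VH vH; have vV : ~~ (v <= V)%MS by apply: contra vH => /submx_trans; apply.
have vsub : ~~ (V + v <= H)%MS.
  by apply: contra vH; apply: submx_trans; apply: addsmxSr.
apply/andP/eqmxP => [[vW /eqmxP WH]|e].
  have VW : (V + v <= W)%MS by rewrite addsmx_sub vW -WH capmxSl.
  have WnH : ~~ (W <= H)%MS by apply: contra vH; apply: submx_trans.
  apply/eqmxP; rewrite VW andbT submx_cap_eq // rank_adds_row //.
  by rewrite (rank_cap_hyper WnH) WH.
rewrite e addsmxSr; split=> //.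
have e2 : \rank (W :&: H)%MS = \rank V.
  have WnH : ~~ (W <= H)%MS by rewrite e.
  by apply/eq_add_S; rewrite -(rank_cap_hyper WnH) e rank_adds_row.
have VWH : (V <= W :&: H)%MS by rewrite sub_capmx VH e addsmxSl.
by rewrite VWH andbT submx_cap_eq // e2.
Qed.

End Hyperplane.

(** The fibre over V <= H consists of the lines of the quotient by V outside H.
Counting pairs of such a subspace and a vector in it outside H in two ways
gives q to the codimension of V in H. *)
Lemma proj_count (s : L) i :
  whitney_number (fun w => (n - proj_rank w)%N) s i =
  whitney (expn q) (n - proj_rank s) i.
Proof.
have q1 : (1 < q)%N by apply: card_finNzRing_gt1.
have rk_n x : (proj_rank x <= n)%N by apply: rank_leq_row.
have [k] := ubnP (n - proj_rank s)%N.
elim: k s i => // k IHk s i; rewrite ltnS => sk.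
have [sn|sn] := eqVneq (proj_rank s) n.
  rewrite sn subnn /= /whitney_number.
  have sT : s = \top%O.
    apply/le_anti; rewrite lex1 proj_le submx_cap_eq //; last first.
      by rewrite -/(proj_rank s) sn; apply: rank_leq_row.
    by rewrite -proj_le lex1.
  rewrite (_ : [set w | _] = if i == 0%N then [set \top%O] else set0).
    by case: (i == 0%N); rewrite ?cards1 ?cards0.
  apply/setP => w; rewrite !inE sT.
  have -> : (\top <= w)%O = (w == \top%O) by rewrite eq_le lex1.
  have [->|wT] := eqVneq w \top%O; rewrite ?proj_top ?subnn /=.
    by rewrite eq_sym; case: eqP => _; rewrite !inE ?eqxx.
  by case: (i == 0%N); rewrite !inE // (negbTE wT).
have sn' : (proj_rank s < n)%N by rewrite ltn_neqAle sn rk_n.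
have [|H [sH _ Hn]] := rank_between proj_rank_function (i := n.-1) (lex1 s).
  by rewrite proj_top; lia.
pose HM := mx_of H.
have rkH : (\rank HM).+1 = n by rewrite -/(proj_rank H) Hn prednK //; apply: leq_ltn_trans sn'.
have /row_subPn[j vH] : ~~ (1%:M <= HM)%MS.
  by apply/negP => /mxrankS; rewrite mxrank1 -[X in (X <= _)%N]rkH ltnn.
set v := row j _ in vH.
pose a := of_mx (mx_of s + v)%MS.
pose h (w : L) := (w <= H)%O.
pose m (w : L) := of_mx (mx_of w :&: HM)%MS.
have vs : ~~ (v <= mx_of s)%MS.
  by apply: contra vH => /submx_trans; apply; rewrite -proj_le.
have ra : (n - proj_rank s = (n - proj_rank a).+1)%N.
  by rewrite proj_rank_of rank_adds_row // -/(proj_rank s) subnSK.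
have mE w x : (m w == x) = (mx_of w :&: HM == mx_of x)%MS.
  by rewrite eq_le le_of_mx ge_of_mx.
rewrite (@local_step _ _ _ s a h m (expn q)); first last.
- move=> V sV hV; have VH : (mx_of V <= HM)%MS by rewrite -proj_le.
  set Fib := [set w | _].
  have FibP w : w \in Fib = ~~ (mx_of w <= HM)%MS && (mx_of w :&: HM == mx_of V)%MS.
    rewrite inE /h -/HM mE proj_le; case: (mx_of w <= HM)%MS; rewrite ?andbF //=.
    case e: (mx_of w :&: HM == mx_of V)%MS; rewrite ?andbF ?andbT //.
    rewrite proj_le; apply: submx_trans (_ : (mx_of V <= _)%MS); first by rewrite -proj_le.
    by move/eqmxP: e => <-; apply: capmxSl.
  have cntw w : w \in Fib -> #|row_space (mx_of w) :\: row_space HM| =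
      (q ^ (proj_rank V) * (q - 1))%N.
    rewrite FibP => /andP[wH /eqmxP e].
    have capE : row_space (mx_of w) :&: row_space HM = row_space (mx_of V).
      by apply/setP => z; rewrite !inE -e sub_capmx.
    rewrite cardsD capE !card_row_space (rank_cap_hyper rkH wH) e.
    by rewrite -/(proj_rank V) expnSr mulnBr muln1.
  have cntT : #|~: row_space HM| = (q ^ n.-1 * (q - 1))%N.
    rewrite cardsCs setCK card_row_space card_mx mul1n -/(proj_rank H) Hn.
    by rewrite -{1}rkH -/(proj_rank H) Hn expnSr mulnBr muln1.
  (* Both sides count pairs of w in the fibre and a vector z in w outside H. *)
  have dbl : (#|Fib| * (q ^ proj_rank V * (q - 1)) = q ^ n.-1 * (q - 1))%N.
    rewrite -cntT -sum_nat_const -(eq_bigr _ cntw) -sum1_card.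
    rewrite (eq_bigr (fun w => (\sum_(z in ~: row_space HM) (z \in row_space (mx_of w)))%N)); last first.
      move=> w _; rewrite -sum1_card big_mkcond [RHS]big_mkcond /=.
      by apply: eq_bigr => z _; rewrite !inE; case: (z <= HM)%MS.
    rewrite exchange_big /=; apply: eq_bigr => z; rewrite !inE => zH.
    transitivity #|[set of_mx (mx_of V + z)%MS]|; last by rewrite cards1.
    rewrite -sum1_card [RHS]big_mkcond [LHS]big_mkcond /=; apply: eq_bigr => w _.
    rewrite FibP !inE eq_le le_of_mx ge_of_mx -(hyper_unique rkH _ VH zH).
    case zw: (z <= mx_of w)%MS; rewrite /= ?andbF //; last by case: ifP.
    suff -> : (mx_of w <= HM)%MS = false by [].
    by apply/negP => wH; rewrite (submx_trans zw wH) in zH.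
  have Vn : (proj_rank V <= n.-1)%N by rewrite -Hn; apply: mxrankS.
  have q0 : (0 < q - 1)%N by rewrite subn_gt0.
  move: dbl; rewrite mulnA => /eqP; rewrite eqn_pmul2r // => /eqP.
  rewrite -{1}(subnK Vn) expnD => /eqP; rewrite eqn_pmul2r ?expn_gt0 ?(ltnW q1) //.
  by move/eqP => ->; congr (_ ^ _)%N; lia.
- move=> V sV hV; transitivity #|[set of_mx (mx_of V + v)%MS]|; last exact: cards1.
  apply: eq_card => w.
  rewrite !inE mE le_of_mx addsmx_sub.
  have VH : (mx_of V <= HM)%MS by rewrite -proj_le.
  have := hyper_unique rkH (mx_of w) VH vH.
  have -> : (w == of_mx (mx_of V + v)%MS) = (mx_of w == mx_of V + v)%MS.
    by rewrite eq_le le_of_mx ge_of_mx.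
  move=> <-; case: (v <= mx_of w)%MS; rewrite ?andbF ?andbT //=.
  case e: (mx_of w :&: HM == mx_of V)%MS; rewrite ?andbF ?andbT //.
  apply: submx_trans (_ : (mx_of V <= _)%MS); first by rewrite -proj_le.
  by move/eqmxP: e => <-; apply: capmxSl.
- move=> w sw wH; split.
  + by rewrite ge_of_mx sub_capmx -!proj_le sw.
  + by rewrite /h le_of_mx capmxSr.
  + rewrite proj_rank_of /proj_rank (rank_cap_hyper rkH (W := mx_of w)) -?proj_le //.
    have := rank_leq_row (mx_of w); rewrite (rank_cap_hyper rkH (W := mx_of w)) -?proj_le //.
    by move=> ?; rewrite subnSK.
- move=> w; rewrite le_of_mx addsmx_sub /h !proj_le => /andP[-> vw] /=.
  by apply: contra vH => /(submx_trans vw).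
rewrite ra /= !IHk //; last by rewrite -ltnS -ra.
by case: i => // i; rewrite !IHk // -ltnS -ra.
Qed.

Lemma projective_resolvable (C : numClosedFieldType) : resolvable C L.
Proof.
apply: (@resolvable_whitney (expn q) C _ _ _ proj_rank_function) => // s i.
rewrite proj_top -proj_count; apply: eq_card => w; rewrite !inE; congr (_ && _).
have : (proj_rank w <= n)%N by apply: rank_leq_row.
lia.
Qed.

End Projective.

(** * Affine geometries *)

Section Affine.
Variables (F : finFieldType) (n : nat).
Local Notation PL := (induced (projective_lattice F n)).
Local Notation L := (induced (affine_lattice F n)).
Local Notation q := #|F|.

Let q1 : (1 < q)%N. Proof. exact: card_finNzRing_gt1. Qed.

Definition translate (p : 'rV[F]_n) (W : PL) : {set 'rV[F]_n} :=
  [set p + v | v in val W].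

Lemma translate_in p W : translate p W \in bs_set (affine_lattice F n).
Proof.
by rewrite /translate -(mx_ofE W); apply/setU1P; right; apply: imset2_f.
Qed.

Definition aff (p : 'rV[F]_n) (W : PL) : L := Induced (translate_in p W).

Lemma mem_aff p W x : (x \in val (aff p W)) = (x - p \in val W).
Proof.
apply/imsetP/idP => [[v vW ->]|xW]; first by rewrite addrC addrA addNr add0r.
by exists (x - p); rewrite // addrC subrK.
Qed.

Lemma affP p (x : L) : p \in val x -> exists W, x = aff p W.
Proof.
have := valP x; rewrite -[bs_set _]/(affine_set F n) => /setU1P[->|]; first by rewrite inE.
case/imset2P => a U _ _ xE; rewrite xE => /imsetP[v vU pE].
exists (of_mx U); apply: val_inj; rewrite xE; apply/setP => z; rewrite mem_aff /=.
transitivity (z - a \in row_space U).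
  apply/imsetP/idP => [[u uU ->]|zU]; first by rewrite addrC addrA addNr add0r.
  by exists (z - a); rewrite // addrC subrK.
move: vU; rewrite pE opprD addrA !inE => vU; apply/idP/idP => h.
  by rewrite addmx_sub // eqmx_opp.
by rewrite -(subrK v (z - a)) addmx_sub.
Qed.

Lemma aff_le p W W' : (aff p W <= aff p W')%O = (W <= W')%O.
Proof.
rewrite -!Order.le_val !Order.SetSubsetOrder.leEsubset.
apply/subsetP/subsetP => h z.
  by move=> zW; have := h (p + z); rewrite !mem_aff addrC addrA addNr add0r; apply.
by rewrite !mem_aff; apply: h.
Qed.

Lemma aff_inj p : injective (aff p).
Proof. by move=> W W' e; apply/le_anti; rewrite -!(aff_le p) e lexx. Qed.

Lemma card_aff p W : #|val (aff p W)| = (q ^ proj_rank W)%N.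
Proof. by rewrite card_imset; [rewrite -mx_ofE card_row_space|exact: addrI]. Qed.

Lemma base_aff p W : p \in val (aff p W).
Proof. by rewrite mem_aff subrr -mx_ofE inE sub0mx. Qed.

(** The dimension plus one, read off from the number of points. *)
Definition aff_rank (x : L) : nat :=
  if val x == set0 then 0%N else (trunc_log q #|val x|).+1.

Lemma aff_rankE p W : aff_rank (aff p W) = (proj_rank W).+1.
Proof.
rewrite /aff_rank ifN ?card_aff ?trunc_expnK //.
by apply/set0Pn; exists p; apply: base_aff.
Qed.

Lemma affine_bot : val (\bot%O : L) = set0.
Proof. by []. Qed.

Lemma aff_rank_bot : aff_rank \bot%O = 0%N.
Proof. by rewrite /aff_rank affine_bot eqxx. Qed.

Lemma eq_bot (x : L) : (x == \bot%O) = (val x == set0).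
Proof. by rewrite -(inj_eq val_inj). Qed.

Lemma aff_top : \top%O = aff 0 \top%O.
Proof. by apply: val_inj; apply/setP => z; rewrite mem_aff !inE. Qed.

Lemma aff_rank_top : aff_rank \top%O = n.+1.
Proof. by rewrite aff_top aff_rankE proj_top. Qed.

Lemma sub_aff p W (y : L) : (aff p W <= y)%O ->
  exists2 W', y = aff p W' & (W <= W')%O.
Proof.
move=> Wy; have [W' yE] : exists W', y = aff p W'.
  apply: affP; move: Wy; rewrite -Order.le_val Order.SetSubsetOrder.leEsubset.
  by move/subsetP; apply; apply: base_aff.
by exists W' => //; rewrite yE aff_le in Wy.
Qed.

Lemma affine_cases (x : L) : x = \bot%O \/ exists p W, x = aff p W.
Proof.
have [/eqP x0|/set0Pn[p px]] := boolP (val x == set0).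
  by left; apply/eqP; rewrite eq_bot x0.
by right; exists p; apply: affP.
Qed.

Lemma affine_rank_function : is_rank_function aff_rank.
Proof.
apply: is_rank_functionI => [|x y|x y]; first exact: aff_rank_bot.
  case: (affine_cases x) => [->|[p [W ->]] Wy].
    rewrite lt0x eq_bot aff_rank_bot => /set0Pn[p /affP[W ->]].
    by rewrite aff_rankE.
  have [W' yE WW'] := sub_aff (ltW Wy); rewrite yE !aff_rankE ltnS.
  apply: (rank_function_lt (@proj_rank_function F n)).
  by rewrite lt_neqAle WW' andbT; apply: contraTneq Wy => ->; rewrite yE ltxx.
case: (affine_cases x) => [->|[p [W ->]] Wy].
  rewrite lt0x eq_bot aff_rank_bot => /set0Pn[p /affP[W ->]].
  exists (aff p \bot%O); rewrite lt0x eq_bot aff_le le0x aff_rankE.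
  rewrite (proj_rank_function F n).1; split=> //.
  by apply/set0Pn; exists p; apply: base_aff.
have [W' yE WW'] := sub_aff (ltW Wy).
have WW : (W < W')%O.
  by rewrite lt_neqAle WW' andbT; apply: contraTneq Wy => ->; rewrite yE ltxx.
have [|V [WV VW' rV]] := rank_between (@proj_rank_function F n) (i := (proj_rank W).+1) WW'.
  by rewrite leqnSn (rank_function_lt (@proj_rank_function F n)).
exists (aff p V); rewrite yE !aff_rankE aff_le rV; split=> //.
rewrite lt_neqAle aff_le WV andbT (inj_eq (@aff_inj p)).
by apply: contra_eqN rV => /eqP <-; rewrite neq_ltn ltnSn.
Qed.

Local Notation cork := (fun x : L => (n.+1 - aff_rank x)%N).

Lemma affine_count p W i :
  whitney_number cork (aff p W) i = whitney (expn q) (n - proj_rank W) i.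
Proof.
rewrite -proj_count /whitney_number -(card_imset _ (@aff_inj p)).
apply: eq_card => y; rewrite !inE; apply/andP/imsetP => [[]|[V]].
  by move=> /sub_aff[V -> WV]; rewrite aff_rankE subSS => c; exists V; rewrite // inE WV.
by rewrite inE => /andP[WV c] ->; rewrite aff_le aff_rankE subSS.
Qed.

(** Double counting of pairs of an affine subspace of codimension i and a point in it: through
every point there are as many as linear subspaces. *)
Lemma affine_count_bot i : (i <= n)%N ->
  whitney_number cork \bot%O i = (q ^ i * whitney (expn q) n i)%N.
Proof.
move=> i_n; set A := [set x : L | (\bot <= x)%O && (cork x == i)].
have cA x : x \in A -> #|val x| = (q ^ (n - i))%N.
  rewrite inE le0x /=; case: (affine_cases x) => [->|[p [W ->]]].
    by rewrite aff_rank_bot subn0 => /eqP e; move: i_n; rewrite -e ltnn.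
  rewrite aff_rankE card_aff subSS => /eqP <-; rewrite subKn //.
  exact: rank_leq_row.
have dbl : (#|A| * q ^ (n - i) = q ^ n * whitney (expn q) n i)%N.
  rewrite -sum_nat_const -(eq_bigr _ cA).
  rewrite (eq_bigr (fun x : L => (\sum_(z : 'rV[F]_n) (z \in val x))%N)); last first.
    by move=> x _; rewrite -sum1_card big_mkcond; apply: eq_bigr => z _; case: (z \in _).
  rewrite exchange_big /=.
  have -> : (q ^ n)%N = #|{: 'rV[F]_n}| by rewrite card_mx mul1n.
  rewrite -sum_nat_const; apply: eq_bigr => z _.
  have := affine_count z \bot%O i; rewrite (proj_rank_function F n).1 subn0 => <-.
  rewrite /whitney_number -sum1_card [LHS]big_mkcond [RHS]big_mkcond /=.
  apply: eq_bigr => x _; rewrite !inE le0x /= andbC; case: (_ == i) => //=.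
  have [zx|zx] := boolP (z \in _).
    by have [W ->] := affP zx; rewrite aff_le le0x.
  case: ifP => // /sub_aff[W xE _]; move: zx; rewrite xE; case/negP.
  exact: base_aff.
have qn : (q ^ n = q ^ i * q ^ (n - i))%N by rewrite -expnD subnKC.
move: dbl; rewrite qn mulnAC => /eqP.
by rewrite eqn_pmul2r ?expn_gt0 ?(ltnW q1) // => /eqP.
Qed.

(** The weights are those of the projective geometry except for the step from
the empty set, at corank n + 1, to the points. *)
Lemma affine_resolvable (C : numClosedFieldType) : resolvable C L.
Proof.
pose lq (m k : nat) : C := (q ^ k)%:R.
pose lam (m k : nat) : C :=
  if m == n then (if (k <= n)%N then affine_lam C q n k else 0) else lq m k.
have res_lq m k i : (m <= n)%N -> resolution lam m k i = resolution lq m k i.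
  elim: m k i => // m IHm k i mn; rewrite !resS; congr (_ + _).
  by apply: eq_bigr => j _; rewrite IHm ?(ltnW mn) // /lam ltn_eqF.
exists aff_rank; split; first exact: affine_rank_function.
exists lam; split=> [m k|m|s i].
- rewrite /lam /lq; case: ifP => _; last exact: ler0n.
  by case: ifP => // kn; apply: affine_lam_ge0.
- rewrite /lam; case: ifP => _; last by rewrite /lq expn0.
  by rewrite /affine_lam big_ord0.
rewrite aff_rank_top.
have -> : #|[set w : L | (s <= w)%O && (aff_rank w + i == n.+1)%N]| =
   whitney_number cork s i.
  apply: eq_card => w; rewrite !inE; congr (_ && _).
  have : (aff_rank w <= n.+1)%N.
    by rewrite -aff_rank_top (rank_function_le affine_rank_function) ?lex1.
  lia.
case: (affine_cases s) => [->|[p [W ->]]]; last first.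
  rewrite affine_count aff_rankE subSS res_lq ?leq_subr // -res_whitney //.
rewrite aff_rank_bot subn0 resS.
rewrite (eq_bigr (fun j : 'I__ => affine_lam C q n j * resolution lq n j i)); last first.
  by move=> j _; rewrite /lam eqxx -ltnS ltn_ord res_lq.
have [i_n|] := leqP i n.
  rewrite ltn_eqF // add0r affine_res // affine_count_bot // natrM natrX.
  by rewrite res_whitney.
rewrite leq_eqVlt => /orP[/eqP <-|n_i].
  rewrite eqxx big1 ?addr0; last by move=> j _; rewrite res_gt ?mulr0.
  congr _%:R; transitivity #|[set \bot%O : L]|; last exact: cards1.
  apply: eq_card => x; rewrite !inE le0x /=.
  case: (affine_cases x) => [->|[p [W ->]]]; first by rewrite aff_rank_bot !eqxx.
  rewrite aff_rankE subSS ltn_eqF ?ltnS ?leq_subr // eq_bot.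
  by apply/esym/negbTE/set0Pn; exists p; apply: base_aff.
rewrite gtn_eqF // big1 ?addr0; last by move=> j _; rewrite res_gt ?mulr0 // ltnW.
rewrite (_ : whitney_number _ _ _ = 0%N) //; apply: eq_card0 => x; rewrite !inE.
by rewrite andbC ltn_eqF // (leq_ltn_trans (leq_subr _ _)).
Qed.

End Affine.

(** * Counting by kernels; partition lattices *)

Section KernelMethod.
Variable e : nat -> nat.
Local Notation chip t k := (\prod_(j < k) (t - (e j)%:R)).

Lemma whitney_expand (t : rat) n :
  t ^+ n = \sum_(i < n.+1) (whitney e n i)%:R * chip t i.
Proof.
elim: n => [|n IHn]; first by rewrite big_ord1 big_ord0 mulr1.
rewrite exprS IHn.
have shift : \sum_(i < n.+2) (whitney e n.+1 i)%:R * chip t i =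
   \sum_(i < n.+2) ((e i * whitney e n i)%N)%:R * chip t i +
   \sum_(i < n.+1) (whitney e n i)%:R * chip t i.+1.
  rewrite big_ord_recl [X in _ = X + _]big_ord_recl -addrA -big_split /=.
  by rewrite add0n; congr (_ + _); apply: eq_bigr => i _; rewrite natrD mulrDl addrC.
rewrite shift [X in _ = X + _]big_ord_recr /= whitney_gt // muln0 mul0r addr0 -big_split mulr_sumr.
by apply: eq_bigr => i _; rewrite big_ord_recr natrM /=; ring.
Qed.

(** The polynomials are monic of distinct degrees. *)
Lemma chip_free B (c : nat -> rat) :
  \sum_(i < B) c i *: \prod_(j < i) ('X - ((e j)%:R)%:P) = 0 ->
  forall i, (i < B)%N -> c i = 0.
Proof.
elim: B => // B IHB; rewrite big_ord_recr /= => s0.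
have cB : c B = 0.
  have := congr1 (fun p : {poly rat} => p`_B) s0; rewrite coefD coef0 coef_sum.
  rewrite big1 ?add0r => [|i _]; last first.
    rewrite coefZ nth_default ?mulr0 // -(big_mkord xpredT (fun j => 'X - ((e j)%:R)%:P)).
    by rewrite size_prod_XsubC size_iota subn0.
  rewrite coefZ => h; move: h.
  have /monicP : \prod_(j < B) ('X - ((e j)%:R : rat)%:P) \is monic.
    exact: monic_prod_XsubC.
  rewrite lead_coefE -[in X in X`_ _](big_mkord xpredT (fun j => 'X - ((e j)%:R)%:P)).
  rewrite -(big_mkord xpredT (fun j => 'X - ((e j)%:R)%:P)) size_prod_XsubC.
  by rewrite size_iota subn0 /= => ->; rewrite mulr1.
move: s0; rewrite cB scale0r addr0 => /IHB h i; rewrite ltnS leq_eqVlt.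
by case/orP=> [/eqP ->|/h].
Qed.

Variables (d : Order.disp_t) (L : finPOrderType d) (cork : L -> nat) (t : nat -> nat).
Hypothesis t_inj : injective t.
Hypothesis count : forall m (s : L), (t m)%:R ^+ cork s =
  \sum_(w : L | (s <= w)%O) chip ((t m)%:R : rat) (cork w).

(** Both families of numbers expand the same power of t in the basis of
products of the t - e_j: the hypothesis does so at infinitely many values of t,
hence as polynomials. *)
Lemma kernel_method (s : L) i : whitney_number cork s i = whitney e (cork s) i.
Proof.
pose B := (maxn i (\max_(w : L) cork w)).+1.
have corkB w : (cork w < B)%N.
  by rewrite ltnS leq_max (bigop.bigmax_sup w) ?orbT.
pose c j : rat := (whitney_number cork s j)%:R - (whitney e (cork s) j)%:R.
pose p := \sum_(j < B) c j *: \prod_(l < j) ('X - ((e l)%:R)%:P).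
suff p0 : p = 0.
  have iB : (i < B)%N by rewrite ltnS leq_maxl.
  by have /eqP := chip_free p0 iB; rewrite subr_eq0 eqr_nat => /eqP.
apply/eqP; apply: contraT => pn0.
have := @max_poly_roots _ p [seq (t m)%:R | m <- iota 0 (size p)] pn0.
rewrite size_map size_iota ltnn => h; apply: h; last first.
  by rewrite map_inj_uniq ?iota_uniq // => a b /eqP; rewrite eqr_nat => /eqP/t_inj.
apply/allP => _ /mapP[m _ ->]; apply/rootP.
rewrite /p horner_sum (eq_bigr (fun j : 'I_B => c j * chip ((t m)%:R) j)); last first.
  move=> j _; rewrite hornerZ horner_prod; congr (_ * _).
  by apply: eq_bigr => l _; rewrite hornerXsubC.
rewrite (eq_bigr _ (fun j _ => mulrBl _ _ _)) sumrB; apply/eqP; rewrite subr_eq0.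
have <- : (t m)%:R ^+ cork s = \sum_(j < B) (whitney e (cork s) j)%:R * chip ((t m)%:R : rat) j.
  rewrite whitney_expand (big_ord_widen _ (fun j => (whitney e (cork s) j)%:R * chip ((t m)%:R : rat) j) (corkB s)).
  rewrite big_mkcond; apply: eq_bigr => j _; case: ltnP => // sj.
  by rewrite whitney_gt ?mul0r.
rewrite count (partition_big (fun w => inord (cork w) : 'I_B) xpredT) //=.
apply/eqP; apply: eq_bigr => j _.
rewrite [RHS](eq_bigr (fun=> chip ((t m)%:R) j)); last first.
  by move=> w /andP[_ /eqP <-]; rewrite inordK.
rewrite [RHS]big_const iter_addr_0 -[RHS]mulr_natl; congr (_ * _); congr _%:R.
by apply: eq_card => w; rewrite inE [RHS]unfold_in -[in RHS]val_eqE /= inordK.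
Qed.

End KernelMethod.

Lemma natr_ffact (m k : nat) :
  (m ^_ k)%:R = \prod_(l < k) ((m%:R : rat) - l%:R).
Proof.
elim: k => [|k IHk]; first by rewrite big_ord0.
rewrite big_ord_recr /= -IHk ffactnSr natrM.
have [km|mk] := leqP k m; first by rewrite natrB.
by rewrite ffact_small ?mul0r.
Qed.

Section PartitionLattice.
Variable n : nat.
Local Notation L := (setpart n).

(** The partition into the fibres of a function.  Every partition is the kernel
of the map to its blocks ([ker_blk]), which replaces the handling of blocks by
the handling of functions. *)
Definition ker (T : eqType) (f : 'I_n -> T) : L := SetPart (preim_partitionP f setT).

Lemma ker_block (T : eqType) (f : 'I_n -> T) i :
  [set j | f i == f j] \in blocks (ker f).
Proof. by apply/imsetP; exists i => //; apply/setP => j; rewrite !inE. Qed.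

Lemma ker_blockP (T : eqType) (f : 'I_n -> T) A : A \in blocks (ker f) ->
  exists i, A = [set j | f i == f j].
Proof. by case/imsetP=> i _ ->; exists i; apply/setP => j; rewrite !inE. Qed.

Lemma ker_le (T U : eqType) (f : 'I_n -> T) (g : 'I_n -> U) :
  reflect (forall i j, f i = f j -> g i = g j) (ker f <= ker g)%O.
Proof.
apply: (iffP (refinesP _ _)) => [h i j fij|h A /ker_blockP[i ->]].
  have [_ /ker_blockP[k ->] /subsetP sub] := h _ (ker_block f i).
  have := sub i; have := sub j; rewrite !inE fij eqxx => /(_ isT)/eqP <-.
  by move=> /(_ isT)/eqP.
exists [set j | g i == g j]; first exact: ker_block.
by apply/subsetP => j; rewrite !inE => /eqP/h ->.
Qed.

Lemma card_ker (T : finType) (f : 'I_n -> T) : #|blocks (ker f)| = #|[set f i | i : 'I_n]|.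
Proof.
pose h (b : T) := [set j | b == f j].
have -> : blocks (ker f) = h @: [set f i | i : 'I_n].
  apply/setP => A; apply/idP/imsetP => [/ker_blockP[i ->]|[_ /imsetP[i _ ->] ->]].
    by exists (f i) => //; apply: imset_f.
  exact: ker_block.
rewrite card_in_imset // => _ _ /imsetP[i _ ->] /imsetP[j _ ->] /setP/(_ j).
by rewrite !inE eqxx => /eqP.
Qed.

Definition block_of (s : L) (i : 'I_n) : {set 'I_n} := pblock (blocks s) i.

Lemma block_of_in s i : block_of s i \in blocks s.
Proof.
have /and3P[/eqP cov _ _] := valP s.
by rewrite pblock_mem // cov.
Qed.

Definition blk (s : L) (i : 'I_n) : {A | A \in blocks s} :=
  exist (fun A => A \in blocks s) _ (block_of_in s i).

Lemma blk_surj s B : exists i, blk s i = B.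
Proof.
case: B => A As; have /and3P[_ triv A0] := valP s.
have /set0Pn[i iA] : A != set0 by apply: contraNneq A0 => <-.
by exists i; apply: val_inj; apply: def_pblock.
Qed.

Lemma ker_blk s : s = ker (blk s).
Proof.
have /and3P[/eqP cov triv A0] := valP s.
have same i j : (blk s i = blk s j) <-> (i \in pblock (blocks s) j).
  split=> [/(congr1 val) /= e|ij].
    by rewrite -[pblock _ j]/(block_of s j) -e mem_pblock cov.
  by apply: val_inj; apply: same_pblock.
apply/le_anti; apply/andP; split; apply/refinesP => A.
  move=> As; have /set0Pn[i iA] : A != set0 by apply: contraNneq A0 => <-.
  exists [set j | blk s i == blk s j]; first exact: ker_block.
  apply/subsetP => j jA; rewrite inE; apply/eqP/same.
  by rewrite (def_pblock triv As jA).
case/ker_blockP => i ->; exists (block_of s i); first exact: block_of_in.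
by apply/subsetP => j; rewrite inE => /eqP/esym/same.
Qed.

Lemma card_blk (s : L) : #|{: {A | A \in blocks s}}| = #|blocks s|.
Proof. by rewrite card_sig. Qed.

Lemma image_comp (T : finType) (s : L) (g : {A | A \in blocks s} -> T) :
  [set g (blk s i) | i : 'I_n] = g @: setT.
Proof.
apply/setP => x; apply/imsetP/imsetP => [[i _ ->]|[B _ ->]].
  by exists (blk s i).
by have [i <-] := blk_surj B; exists i.
Qed.

(** A coarser partition is a function of the blocks of the finer one. *)
Lemma above_ker (T : finType) (s : L) (f : 'I_n -> T) : (s <= ker f)%O ->
  exists g : {ffun {A | A \in blocks s} -> T}, forall i, f i = g (blk s i).
Proof.
have surj (B : {A | A \in blocks s}) : exists i, blk s i == B.
  by have [i <-] := blk_surj B; exists i.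
move=> sf; exists [ffun B => f (xchoose (surj B))] => i; rewrite ffunE.
move: sf; rewrite {1}(ker_blk s) => /ker_le; apply.
by rewrite (eqP (xchooseP (surj (blk s i)))).
Qed.

Lemma count_above t (s : L) :
  #|[set f : {ffun 'I_n -> 'I_t} | (s <= ker f)%O]| = (t ^ #|blocks s|)%N.
Proof.
rewrite -card_blk -[t in RHS]card_ord -card_ffun.
pose F (g : {ffun {A | A \in blocks s} -> 'I_t}) := [ffun i => g (blk s i)].
have Finj : injective F.
  move=> g g' /ffunP e; apply/ffunP => B; have [i <-] := blk_surj B.
  by have := e i; rewrite !ffunE.
rewrite -[RHS](card_imset _ Finj); apply: eq_card => f; rewrite inE.
apply/idP/imsetP => [/above_ker[g gE]|[g _ ->]].
  by exists g => //; apply/ffunP => i; rewrite ffunE.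
rewrite {1}(ker_blk s); apply/ker_le => i j; rewrite !ffunE => -> //.
Qed.

Lemma count_equal t (s : L) :
  #|[set f : {ffun 'I_n -> 'I_t} | ker f == s]| = (t ^_ #|blocks s|)%N.
Proof.
rewrite -card_blk -[t in RHS]card_ord -card_inj_ffuns.
pose F (g : {ffun {A | A \in blocks s} -> 'I_t}) := [ffun i => g (blk s i)].
have Finj : injective F.
  move=> g g' /ffunP e; apply/ffunP => B; have [i <-] := blk_surj B.
  by have := e i; rewrite !ffunE.
rewrite -[RHS](card_imset _ Finj); apply: eq_card => f; rewrite inE.
apply/eqP/imsetP => [fE|[g]].
  have [|g gE] := @above_ker _ s f; first by rewrite fE.
  exists g; last by apply/ffunP => i; rewrite ffunE.
  rewrite inE; apply/injectiveP => B B'.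
  have [i <-] := blk_surj B; have [j <-] := blk_surj B'; rewrite -!gE.
  by apply/ker_le: i j; rewrite fE -ker_blk.
rewrite inE => /injectiveP g_inj ->; apply/le_anti; rewrite (ker_blk s).
apply/andP; split; apply/ker_le => i j; rewrite !ffunE; first exact: g_inj.
by move=> ->.
Qed.

Definition part_rank (s : L) : nat := (n - #|blocks s|)%N.

Lemma card_blocks_le (s : L) : (#|blocks s| <= n)%N.
Proof.
rewrite (ker_blk s) card_ker -[X in (_ <= X)%N]card_ord.
exact: leq_imset_card.
Qed.

Lemma card_blocks_bot : #|blocks (\bot%O : L)| = n.
Proof.
have -> : \bot%O = ker id :> L by [].
by rewrite card_ker card_imset ?cardsT ?card_ord.
Qed.

Lemma blocks_lt (s w : L) : (s < w)%O -> (#|blocks w| < #|blocks s|)%N.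
Proof.
move=> sw; have /above_ker[g gE] : (s <= ker (blk w))%O by rewrite -ker_blk ltW.
have wE : w = ker (fun i => g (blk s i)).
  by rewrite [LHS]ker_blk; apply/le_anti/andP; split; apply/ker_le => i j; rewrite !gE.
rewrite wE card_ker image_comp -(card_blk s) -cardsT ltn_neqAle leq_imset_card andbT.
apply: contraTneq sw => /eqP/imset_injP g_inj.
suff -> : w = s by rewrite ltxx.
rewrite wE [RHS]ker_blk; apply/le_anti/andP; split; apply/ker_le => i j; last by move=> ->.
by move/(g_inj _ _ (in_setT _) (in_setT _)).
Qed.

Lemma part_rank_function : is_rank_function part_rank.
Proof.
apply: is_rank_functionI => [|s w sw|s w sw].
- by rewrite /part_rank card_blocks_bot subnn.
- by have := blocks_lt sw; have := card_blocks_le s; rewrite /part_rank; lia.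
have /above_ker[g gE] : (s <= ker (blk w))%O by rewrite -ker_blk ltW.
have [injg|] := boolP (injectiveb g).
  move: sw; rewrite lt_leAnge => /andP[_ /negP[]].
  rewrite (ker_blk w) (ker_blk s); apply/ker_le => i j /eqP.
  by rewrite !gE (inj_eq (injectiveP _ injg)) => /eqP.
move/injectivePn => [b [b' bb' gb]].
pose g' c := if c == b' then b else c.
(* g identifies b and b'; merging only these two blocks raises the rank by one. *)
have im : g' @: setT = setT :\ b'.
  apply/setP => c; rewrite !inE andbT; apply/imsetP/idP => [[c' _ ->]|cb'].
    by rewrite /g'; case: ifP => [_|/negbT].
  by exists c; rewrite /g' ?(negbTE cb').
exists (ker (fun i => g' (blk s i))).
have cE : #|blocks (ker (fun i => g' (blk s i)))| = #|blocks s|.-1.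
  by rewrite card_ker image_comp im -(card_blk s) -cardsT [in RHS](cardsD1 b') inE.
have s0 : (0 < #|blocks s|)%N by rewrite -card_blk; apply/card_gt0P; exists b.
have sle : (s <= ker (fun i => g' (blk s i)))%O.
  by rewrite {1}(ker_blk s); apply/ker_le => i j ->.
split.
- rewrite lt_neqAle sle andbT; apply/eqP => e.
  by have := congr1 (fun x : L => #|blocks x|) e; rewrite cE; lia.
- rewrite (ker_blk w); apply/ker_le => i j; rewrite !gE.
  have gg' c : g c = g (g' c) by rewrite /g'; case: eqP => [->|].
  by rewrite gg' => ->; rewrite -gg'.
- by rewrite /part_rank cE; have := card_blocks_le s; lia.
Qed.

Lemma blocks_gt0 (s : L) : (0 < n)%N -> (0 < #|blocks s|)%N.
Proof.
move=> n0; apply/card_gt0P; exists (block_of s (Ordinal n0)); exact: block_of_in.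
Qed.

(** The functions to a set of m + 1 elements whose kernel is above s are the
functions on the blocks of s; sorted by their kernel w they are the injective
functions on the blocks of w.  One factor m + 1 is common to both sides, which
lowers the number of blocks to the corank. *)
Lemma part_count m (s : L) : (0 < n)%N -> m.+1%:R ^+ #|blocks s|.-1 =
  \sum_(w : L | (s <= w)%O)
     \prod_(j < #|blocks w|.-1) ((m.+1%:R : rat) - j.+1%:R).
Proof.
move=> n0; apply: (@mulfI _ m.+1%:R); first by rewrite pnatr_eq0.
rewrite -exprS prednK ?blocks_gt0 // -natrX -count_above -sum1_card natr_sum.
rewrite (partition_big (fun f : {ffun 'I_n -> 'I_m.+1} => ker f) (fun w => (s <= w)%O)) /=; last first.
  by move=> f; rewrite inE.
rewrite mulr_sumr; apply: eq_bigr => w sw.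
transitivity ((m.+1 ^_ #|blocks w|)%:R : rat).
  rewrite -count_equal -[in RHS]sum1_card natr_sum; apply: eq_bigl => f; rewrite !inE.
  by case: eqP => [->|]; rewrite ?andbF ?andbT.
have := blocks_gt0 w n0; case: #|blocks w| => // k _.
rewrite natr_ffact big_ord_recl subr0.
by congr (_ * _); apply: eq_bigr => j _; rewrite lift0.
Qed.

Lemma partition_resolvable (C : numClosedFieldType) : resolvable C L.
Proof.
apply: (@resolvable_whitney S C _ _ _ part_rank_function) => // s i.
have rT : (part_rank \top%O <= n)%N by rewrite leq_subr.
have [n0|n0] := posnP n.
  have all1 (w : L) : part_rank w = 0%N.
    by apply/eqP; rewrite -leqn0 (leq_trans (leq_subr _ _)) // n0.
  have allT (w : L) : w = \top%O.
    have := lex1 w; rewrite le_eqVlt => /orP[/eqP //|/(rank_function_lt part_rank_function)].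
    by rewrite !all1.
  rewrite !all1 subnn /=; have [->|i0] := eqVneq i 0%N.
    transitivity #|[set \top%O : L]|; last exact: cards1.
    by apply: eq_card => w; rewrite !inE all1 addn0 eqxx andbT [w]allT [s]allT lexx eqxx.
  by apply: eq_card0 => w; rewrite !inE all1 add0n (negbTE i0) andbF.
have cT : part_rank \top%O = n.-1.
  rewrite /part_rank; have -> : \top%O = ker (fun=> tt) :> L by [].
  rewrite card_ker (_ : [set _ | _ : _] = [set tt]) ?cards1 ?subn1 //.
  apply/setP => -[]; rewrite inE; apply/imsetP; by exists (Ordinal n0).
have corkE (w : L) : (n.-1 - part_rank w = #|blocks w|.-1)%N.
  by rewrite /part_rank; have := blocks_gt0 w n0; have := card_blocks_le w; lia.
rewrite cT corkE.
rewrite -(@kernel_method S _ _ (fun w : L => #|blocks w|.-1) S succn_inj); last first.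
  by move=> m w; apply: part_count.
apply: eq_card => w; rewrite !inE -corkE; congr (_ && _).
have : (part_rank w <= n.-1)%N by rewrite -cT (rank_function_le part_rank_function) ?lex1.
by lia.
Qed.

End PartitionLattice.

(** * Dowling geometries *)

Section Dowling.
Variables (n : nat) (G : finGroupType).
Local Notation L := (dowling n G).
Local Notation prepart := (prepartition n G).
Implicit Types p q : prepart.

Definition same_block p i j := Some j \in pblock (pp_blocks p) (Some i).

Lemma same_blockE p i j : same_block p i j = (pblock (pp_blocks p) (Some i) == pblock (pp_blocks p) (Some j)).
Proof. by rewrite /same_block -eq_pblock ?pp_cover //; apply: pp_triv. Qed.

Lemma same_block_sym p i j : same_block p i j = same_block p j i.
Proof. by rewrite !same_blockE eq_sym. Qed.

Lemma nonzero_pblock p D i : D \in nonzero_blocks p -> Some i \in D ->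
  D = pblock (pp_blocks p) (Some i).
Proof. by move=> /nonzeroW Dp iD; rewrite (def_pblock (pp_triv p) Dp iD). Qed.

Lemma nonzero_pblock_in p i : pp_label p i != None ->
  pblock (pp_blocks p) (Some i) \in nonzero_blocks p.
Proof. by case/nonzero_block_of => D Dp iD; rewrite -(nonzero_pblock Dp iD). Qed.

(** The order on classes in terms of arbitrary representatives: two elements of
a nonzero block either both go to the zero block, or stay together with labels
changed by the same group element.  The comparison c a^-1 = d b^-1 does not
depend on the representatives. *)
Definition finer p q : Prop :=
  (forall i, pp_label p i = None -> pp_label q i = None) /\
  (forall i j a b, pp_label p i = Some a -> pp_label p j = Some b -> same_block p i j ->
     (pp_label q i = None /\ pp_label q j = None) \/
     exists c d, [/\ pp_label q i = Some c, pp_label q j = Some d, same_block q i j &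
        (c * a^-1 = d * b^-1)%g]).

Lemma pp_le_finer p q : pp_le p q -> finer p q.
Proof.
case/pp_leP => H lab; split=> [i pi|i j a b pi pj ij].
  by case qi: (pp_label q i) => [c|//]; have := lab i; rewrite qi pi => /(_ isT).
have down k l : same_block p k l -> pp_label q k != None ->
    pp_label q l != None /\ same_block q k l.
  move=> kl qk; have [B Bq kB] := nonzero_block_of qk.
  have [D [Dp kD DB]] := H _ _ Bq kB; rewrite (nonzero_pblock Dp kD) in DB.
  have lB : Some l \in B by apply: (subsetP DB).
  by rewrite (pp_label_nonzero Bq lB) /same_block -(nonzero_pblock Bq kB).
case qi : (pp_label q i) => [c|].
  have [|qj qij] := down i j ij; first by rewrite qi.
  case qj' : (pp_label q j) qj => [d|//] _; right; exists c, d; split=> //.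
  have := lab i; rewrite pi qi => /(_ isT)[->].
  by have := lab j; rewrite pj qj' => /(_ isT)[->]; rewrite !mulgV.
left; split=> //; apply/eqP; apply: contraT => qj.
by have [] := down j i _ qj; rewrite ?qi // same_block_sym.
Qed.

Lemma same_block_equiv p p' i j : pp_equiv p p' -> same_block p i j = same_block p' i j.
Proof. by case/pp_equivP => bE _; rewrite /same_block bE. Qed.

Lemma label_equiv p p' i j a' : pp_equiv p p' -> pp_label p' i = Some a' -> same_block p i j ->
  exists g, pp_label p i = Some (g * a')%g /\ forall b', pp_label p' j = Some b' -> pp_label p j = Some (g * b')%g.
Proof.
case/pp_equivP => bE E p'i ij.
have pi : pp_label p i != None by rewrite (pp_label_eq0 _ bE) p'i.
have [g gP] := E _ (nonzero_pblock_in pi).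
exists g; rewrite gP ?mem_pblock ?pp_cover // p'i; split=> // b' p'j.
by rewrite gP ?p'j.
Qed.

Lemma finer_equivl p p' q : pp_equiv p p' -> finer p' q -> finer p q.
Proof.
move=> e [H1 H2]; have [bE _] := pp_equivP _ _ e; split=> [i pi|i j a b pi pj ij].
  by apply: H1; apply/eqP; rewrite -(pp_label_eq0 _ bE) pi.
have ij' : same_block p' i j by rewrite -(same_block_equiv _ _ e).
case p'i : (pp_label p' i) => [a'|]; last first.
  by have := pp_label_eq0 i bE; rewrite p'i pi.
case p'j : (pp_label p' j) => [b'|]; last first.
  by have := pp_label_eq0 j bE; rewrite p'j pj.
have [g []] := label_equiv e p'i ij; rewrite pi => -[->] /(_ _ p'j); rewrite pj => -[->].
case: (H2 i j a' b' p'i p'j ij') => [|[c [d [qi qj qij cd]]]]; first by left.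
by right; exists c, d; split=> //; rewrite !invMg !mulgA cd.
Qed.

Lemma finer_equivr p q q' : pp_equiv q q' -> finer p q' -> finer p q.
Proof.
move=> e [H1 H2]; have [bE _] := pp_equivP _ _ e; split=> [i pi|i j a b pi pj ij].
  by apply/eqP; rewrite (pp_label_eq0 _ bE) H1.
case: (H2 i j a b pi pj ij) => [[qi qj]|[c [d [qi qj qij cd]]]].
  by left; split; apply/eqP; rewrite (pp_label_eq0 _ bE) ?qi ?qj.
right; have qij' : same_block q i j by rewrite (same_block_equiv _ _ e).
have [g [qi' /(_ _ qj) qj']] := label_equiv e qi qij'.
by exists (g * c)%g, (g * d)%g; split=> //; rewrite -!mulgA cd.
Qed.

(** The new representative copies the labels of q outside its zero block; on a
block of p this is one left translation. *)
Lemma finer_relabel p q : finer p q -> exists2 p', pp_equiv p p' & pp_le p' q.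
Proof.
case=> H1 H2.
pose l := [ffun i => if pp_label q i != None then pp_label q i else pp_label p i].
have lP : partition (pp_blocks p) setT &&
  [forall i, (l i == None) == (Some i \in pblock (pp_blocks p) None)].
  rewrite pp_partition; apply/forallP => i; rewrite ffunE -pp_labelE.
  case: ifP => // qi; rewrite (negbTE qi) eq_sym; apply/eqP/negbTE.
  by apply: contra qi => /eqP/H1 ->.
pose p' : prepart := PrePartition (pp_data := (pp_blocks p, l)) lP.
have lE i : pp_label p' i = l i by [].
exists p'.
  apply/pp_equivP; split=> // D Dp.
  have [/existsP[j /andP[jD qj]]|/existsPn no] :=
    boolP [exists j, (Some j \in D) && (pp_label q j != None)]; last first.
    exists 1%g => i iD; rewrite lE ffunE ifN; last by have := no i; rewrite iD.
    by case: (pp_label _ i) => //= x; rewrite mul1g.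
  have := pp_label_nonzero Dp jD; case pj: (pp_label p j) => [b|//] _.
  case qj': (pp_label q j) qj => [d|//] _.
  exists (b * d^-1)%g => i iD.
  have := pp_label_nonzero Dp iD; case pi: (pp_label p i) => [a|//] _.
  have ij : same_block p i j by rewrite /same_block -(nonzero_pblock Dp iD).
  case: (H2 i j a b pi pj ij); first by case=> _; rewrite qj'.
  case=> c [d' [qi qj _ cd]]; rewrite lE ffunE qi /=; congr Some.
  have dd : d' = d by move: qj; rewrite qj' => -[].
  have -> : c = (d * b^-1 * a)%g by rewrite -dd -cd mulgKV.
  by rewrite !mulgA mulgKV mulgV mul1g.
apply/pp_leP; split=> [B [i|] Bq iB|i qi]; last 2 first.
- by move: Bq; rewrite inE iB andbF.
- by rewrite lE ffunE qi.
have qi := pp_label_nonzero Bq iB.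
have pi : pp_label p i != None by apply: contra qi => /eqP/H1 ->.
have Dp := nonzero_pblock_in pi.
exists (pblock (pp_blocks p) (Some i)); split; first exact: Dp.
  by rewrite mem_pblock pp_cover.
apply/subsetP => -[j|] jD; last by move: Dp; rewrite inE jD andbF.
case pi' : (pp_label p i) pi => [a|//] _.
have := pp_label_nonzero Dp jD; case pj: (pp_label p j) => [b|//] _.
case: (H2 i j a b pi' pj jD) => [[qi0]|[c [d [_ _ qij _]]]].
  by rewrite qi0 in qi.
by rewrite (nonzero_pblock Bq iB).
Qed.

Lemma dw_leP p q : (dw_of p <= dw_of q)%O <-> finer p q.
Proof.
split=> [/dowling_leP[p' [q' []]]|/finer_relabel[p' pp' p'q]].
  rewrite !mem_dw_of => pp' qq' /pp_le_finer h.
  by apply: finer_equivl pp' _; apply: finer_equivr qq' _.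
by apply/dowling_leP; exists p', q; rewrite !mem_dw_of pp_equiv_refl.
Qed.

Lemma dw_eq p q : (forall i, pp_label p i = pp_label q i) ->
  (forall i j, pp_label p i != None -> pp_label p j != None -> same_block p i j = same_block q i j) ->
  dw_of p = dw_of q.
Proof.
move=> lE sE; apply/le_anti/andP; split; apply/dw_leP; split=> [i|i j a b pi pj ij].
- by rewrite lE.
- right; exists a, b; rewrite -!lE pi pj -sE ?pi ?pj //; split=> //.
  by rewrite !mulgV.
- by rewrite lE.
- right; exists a, b; rewrite !lE pi pj sE ?lE ?pi ?pj //; split=> //.
  by rewrite !mulgV.
Qed.

Lemma dw_of_class x p : p \in dw_class x -> dw_of p = x.
Proof. by move=> px; apply: (@dw_inj _ _ _ _ p) => //; rewrite mem_dw_of pp_equiv_refl. Qed.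

(** A function to the points of {0} + T x G has a kernel in the Dowling geometry:
the fibre of 0 is the zero block, the T-components give the other blocks and
the G-components their labels. *)
Section Functions.
Variables (T : eqType) (f : 'I_n -> option (T * G)).

Definition oblk (o : option 'I_n) : option T := obind (fun i => omap fst (f i)) o.

Fact prep_subproof :
  let b := preim_partition oblk [set: option 'I_n] in
  let l := [ffun i => omap snd (f i)] in
  partition b setT && [forall i, (l i == None) == (Some i \in pblock b None)].
Proof.
apply/andP; split; first exact: preim_partitionP.
apply/forallP => i; rewrite ffunE pblock_preim /=; by case: (f i).
Qed.

Definition prep : prepart := PrePartition (pp_data := (_, _)) prep_subproof.

Lemma prep_label i : pp_label prep i = omap snd (f i).
Proof. by rewrite /pp_label /= ffunE. Qed.

Lemma prep_same_block i j : same_block prep i j = (omap fst (f i) == omap fst (f j)).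
Proof. by rewrite /same_block pblock_preim. Qed.

End Functions.

Definition dw_ker (T : eqType) (f : 'I_n -> option (T * G)) : L := dw_of (prep f).

Lemma dw_ker_leP (T U : eqType) (f : 'I_n -> option (T * G)) (g : 'I_n -> option (U * G)) :
  (dw_ker f <= dw_ker g)%O <->
  (forall i, f i = None -> g i = None) /\
  (forall i j x a b, f i = Some (x, a) -> f j = Some (x, b) ->
    (g i = None /\ g j = None) \/
    exists y c d, [/\ g i = Some (y, c), g j = Some (y, d) & (c * a^-1 = d * b^-1)%g]).
Proof.
split=> [/dw_leP[H1 H2]|[H1 H2]]; last first.
  apply/dw_leP; split=> [i|i j a b]; rewrite !prep_label.
    by case fi: (f i) => // _; rewrite H1.
  rewrite !prep_same_block; case fi: (f i) => [[x a']|//] [<-].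
  case fj: (f j) => [[x' b']|//] [<-] /= /eqP[xx]; rewrite -xx in fj.
  case: (H2 i j x a' b' fi fj) => [[-> ->]|[y [c [d [-> -> cd]]]]]; first by left.
  by right; exists c, d; rewrite /= eqxx.
split=> [i fi|i j x a b fi fj].
  by have := H1 i; rewrite !prep_label fi => /(_ erefl); case: (g i).
have := H2 i j a b; rewrite !prep_label !prep_same_block fi fj eqxx => /(_ erefl erefl isT).
case=> [[]|[c [d []]]]; first by case: (g i) => // _; case: (g j) => // _; left.
case: (g i) => [[y c']|//] [<-]; case: (g j) => [[y' d']|//] [<-] /= /eqP[<-] cd.
by right; exists y, c', d'.
Qed.

(** Postcomposition with the G-equivariant map given by [al] on T x {1}, the zero
point being fixed. *)
Definition push (T U : Type) (al : T -> option (U * G)) (f : 'I_n -> option (T * G)) i :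
    option (U * G) :=
  if f i is Some (x, a) then omap (fun yc => (yc.1, (yc.2 * a)%g)) (al x) else None.

Lemma dw_ker_push (T U : eqType) (al : T -> option (U * G)) f : (dw_ker f <= dw_ker (push al f))%O.
Proof.
apply/dw_ker_leP; rewrite /push; split=> [i -> //|i j x a b -> ->].
case: (al x) => [[y c]|]; last by left.
by right; exists y, (c * a)%g, (c * b)%g; rewrite !mulgK.
Qed.

Lemma eq_dw_ker (T : eqType) (f g : 'I_n -> option (T * G)) : f =1 g -> dw_ker f = dw_ker g.
Proof.
by move=> fg; apply: dw_eq => [i|i j _ _]; rewrite ?prep_label ?prep_same_block !fg.
Qed.

(** As for partitions, every class is the kernel of the map to its own nonzero
blocks, and the classes above it are kernels of equivariant maps on these. *)
Section Representative.
Variable x : L.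

Definition class_repr : prepart := xchoose (dw_rep x).
Definition Blk := {D | D \in nonzero_blocks class_repr}.

Definition block_coord (i : 'I_n) : option (Blk * G) :=
  if pp_label class_repr i is Some g then
    omap (fun D => (D, g)) (insub (pblock (pp_blocks class_repr) (Some i)) : option Blk)
  else None.

Lemma block_coord_label i : omap snd (block_coord i) = pp_label class_repr i.
Proof.
rewrite /block_coord; case pi: (pp_label class_repr i) => [g|//].
by rewrite insubT ?nonzero_pblock_in ?pi.
Qed.

Lemma dw_ker_coord : dw_ker block_coord = x.
Proof.
rewrite -[RHS](dw_of_class (xchooseP (dw_rep x))) -/class_repr; apply: dw_eq => [i|i j].
  by rewrite prep_label block_coord_label.
rewrite !prep_label !block_coord_label prep_same_block same_blockE /block_coord.
case pi: (pp_label class_repr i) => [g|//] _; case pj: (pp_label class_repr j) => [h|//] _.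
have Di : pblock (pp_blocks class_repr) (Some i) \in nonzero_blocks class_repr by rewrite nonzero_pblock_in ?pi.
have Dj : pblock (pp_blocks class_repr) (Some j) \in nonzero_blocks class_repr by rewrite nonzero_pblock_in ?pj.
by rewrite !insubT /=; apply/eqP/eqP => [[]|e] //; congr Some; apply: val_inj.
Qed.

Lemma block_coord_surj (D : Blk) : exists i, [exists a, block_coord i == Some (D, a)].
Proof.
case: D => D Dn; have [[i|] iD] := pp_nonempty (nonzeroW Dn); last first.
  by have := Dn; rewrite inE iD andbF.
exists i; have := pp_label_nonzero Dn iD; rewrite /block_coord.
case pi: (pp_label class_repr i) => [g|//] _; apply/existsP; exists g.
rewrite insubT ?nonzero_pblock_in ?pi //= => h; apply/eqP; congr (Some (_, _)).
by apply: val_inj; rewrite /= -(nonzero_pblock Dn iD).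
Qed.

End Representative.

Definition nblk (x : L) : nat := #|nonzero_blocks (class_repr x)|.

Lemma card_Blk x : #|{: Blk x}| = nblk x.
Proof. by rewrite card_sig. Qed.

(** The points of U that are reached; for a kernel these are the nonzero
blocks. *)
Definition targets (T U : finType) (al : T -> option (U * G)) : {set option U} :=
  [set omap fst (al b) | b : T] :\ None.

Lemma nblk_dw_ker (T : finType) (f : 'I_n -> option (T * G)) : nblk (dw_ker f) = #|targets f|.
Proof.
rewrite /nblk; have /pp_equivP[bE _] : pp_equiv (prep f) (class_repr (dw_ker f)).
  by rewrite -mem_dw_of; apply: xchooseP (dw_rep (dw_ker f)).
rewrite -(nonzero_eq bE).
pose h (o : option T) := [set z : option 'I_n | o == oblk f z].
have -> : nonzero_blocks (prep f) = h @: targets f.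
  apply/setP => D; apply/idP/imsetP.
    rewrite inE => /andP[/imsetP[z _ ->]]; rewrite !inE andTb => fz.
    have zE : oblk f z != None by [].
    exists (oblk f z); last by apply/setP => z'; rewrite !inE.
    rewrite !inE zE /=; case: z {fz} zE => [i|//] _; apply/imsetP; by exists i.
  case=> o; rewrite !inE => /andP[oN /imsetP[i _ oE]] ->.
  apply/andP; split; last by rewrite inE.
  by apply/imsetP; exists (Some i) => //; apply/setP => z; rewrite !inE oE.
rewrite card_in_imset // => o o'; rewrite !inE.
move=> /andP[_ /imsetP[i _ ->]] /andP[_ /imsetP[j _ ->]] /setP/(_ (Some j)).
by rewrite !inE /= eqxx => /eqP.
Qed.

Lemma targets_push (T : finType) x (al : Blk x -> option (T * G)) : targets (push al (@block_coord x)) = targets al.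
Proof.
apply/setP => o; rewrite !inE; case: o => [y|//] /=.
apply/imsetP/imsetP => [[i _]|[D _ e]].
  rewrite /push; case: (block_coord x i) => [[D a] e|//]; exists D => //.
  by rewrite e; case: (al D) => [[]|].
have [i /existsP[a /eqP ia]] := block_coord_surj D; exists i => //.
by rewrite /push ia e; case: (al D) => [[]|].
Qed.

Definition block_injective (T U : finType) (al : T -> option (U * G)) : Prop :=
  (forall b, al b <> None) /\ injective (fun b => omap fst (al b)).

(** No information is lost exactly by the equivariant maps that are injective;
these are the ones that send no block to 0 and distinct blocks to distinct
blocks. *)
Lemma dw_ker_push_id (T : finType) x (al : Blk x -> option (T * G)) :
  dw_ker (push al (@block_coord x)) = x <-> block_injective al.
Proof.
have up := dw_ker_push al (@block_coord x); rewrite dw_ker_coord in up.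
split=> [e|[alN al_inj]]; last first.
  apply/le_anti; rewrite up andbT.
  suff : (dw_ker (push al (@block_coord x)) <= dw_ker (@block_coord x))%O by rewrite dw_ker_coord.
  apply/dw_ker_leP.
  rewrite /push; split=> [i|i j y c d].
    case bi: (block_coord x i) => [[D a]|//]; case aD: (al D) => //; by have := alN D.
  case bi: (block_coord x i) => [[D a]|//]; case bj: (block_coord x j) => [[D' b]|//].
  case aD: (al D) => [[y1 c1]|//]; case aD': (al D') => [[y2 c2]|//].
  case=> <- <- [yE <-]; rewrite yE in aD'.
  have DD : D = D' by apply: al_inj; rewrite aD aD'.
  right; exists D, a, b; rewrite DD; split=> //.
  by move: aD'; rewrite -DD aD => -[<-]; rewrite !invMg !mulgA !mulgV.
have /dw_ker_leP[H1 H2] : (dw_ker (push al (@block_coord x)) <= dw_ker (@block_coord x))%O by rewrite e dw_ker_coord.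
split=> [D aD|D D' /= DD].
  have [i /existsP[a /eqP ia]] := block_coord_surj D.
  by have := H1 i; rewrite /push ia aD /= => /(_ erefl).
have alN : al D <> None.
  move=> aD; have [i /existsP[a /eqP ia]] := block_coord_surj D.
  by have := H1 i; rewrite /push ia aD /= => /(_ erefl).
case aD: (al D) alN => [[y c]|//] _; case aD': (al D') DD => [[y' c']|]; rewrite aD //=.
case=> yy; rewrite -yy in aD'.
have [i /existsP[a /eqP ia]] := block_coord_surj D; have [j /existsP[b /eqP jb]] := block_coord_surj D'.
have := H2 i j y (c * a)%g (c' * b)%g; rewrite /push ia jb aD aD' /=.
by case=> // [[]//|[z [u [v []]]]] [<- _] [->].
Qed.

Lemma above_dw_ker (T : finType) x (f : 'I_n -> option (T * G)) : (x <= dw_ker f)%O ->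
  exists al : {ffun Blk x -> option (T * G)}, f =1 push al (@block_coord x).
Proof.
rewrite -{1}(dw_ker_coord x) => /dw_ker_leP[H1 H2].
exists [ffun D => let i := xchoose (block_coord_surj D) in
  let a := odflt 1%g (omap snd (block_coord x i)) in
  omap (fun yc => (yc.1, (yc.2 * a^-1)%g)) (f i)] => i.
rewrite /push; case bi: (block_coord x i) => [[D a]|]; last exact: H1.
rewrite ffunE; set j := xchoose _.
have /existsP[b /eqP bj] : [exists a, block_coord x j == Some (D, a)] := xchooseP (block_coord_surj D).
rewrite bj /=; case: (H2 j i D b a bj bi) => [[-> -> //]|[y [c [d [-> -> cd]]]]] /=.
by rewrite cd mulgKV.
Qed.

Lemma push_inj (T : finType) x (al al' : Blk x -> option (T * G)) :
  push al (@block_coord x) =1 push al' (@block_coord x) -> al =1 al'.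
Proof.
move=> e D; have [i /existsP[a /eqP ia]] := block_coord_surj D; have := e i.
rewrite /push ia; case: (al D) => [[y c]|]; case: (al' D) => [[y' c']|] //=.
by case=> -> /mulIg ->.
Qed.

(** An equivariant map sends each nonzero block to any of the 1 + |T| |G| points
of the target. *)
Lemma dowling_count_above (T : finType) (x : L) :
  #|[set f : {ffun 'I_n -> option (T * G)} | (x <= dw_ker f)%O]| =
  ((#|T| * #|G|).+1 ^ nblk x)%N.
Proof.
rewrite -card_Blk -card_prod -card_option -card_ffun.
pose F (al : {ffun Blk x -> option (T * G)}) := [ffun i => push al (@block_coord x) i].
have Finj : injective F.
  move=> al al' /ffunP e; apply/ffunP/push_inj => i.
  by have := e i; rewrite !ffunE.
rewrite -[RHS](card_imset _ Finj); apply: eq_card => f; rewrite inE.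
apply/idP/imsetP => [/above_dw_ker[al alE]|[al _ ->]].
  by exists al => //; apply/ffunP => i; rewrite ffunE.
have -> : dw_ker (F al) = dw_ker (push al (@block_coord x)) by apply: eq_dw_ker => i; rewrite ffunE.
by rewrite -{1}(dw_ker_coord x); apply: dw_ker_push.
Qed.

Lemma dowling_count_equal (T : finType) (x : L) :
  #|[set f : {ffun 'I_n -> option (T * G)} | dw_ker f == x]| =
  (#|T| ^_ nblk x * #|G| ^ nblk x)%N.
Proof.
rewrite -card_Blk -card_inj_ffuns -card_ffun -cardsT -cardsX.
pose F (ge : {ffun Blk x -> T} * {ffun Blk x -> G}) :=
  [ffun i => push (fun D => Some (ge.1 D, ge.2 D)) (@block_coord x) i].
have Finj : injective F.
  move=> [g h] [g' h'] /ffunP e.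
  have {}e : (fun D => Some (g D, h D)) =1 (fun D => Some (g' D, h' D)).
    by apply: push_inj => i; have := e i; rewrite !ffunE.
  by congr (_, _); apply/ffunP => D; case: (e D).
rewrite -[RHS](card_imset _ Finj); apply: eq_card => f; rewrite inE.
have dw_kerF ge : dw_ker (F ge) = dw_ker (push (fun D => Some (ge.1 D, ge.2 D)) (@block_coord x)).
  by apply: eq_dw_ker => i; rewrite ffunE.
apply/eqP/imsetP => [fx|[ge]]; last first.
  rewrite !inE andbT => /injectiveP g_inj ->; rewrite dw_kerF; apply/dw_ker_push_id.
  by split=> // D D' [/g_inj].
have [|al alE] := @above_dw_ker _ x f; first by rewrite fx.
have [alN al_inj] : block_injective al by apply/dw_ker_push_id; rewrite -(eq_dw_ker alE).
have alS D : {yc | al D = Some yc}.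
  by case e: (al D) => [yc|]; [exists yc|have := alN D].
exists ([ffun D => (sval (alS D)).1], [ffun D => (sval (alS D)).2]).
  rewrite !inE andbT; apply/injectiveP => D D'; rewrite !ffunE => e.
  by apply: al_inj; rewrite (svalP (alS D)) (svalP (alS D')) /= e.
apply/ffunP => i; rewrite ffunE alE /push; case: (block_coord x i) => [[D a]|//].
congr (omap _ _); rewrite !ffunE -surjective_pairing; exact: (svalP (alS D)).
Qed.

Definition dowling_rank (x : L) : nat := (n - nblk x)%N.

Lemma card_targets_le (T U : finType) (al : T -> option (U * G)) : (#|targets al| <= #|T|)%N.
Proof.
by apply: leq_trans (subset_leq_card (subD1set _ _)) (leq_imset_card _ _).
Qed.

Lemma targets_coord x : #|targets (@block_coord x)| = nblk x.
Proof. by rewrite -nblk_dw_ker dw_ker_coord. Qed.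

Lemma nblk_le (x : L) : (nblk x <= n)%N.
Proof. by rewrite -targets_coord -[X in (_ <= X)%N]card_ord card_targets_le. Qed.

Lemma card_targets_lt (T U : finType) (al : T -> option (U * G)) :
  ~ block_injective al -> (#|targets al| < #|T|)%N.
Proof.
move=> ng; rewrite /targets; set A := imset _ _.
have AT : (#|A| <= #|T|)%N by apply: leq_imset_card.
have [NA|NA] := boolP (None \in A).
  by apply: leq_trans AT; rewrite [X in (_ < X)%N](cardsD1 None) NA.
have -> : A :\ None = A by apply/setDidPl; rewrite disjoint_sym disjoints1.
rewrite ltn_neqAle AT andbT; apply/negP => /eqP/esym e; apply: ng; split=> [b ab|].
  by case/negP: NA; apply/imsetP; exists b; rewrite ?ab.
move=> b b' bb'; have /imset_injP inj : #|A| == #|T| by rewrite e.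
exact: inj.
Qed.

Lemma above_decomp (x w : L) : (x <= w)%O ->
  exists al : Blk x -> option (Blk w * G), w = dw_ker (push al (@block_coord x)).
Proof.
move=> xw; have /above_dw_ker[al alE] : (x <= dw_ker (@block_coord w))%O by rewrite dw_ker_coord.
by exists al; rewrite -(eq_dw_ker alE) dw_ker_coord.
Qed.

Lemma not_block_injective (x w : L) (al : Blk x -> option (Blk w * G)) :
  (x < w)%O -> w = dw_ker (push al (@block_coord x)) -> ~ block_injective al.
Proof. by move=> xw wE /dw_ker_push_id e; have := lt_eqF xw; rewrite [X in x == X]wE e eqxx. Qed.

Lemma nblk_lt (x w : L) : (x < w)%O -> (nblk w < nblk x)%N.
Proof.
move=> xw; have [al wE] := above_decomp (ltW xw).
by rewrite wE nblk_dw_ker targets_push -card_Blk card_targets_lt //; apply: not_block_injective wE.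
Qed.

(** A map that is not injective either sends a block to 0 or identifies two
blocks.  Doing only this first, with the matching translation in the second
case, factors the map through a step of rank one. *)
Lemma merge_one (T U : finType) (al : T -> option (U * G)) : ~ block_injective al ->
  exists al' : T -> option (T * G),
    [/\ #|targets al'| = #|T|.-1 &
        forall f : 'I_n -> option (T * G), push al (push al' f) =1 push al f].
Proof.
move=> ng.
have step b0 (al' : T -> option (T * G)) :
    (forall c, c != b0 -> al' c = Some (c, 1%g)) ->
    (forall y c, al' b0 = Some (y, c) -> y != b0) ->
    (if al' b0 is Some (y, g) then omap (fun z => (z.1, (z.2 * g)%g)) (al y) else None)
      = al b0 ->
    [/\ #|targets al'| = #|T|.-1 &
        forall f : 'I_n -> option (T * G), push al (push al' f) =1 push al f].
  move=> al'c al'b comp; split.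
    have -> : targets al' = Some @: [set~ b0].
      apply/setP => o; rewrite !inE; apply/andP/imsetP.
        case=> oN /imsetP[c _ oE]; have [cb|cb] := eqVneq c b0; last first.
          by exists c; rewrite ?inE // oE al'c.
        move: oE oN; rewrite cb; case e: (al' b0) => [[y g]|] -> //= _.
        by exists y; rewrite // !inE (al'b _ _ e).
      case=> c; rewrite !inE => cb ->; split=> //.
      by apply/imsetP; exists c; rewrite ?al'c.
    by rewrite card_imset ?cardsC1 //; apply: Some_inj.
  move=> f i; rewrite /push; case: (f i) => [[c a]|//].
  have [->|cb] := eqVneq c b0; last by rewrite al'c //= mul1g.
  rewrite -comp; case: (al' b0) => [[y g]|//] /=.
  by case: (al y) => [[z h]|//] /=; rewrite mulgA.
have [/existsP[b0 /eqP b0N]|/existsPn noN] := boolP [exists b, al b == None].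
  exists (fun c => if c == b0 then None else Some (c, 1%g)).
  by apply: (step b0) => [c /negbTE -> //||]; rewrite eqxx.
have [/injectiveP inj|] := boolP (injectiveb (fun b => omap fst (al b))).
  by case: ng; split=> // b /eqP; apply/negP.
move/injectivePn => [b [b' bb' e]].
have := noN b; have := noN b'; case ab: (al b) e => [[y h]|//].
case ab': (al b') => [[y' h']|//] [yy] _ _; rewrite -yy in ab'.
exists (fun c => if c == b then Some (b', (h'^-1 * h)%g) else Some (c, 1%g)).
apply: (step b) => [c /negbTE -> //||]; rewrite eqxx /=.
- by move=> z c [<- _]; rewrite eq_sym.
- by rewrite ab' ab /= mulKVg.
Qed.

Lemma dowling_botE : \bot%O = dw_ker (fun i : 'I_n => Some (i, 1%g : G)) :> L.
Proof.
apply: dw_eq => [i|i j _ _].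
  by rewrite [RHS]prep_label /pp_label [LHS]ffunE.
by rewrite prep_same_block /same_block pblock_preim.
Qed.

Lemma dowling_topE : \top%O = dw_ker (fun=> None : option (unit * G)) :> L.
Proof.
have top_label i : pp_label (@pp_zero n G) i = None.
  by rewrite /pp_label [LHS]ffunE.
by apply: dw_eq => [i|i j]; rewrite top_label // prep_label.
Qed.

Lemma nblk_bot : nblk \bot%O = n.
Proof.
rewrite dowling_botE nblk_dw_ker.
have -> : targets (fun i : 'I_n => Some (i, 1%g : G)) = Some @: setT.
  apply/setP => o; rewrite !inE; apply/andP/imsetP => [[_ /imsetP[i _ ->]]|[i _ ->]].
    by exists i.
  by split=> //; apply/imsetP; exists i.
by rewrite card_imset ?cardsT ?card_ord //; apply: Some_inj.
Qed.

Lemma nblk_top : nblk \top%O = 0%N.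
Proof.
rewrite dowling_topE nblk_dw_ker; apply: eq_card0 => o; rewrite !inE.
by apply/negP => /andP[oN /imsetP[i _ oE]]; rewrite oE in oN.
Qed.

Lemma dowling_rank_function : is_rank_function dowling_rank.
Proof.
apply: is_rank_functionI => [|x w xw|x w xw].
- by rewrite /dowling_rank nblk_bot subnn.
- by have := nblk_lt xw; have := nblk_le x; rewrite /dowling_rank; lia.
have [al wE] := above_decomp (ltW xw); have ng := not_block_injective xw wE.
have [al' [imE fact]] := merge_one ng.
exists (dw_ker (push al' (@block_coord x))).
have nE : nblk (dw_ker (push al' (@block_coord x))) = (nblk x).-1 by rewrite nblk_dw_ker targets_push imE card_Blk.
have x0 : (0 < nblk x)%N by apply: leq_ltn_trans (nblk_lt xw).
have xle : (x <= dw_ker (push al' (@block_coord x)))%O.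
  by have := dw_ker_push al' (@block_coord x); rewrite dw_ker_coord.
split.
- rewrite lt_neqAle xle andbT; apply/eqP => e.
  by have := congr1 nblk e; rewrite nE; lia.
- by rewrite wE -(eq_dw_ker (fact _)) dw_ker_push.
- by rewrite /dowling_rank nE; have := nblk_le x; lia.
Qed.

Lemma dowling_chip m k : ((m ^_ k * #|G| ^ k)%:R : rat) =
  \prod_(j < k) (((m * #|G|).+1)%:R - ((j * #|G|).+1)%:R).
Proof.
rewrite natrM natr_ffact natrX -[X in _ ^+ X](card_ord k) -prodr_const -big_split /=.
by apply: eq_bigr => j _; rewrite -[_.+1]addn1 -[(j * _).+1]addn1 !natrD !natrM; ring.
Qed.

Lemma dowling_resolvable (C : numClosedFieldType) : resolvable C L.
Proof.
apply: (@resolvable_whitney (fun k => (k * #|G|).+1) C _ _ _ dowling_rank_function) => // x i.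
have corkE (w : L) : (n - dowling_rank w = nblk w)%N by rewrite subKn ?nblk_le.
have -> : dowling_rank \top%O = n by rewrite /dowling_rank nblk_top subn0.
have t_inj : injective (fun m => (m * #|G|).+1).
  have G0 : (0 < #|G|)%N by apply/card_gt0P; exists 1%g.
  by move=> a b [/eqP]; rewrite eqn_pmul2r // => /eqP.
rewrite corkE -(@kernel_method _ _ _ nblk _ t_inj); last first.
  move=> m s; rewrite -natrX -[m in LHS]card_ord -dowling_count_above -sum1_card natr_sum.
  rewrite (partition_big (fun f : {ffun 'I_n -> option ('I_m * G)} => dw_ker f)
    (fun w => (s <= w)%O)) /=; last by move=> f; rewrite inE.
  apply: eq_bigr => w sw; rewrite -dowling_chip -[m in RHS]card_ord -dowling_count_equal.
  rewrite -[in RHS]sum1_card natr_sum; apply: eq_bigl => f; rewrite !inE.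
  by case: eqP => [->|]; rewrite ?andbF ?andbT.
apply: eq_card => w; rewrite !inE -corkE; congr (_ && _).
have : (dowling_rank w <= n)%N by apply: leq_subr.
by lia.
Qed.

End Dowling.

(** * Supersolvable rank-uniform geometric lattices *)

Section MatroidClosure.
Variables (E : finType) (M : matroid E).
Implicit Types A B I J D F : {set E}.
Local Notation rank := (mrank M).

Lemma indep_rank I A : I \in indep M -> I \subset A -> (#|I| <= rank A)%N.
Proof. by move=> Ii IA; apply: (bigop.bigmax_sup I) => //; rewrite Ii. Qed.

Lemma rankS A B : A \subset B -> (rank A <= rank B)%N.
Proof.
move=> AB; apply/bigmax_leqP => I /andP[Ii IA].
by apply: indep_rank => //; apply: subset_trans AB.
Qed.

Lemma extend_basis I A : I \in indep M -> I \subset A ->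
  exists J, [/\ J \in indep M, I \subset J, J \subset A & #|J| = rank A].
Proof.
move=> Ii IA; pose Q J := [&& J \in indep M, I \subset J & J \subset A].
have QI : Q I by rewrite /Q Ii IA subxx.
case: (@arg_maxnP _ I Q (fun J => #|J|) QI) => J /and3P[Ji IJ JA] Jmax.
exists J; split=> //; apply/eqP; rewrite eqn_leq indep_rank //=.
apply/bigmax_leqP => K /andP[Ki KA]; rewrite leqNgt; apply/negP => JK.
have [x /setDP[xK xJ] xJi] := indep_augment Ji Ki JK.
have : Q (x |: J).
  by rewrite /Q xJi (subset_trans IJ (subsetUr _ _)) subUset sub1set JA (subsetP KA).
by move/Jmax; rewrite /geq /= cardsU1 xJ add1n ltnn.
Qed.

Lemma basis_exists A : exists J, [/\ J \in indep M, J \subset A & #|J| = rank A].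
Proof.
have [J [Ji _ JA Jr]] := extend_basis (indep0 M) (sub0set A).
by exists J.
Qed.

(** Adding a point to a set increases the rank exactly if it extends one, hence
every, basis of the set. *)
Lemma basis_gain I A y : I \in indep M -> I \subset A -> #|I| = rank A ->
  (rank A < rank (y |: A))%N = (y \notin I) && (y |: I \in indep M).
Proof.
move=> Ii IA Ir; apply/idP/andP => [lt|[yI yIi]]; last first.
  apply: leq_trans (indep_rank yIi (setUS _ IA)).
  by rewrite cardsU1 yI add1n Ir.
have [J [Ji JA Jr]] := basis_exists (y |: A).
have [|z /setDP[zJ zI] zIi] := indep_augment Ii Ji; first by rewrite Ir Jr.
have /setU1P[<- //|zA] := subsetP JA z zJ.
have := @indep_rank (z |: I) A zIi; rewrite subUset sub1set zA IA => /(_ isT).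
by rewrite cardsU1 zI add1n Ir ltnn.
Qed.

(** Submodularity of the rank in the only form needed for closures. *)
Lemma rank_gainS A B y : A \subset B ->
  (rank B < rank (y |: B))%N -> (rank A < rank (y |: A))%N.
Proof.
move=> AB; have [I [Ii IA Ir]] := basis_exists A.
have [J [Ji IJ JB Jr]] := extend_basis Ii (subset_trans IA AB).
rewrite (basis_gain y Ji JB Jr) (basis_gain y Ii IA Ir) => /andP[yJ yJi].
rewrite (contra (subsetP IJ y) yJ) /=.
exact: indepS (setUS _ IJ) yJi.
Qed.

Lemma rankU1 A y : (rank (y |: A) <= (rank A).+1)%N.
Proof.
apply/bigmax_leqP => I /andP[Ii IA].
have ID : I :\ y \in indep M by apply: indepS Ii; apply: subD1set.
have IDA : I :\ y \subset A.
  by apply/subsetP => z /setD1P[zy /(subsetP IA)/setU1P[/eqP|//]]; rewrite (negbTE zy).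
by rewrite (cardsD1 y) -add1n leq_add ?leq_b1 // indep_rank.
Qed.

Definition closure A : {set E} := [set y | rank (y |: A) == rank A].

Lemma sub_closure A : A \subset closure A.
Proof. by apply/subsetP => x xA; rewrite inE (setUidPr _) // sub1set. Qed.

Lemma closureP A y : (y \notin closure A) = (rank A < rank (y |: A))%N.
Proof. by rewrite inE ltn_neqAle eq_sym rankS ?andbT // subsetUr. Qed.

Lemma rank_closure A : rank (closure A) = rank A.
Proof.
apply/eqP; rewrite eqn_leq (rankS (sub_closure A)) andbT.
have [I [Ii IA Ir]] := basis_exists A.
apply/bigmax_leqP => J /andP[Ji JA]; rewrite leqNgt; apply/negP => IJ.
have [|z /setDP[zJ zI] zIi] := indep_augment Ii Ji; first by rewrite Ir.
have : z \in closure A by apply: (subsetP JA).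
by apply/negP; rewrite closureP (basis_gain z Ii IA Ir) zI.
Qed.

Lemma flatP F : reflect (forall y, y \notin F -> (rank F < rank (y |: F))%N) (is_flat M F).
Proof. by apply: (iffP forallP) => h y; have := h y; [move/implyP|move/implyP]. Qed.

Lemma closure_flat A : is_flat M (closure A).
Proof.
apply/flatP => y; rewrite closureP rank_closure => lt.
by apply: leq_trans lt _; apply: rankS; apply/setUS/sub_closure.
Qed.

Lemma closure_min A F : is_flat M F -> A \subset F -> closure A \subset F.
Proof.
move=> /flatP Ff AF; apply/subsetP => y; apply: contraTT => /Ff lt.
by rewrite closureP; apply: rank_gainS lt.
Qed.

Lemma flat_eq F D : is_flat M F -> F \subset D -> (rank D <= rank F)%N -> F = D.
Proof.
move=> /flatP Ff FD DF; apply/eqP; rewrite eqEsubset FD /=.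
apply/subsetP => y yD; apply: contraT => /Ff lt.
have : (rank (y |: F) <= rank D)%N by apply: rankS; rewrite subUset sub1set yD.
by rewrite leqNgt (leq_ltn_trans DF lt).
Qed.

Lemma flat_cover F x D : is_flat M F -> is_flat M D -> x \notin F ->
  F \subset D -> D \subset closure (x |: F) -> D = F \/ D = closure (x |: F).
Proof.
move=> Ff Df xF FD DB; have [le|lt] := leqP (rank D) (rank F).
  by left; apply/esym/flat_eq.
right; apply: flat_eq => //; rewrite rank_closure.
exact: leq_trans (rankU1 _ _) lt.
Qed.

End MatroidClosure.

Section FlatOrder.
Variables (E : finType) (M : matroid E).

Lemma flat_le (F D : flats M) : (F <= D)%O = (val F \subset val D).
Proof. by rewrite -Order.le_val Order.SetSubsetOrder.leEsubset. Qed.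

Lemma flat_is_flat (F : flats M) : is_flat M (val F).
Proof. by have := valP F; rewrite inE. Qed.

Lemma flat_cover_ex (F : flats M) x : x \notin val F -> exists B : flats M,
  [/\ covers F B, x \in val B &
      forall D : flats M, (F <= D)%O -> x \in val D -> (B <= D)%O].
Proof.
move=> xF.
have Bin : closure M (x |: val F) \in bs_set (flat_family M).
  by rewrite inE closure_flat.
pose B : flats M := Induced Bin.
have xB : x \in val B by apply: (subsetP (sub_closure M _)); rewrite setU11.
have FB : val F \subset val B.
  by apply: subset_trans (sub_closure M _); apply: subsetUr.
exists B; split=> // [|D]; last first.
  rewrite !flat_le => FD xD; apply: closure_min; first exact: flat_is_flat.
  by rewrite subUset sub1set xD.
rewrite /covers lt_neqAle flat_le FB andbT; apply/andP; split.
  by apply: contraNneq xF => ->.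
apply/forallP => D; apply/negP; rewrite !lt_neqAle !flat_le.
case/andP=> /andP[FD' FD] /andP[DB' DB].
have [e|e] := flat_cover (flat_is_flat F) (flat_is_flat D) xF FD DB.
  by case/eqP: FD'; apply: val_inj.
by case/eqP: DB'; apply: val_inj.
Qed.

End FlatOrder.

Section GeometricOrder.
Variables (d : Order.disp_t) (L : finTBLatticeType d).
Hypothesis L_geom : geometric L.

Lemma covers_eq (s b a : L) : covers s a -> (s < b)%O -> (b <= a)%O -> b = a.
Proof.
case/andP=> _ /forallP/(_ b) no sb; rewrite le_eqVlt => /orP[/eqP //|ba].
by rewrite sb ba in no.
Qed.

(** The predicate x tells whether a flat contains a fixed point of y outside z.  Over
each flat without this point there is a least flat containing it, and it is a
cover.  Atomicity and semimodularity are both consequences. *)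
Lemma geometric_cover (z y : L) : ~~ (y <= z)%O -> exists x : L -> bool,
  [/\ x y, ~~ x z, {homo x : a b / (a <= b)%O >-> a ==> b} &
   forall s, ~~ x s -> exists b, [/\ covers s b, x b &
     forall c, (s <= c)%O -> x c -> (b <= c)%O]].
Proof.
have [E [M [g [[g' gK g'K] gmono]]]] := L_geom.
rewrite -gmono flat_le => /subsetPn[e ey ez].
exists (fun s => e \in val (g s)); split=> // [a b ab|s es].
  by apply/implyP; apply: (subsetP _); rewrite -flat_le gmono.
have [B [FB eB Bmin]] := flat_cover_ex es.
exists (g' B); rewrite g'K; split=> // [|c sc ec]; last first.
  by rewrite -gmono g'K Bmin // gmono.
have g_lt a b : (g a < g b)%O = (a < b)%O by apply: (leW_mono gmono).
case/andP: FB => FB /forallP no; rewrite /covers -g_lt g'K FB.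
by apply/forallP => w; rewrite -!g_lt g'K; apply: no.
Qed.

Lemma geometric_atomic (z h : L) : (z <= h)%O -> (h < \top)%O ->
  exists2 a, covers z a & ~~ (a <= h)%O.
Proof.
move=> zh hT; have : ~~ (\top <= h)%O by rewrite lt_geF.
case/geometric_cover => x [_ xh xmono xcov].
have xz : ~~ x z by apply: contra xh; apply/implyP/xmono.
have [b [zb xb _]] := xcov z xz; exists b => //.
by apply: contra xh => bh; apply: (implyP (xmono _ _ bh)).
Qed.

Lemma geometric_semimodular (s a z : L) : covers s a -> (s <= z)%O ->
  ~~ (a <= z)%O -> covers z (z `|` a)%O.
Proof.
move=> sa sz az; have [x [xa xz xmono xcov]] := geometric_cover az.
have xs : ~~ x s by apply: contra xz; apply/implyP/xmono.
have [b [sb xb bmin]] := xcov s xs; have [c [zc xc cmin]] := xcov z xz.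
have ba : b = a.
  apply: (covers_eq sa _ (bmin _ _ xa)); last by apply: ltW; case/andP: sa.
  by case/andP: sb.
suff -> : (z `|` a)%O = c by [].
have zc' : (z <= c)%O by apply: ltW; case/andP: zc.
apply/le_anti; rewrite leUx zc' -ba bmin ?(le_trans sz zc') //=.
by rewrite cmin ?leUl // ba (implyP (xmono _ _ (leUr a z))).
Qed.

End GeometricOrder.

Section Supersolvable.
Variables (d : Order.disp_t) (L : finTBLatticeType d).
Hypothesis L_geom : geometric L.
Hypothesis L_uniform : rank_uniform L.
Variable rho : L -> nat.
Hypothesis rhoP : is_rank_function rho.
Local Notation r := (rho \top%O).
Local Notation cork := (fun w : L => (r - rho w)%N).

Let rho_le w : (rho w <= r)%N.
Proof. by apply: (rank_function_le rhoP); apply: lex1. Qed.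

Let rho_inj s w : (s <= w)%O -> rho s = rho w -> s = w.
Proof.
rewrite le_eqVlt => /orP[/eqP //|/(rank_function_lt rhoP)] lt e.
by rewrite e ltnn in lt.
Qed.

(** Rank-uniformity compares elements strictly above; the remaining case is the
element itself. *)
Lemma uniform_count (s t : L) i : rho s = rho t ->
  whitney_number cork s i = whitney_number cork t i.
Proof.
move=> st; have cE (u w : L) k : (u <= w)%O -> (i + k = cork u)%N ->
    (cork w == i) = (rk w == rk u + k)%N.
  move=> uw ik; rewrite !(rkE rhoP); have := rank_function_le rhoP uw.
  by have := rho_le w; have := rho_le u; move: ik => /=; lia.
have [le|lt] := leqP i (cork s); last first.
  rewrite /whitney_number !eq_card0 // => w; rewrite !inE; apply/negP => /andP[uw /eqP wi].
    by have := rank_function_le rhoP uw; move: lt wi => /=; lia.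
  by have := rank_function_le rhoP uw; move: lt wi => /=; lia.
have := subnKC le; set k := (cork s - i)%N => ik.
have ik' : (i + k = cork t)%N by rewrite ik /= st.
have [k0|k0] := posnP k.
  have one u : (i + k = cork u)%N -> whitney_number cork u i = 1%N.
    move=> iku; transitivity #|[set u]|; last exact: cards1.
    apply: eq_card => w; rewrite !inE; apply/andP/eqP => [[uw]|->]; last first.
      by rewrite lexx -iku k0 addn0.
    rewrite (cE u w k uw iku) k0 addn0 !(rkE rhoP) => /eqP e.
    by apply/esym/rho_inj.
  by rewrite !one.
have := @L_uniform s t k; rewrite !(rkE rhoP) => /(_ st k0) h.
rewrite /whitney_number; transitivity #|[set w : L | (s <= w)%O && (rk w == rk s + k)%N]|.
  by apply: eq_card => w; rewrite !inE; case sw: (s <= w)%O => //=; rewrite (cE s w k).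
rewrite !(rkE rhoP) h -(rkE rhoP t).
by apply: eq_card => w; rewrite !inE; case tw: (t <= w)%O => //=; rewrite (cE t w k).
Qed.

Section ModularCoatom.
Variable H : L.
Hypothesis H_coatom : covers H \top%O.
Hypothesis H_modular : left_modular H.

Let H_lt : (H < \top)%O. Proof. by case/andP: H_coatom. Qed.

(** An element y strictly between w /\ H and w has y \/ H = 1, so left modularity
for y <= w gives w = y \/ (H /\ w) = y. *)
Lemma covers_meet (w : L) : ~~ (w <= H)%O -> covers (w `&` H)%O w.
Proof.
move=> wH; apply/andP; split.
  by rewrite lt_neqAle leIl andbT; apply: contra wH => /eqP <-; apply: leIr.
apply/forallP => y; apply/negP => /andP[vy yw].
have yH : ~~ (y <= H)%O.
  by apply/negP => yH; have := lt_geF vy; rewrite lexI yH ltW.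
have yHT : (y `|` H = \top)%O.
  apply/eqP; apply: contraNT yH => ne.
  have Hy : (H <= y `|` H)%O by apply: leUr.
  have [e|e] := eqVneq H (y `|` H)%O; first by rewrite e leUl.
  case/eqP: ne; apply: (covers_eq H_coatom _ (lex1 _)).
  by rewrite lt_neqAle e.
have := H_modular (ltW yw); rewrite yHT meet1x meetC joinC (join_r (ltW vy)) => e.
by rewrite e ltxx in yw.
Qed.

Section Step.
Variables s a : L.
Hypothesis sH : (s <= H)%O.
Hypothesis sa : covers s a.
Hypothesis aH : ~~ (a <= H)%O.

Let h (w : L) := (w <= H)%O.
Let m (w : L) := (w `&` H)%O.

Lemma step_above w : (a <= w)%O -> (s <= w)%O && ~~ h w.
Proof.
move=> aw; rewrite (le_trans _ aw) /=; last by apply: ltW; case/andP: sa.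
by apply: contra aH; apply: le_trans.
Qed.

Lemma step_meet w : (s <= w)%O -> ~~ h w ->
  [/\ (s <= m w)%O, h (m w) & cork (m w) = (cork w).+1].
Proof.
move=> sw wH; rewrite lexI sw sH /h leIr; split=> //=.
have := rhoP.2 _ _ (covers_meet wH); rewrite -/(m w) => e.
by have := rho_le w; lia.
Qed.

(** The element above a over v is v \/ a: it covers v by semimodularity, and every
other candidate covers v as well and contains v \/ a. *)
Lemma step_fiber v : (s <= v)%O -> h v ->
  #|[set w : L | (a <= w)%O && (m w == v)]| = 1%N.
Proof.
move=> sv vH; have av : ~~ (a <= v)%O by apply: contra aH => /le_trans; apply.
have cv := geometric_semimodular L_geom sa sv av.
have vaH : ~~ (v `|` a <= H)%O by apply: contra aH; apply: le_trans; apply: leUr.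
transitivity #|[set (v `|` a)%O]|; last exact: cards1.
apply: eq_card => w; rewrite !inE; apply/andP/eqP => [[aw /eqP mw]|->].
  have wH : ~~ (w <= H)%O by case/andP: (step_above aw).
  have := covers_meet wH; rewrite -/(m w) mw => vw; apply/esym.
  apply: (covers_eq vw); first by case/andP: cv.
  by rewrite leUx aw andbT; case/andP: vw => /ltW.
rewrite leUr; split=> //; apply/eqP/esym.
have vm : (v <= m (v `|` a))%O by rewrite lexI leUl.
move: vm; rewrite le_eqVlt => /orP[/eqP //|vm].
have e := covers_eq cv vm (leIl _ _).
by case/negP: vaH; rewrite -e leIr.
Qed.

Lemma step_count_below i :
  #|[set w : L | [&& (s <= w)%O, h w & cork w == i]]| =
  (if i is j.+1 then whitney_number cork a j else 0)%N.
Proof. exact: (count_below_hyper step_above step_meet step_fiber). Qed.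

End Step.

(** By uniformity the counts may be read off from any element of given corank;
this one is below the coatom, where [local_step] applies.  Only the top has
corank 0, so there the default is the right value. *)
Definition sample (n : nat) : L := odflt \top%O [pick w : L | (w <= H)%O && (cork w == n)].

Lemma sampleP n : (0 < n <= r)%N -> (sample n <= H)%O /\ cork (sample n) = n.
Proof.
case/andP=> n0 nr; have rH : r = (rho H).+1 := rhoP.2 _ _ H_coatom.
have [|w [_ wH wE]] := rank_between rhoP (i := (r - n)%N) (le0x H).
  by rewrite rhoP.1; lia.
rewrite /sample; case: pickP => [u /andP[uH /eqP un] //|no].
by have := no w; rewrite wH wE subKn ?eqxx.
Qed.

Let R n i := whitney_number cork (sample n) i.

Lemma R_count (w : L) i : (0 < cork w)%N -> whitney_number cork w i = R (cork w) i.
Proof.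
move=> w0; have [|_ e] := @sampleP (cork w); first by rewrite w0 leq_subr.
by apply: uniform_count; have := rho_le w; have := rho_le (sample (cork w)); move: e w0 => /=; lia.
Qed.

(** The number of covers of an element of corank k + 1, minus the number of
covers of an element of corank k. *)
Definition modular_e (k : nat) : nat := if k is j.+1 then (R k.+1 k - R k j)%N else 1%N.

Lemma count_top i : whitney_number cork \top%O i = (i == 0%N).
Proof.
have [->|i0] := eqVneq i 0%N.
  transitivity #|[set \top%O : L]|; last exact: cards1.
  by apply: eq_card => w; rewrite !inE le1x; case: eqP => //= ->; rewrite subnn.
apply: eq_card0 => w; rewrite !inE le1x; apply/negP => /andP[/eqP ->].
by rewrite subnn eq_sym (negbTE i0).
Qed.

Lemma cork0 (w : L) : cork w = 0%N -> w = \top%O.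
Proof. by move=> w0; apply: rho_inj (lex1 w) _; have := rho_le w; move: w0 => /=; lia. Qed.

(** The fibre over v consists of the covers of v outside H.  All covers of v are
counted by uniformity, and those below H correspond to the covers of a, for a
cover a of v outside H. *)
Lemma fiber_covers (s v : L) : (s <= v)%O -> (v <= H)%O ->
  #|[set w : L | [&& (s <= w)%O, ~~ (w <= H)%O & (w `&` H)%O == v]]| =
  modular_e (cork v).-1.
Proof.
move=> sv vH; have rH : r = (rho H).+1 := rhoP.2 _ _ H_coatom.
have rv := rank_function_le rhoP vH.
have cv0 : (0 < cork v)%N by rewrite /=; lia.
have [a va aH] := geometric_atomic L_geom vH H_lt.
have ca : (cork v = (cork a).+1)%N.
  by have := rhoP.2 _ _ va; have := rho_le a; rewrite /=; lia.
set Fib := [set w | _].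
have split_covers : (whitney_number cork v (cork v).-1 =
    #|[set w : L | [&& (v <= w)%O, (w <= H)%O & cork w == (cork v).-1]]| + #|Fib|)%N.
  rewrite /whitney_number -(cardsID [set w | (w <= H)%O]); congr (_ + _)%N;
    apply: eq_card => w; rewrite !inE.
    by case: (w <= H)%O; rewrite ?andbT ?andbF.
  case wH: (w <= H)%O; rewrite /= ?andbF //.
  have wH' : ~~ (w <= H)%O by rewrite wH.
  have cw := rhoP.2 _ _ (covers_meet wH'); have rw := rho_le w.
  apply/andP/andP => [[vw /eqP e]|[sw /eqP e]].
    have vm : (v <= w `&` H)%O by rewrite lexI vw.
    split; first exact: le_trans vw.
    apply/eqP/esym/(rho_inj vm).
    move: e cw cv0 rw => /=; clear; move: (rho (w `&` H)%O) (rho w) (rho v) => x y z.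
    set R0 := rho _; move: R0 => R0; lia.
  split; first by rewrite -e leIl.
  by move: cw; rewrite e => cw; apply/eqP; rewrite /=; lia.
move: split_covers; rewrite (step_count_below vH va aH) ca /=.
rewrite (R_count _ cv0) ca /modular_e; case ca0: (cork a) => [|j].
  rewrite add0n => <-.
  (* v is a coatom: its only cover is the top, and modular_e 0 = 1. *)
  have -> : R 1 0 = 1%N.
    have [|sa1 sa2] := @sampleP 1%N; first by rewrite rH.
    have [b sb bH] := geometric_atomic L_geom sa1 H_lt.
    have bT : b = \top%O.
      by apply: cork0; have := rhoP.2 _ _ sb; have := rho_le b; move: sa2 => /=; lia.
    transitivity #|[set \top%O : L]|; last exact: cards1.
    apply: eq_card => w; rewrite !inE; apply/andP/eqP => [[_ /eqP/cork0 //]|->].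
    by rewrite lex1 subnn.
  by [].
have ca_gt : (0 < cork a)%N by rewrite ca0.
by rewrite (R_count j ca_gt) ca0 => ->; rewrite addKn.
Qed.

Lemma modular_count (s : L) i :
  whitney_number cork s i = whitney modular_e (cork s) i.
Proof.
have [n] := ubnP (cork s); elim: n s i => // n IHn s i.
case cs: (cork s) => [|k] sn; first by rewrite (cork0 cs) count_top.
have [|sH cS] := @sampleP k.+1; first by rewrite ltn0Sn -cs leq_subr.
have [a sa aH] := geometric_atomic L_geom sH H_lt.
have ca : cork a = k.
  by have := rhoP.2 _ _ sa; have := rho_le a; move: cS; rewrite /=; lia.
have -> : whitney_number cork s i = whitney_number cork (sample k.+1) i.
  by rewrite R_count cs.
rewrite (local_step (step_above sa aH) (step_meet sH sa aH) (step_fiber sa aH) (e := modular_e)).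
  by case: i => [|i]; rewrite /= !IHn ?ca.
by move=> v sv vH; apply: fiber_covers.
Qed.

End ModularCoatom.

Lemma modular_coatom_resolvable (C : numClosedFieldType) :
  ((0 < r)%N -> exists H : L, covers H \top%O /\ left_modular H) -> resolvable C L.
Proof.
have cnt (e : nat -> nat) :
    (forall (s : L) i, whitney_number cork s i = whitney e (cork s) i) ->
    forall (s : L) i, #|[set w : L | (s <= w)%O && (rho w + i == r)%N]| = whitney e (r - rho s) i.
  move=> h s i; rewrite -[RHS]h; apply: eq_card => w; rewrite !inE; congr (_ && _).
  by have := rho_le w; lia.
have [r0 _|r0 /(_ isT)[H [Hc Hm]]] := posnP r; last first.
  exact: (resolvable_whitney C rhoP (e := modular_e H) erefl (cnt _ (modular_count Hc Hm))).
apply: (resolvable_whitney C rhoP (e := fun=> 1%N) erefl); apply: cnt => s i.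
have all0 (w : L) : rho w = 0%N by apply/eqP; rewrite -leqn0 -r0.
have allT (w : L) : w = \top%O by apply: rho_inj (lex1 w) _; rewrite !all0.
rewrite !all0 /=; have [->|i0] := eqVneq i 0%N.
  transitivity #|[set \top%O : L]|; last exact: cards1.
  by apply: eq_card => w; rewrite !inE !all0 [w]allT [s]allT lexx eqxx.
by apply: eq_card0 => w; rewrite !inE !all0 subnn eq_sym (negbTE i0) andbF.
Qed.

End Supersolvable.

(** The coatom of a maximal chain of left modular elements is a coatom of the
lattice. *)
Lemma supersolvable_resolvable (C : numClosedFieldType) d (L : finTBLatticeType d) :
  geometric L -> supersolvable L -> rank_uniform L -> resolvable C L.
Proof.
move=> Lg [[rho rhoP] [K [/maxsetP[Kc Kmax] Kmod]]] Lu.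
apply: (modular_coatom_resolvable Lg Lu rhoP) => r0.
have inK (w : L) : {in K, forall z, (w >=< z)%O} -> w \in K.
  by move=> wK; rewrite -(Kmax (w |: K) _ (subsetUr _ _)) ?setU11 // chainU1.
have Kcomp := chainP _ Kc.
have botK : \bot%O \in K by apply: inK => z _; rewrite le_comparable ?le0x.
have botT : (\bot < \top :> L)%O.
  rewrite lt0x; apply: contraTneq r0 => e; by rewrite e rhoP.1.
have [H HK Hmax] : exists2 H, (H \in K) && (H < \top)%O &
    forall z, z \in K -> (z < \top)%O -> (z <= H)%O.
  have bK : (\bot%O \in K) && (\bot < \top :> L)%O by rewrite botK.
  case: (@arg_maxnP L \bot%O (fun u => (u \in K) && (u < \top)%O) rho bK) => H HK Hm.
  exists H => // z zK zT; case/andP: HK => HK HT.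
  have := Kcomp _ _ zK HK; case/orP=> // Hz.
  have := Hm z; rewrite zK zT => /(_ isT); rewrite /geq /=.
  move: Hz; rewrite le_eqVlt => /orP[/eqP -> //|/(rank_function_lt rhoP)].
  by rewrite ltnNge => /negbTE ->.
case/andP: HK => HK HT; exists H; split; last exact: Kmod.
rewrite /covers HT; apply/forallP => w; apply/negP => /andP[Hw wT].
have wK : w \in K.
  apply: inK => z zK; have [->|zT] := eqVneq z \top%O; first by rewrite le_comparable ?lex1.
  rewrite ge_comparable // (le_trans _ (ltW Hw)) // Hmax // lt_neqAle zT lex1 //.
by have := Hmax w wK wT; rewrite lt_geF.
Qed.

(** * The listed posets *)

Definition nonpos_roots (C : numClosedFieldType) (p : {poly int}) : Prop :=
  forall z : C, root (map_poly intr p) z -> z <= 0.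

Definition nonpos_rooted (C : numClosedFieldType) d (P : finTBPOrderType d) : Prop :=
  graded P /\
  [/\ nonpos_roots C (chow P), nonpos_roots C (augmented_chow P) &
      nonpos_roots C (h_polynomial (order_complex [set: P]))].

Section Families.
Variable C : numClosedFieldType.

Lemma nonpos_rooted_embedding d' (L : finTBPOrderType d') (rho : L -> nat)
    d (P : finTBPOrderType d) (f : P -> L) (S : pred nat) :
  resolvable C L -> is_rank_function rho ->
  {mono f : x y / (x <= y)%O} -> (forall x, S (rho (f x))) ->
  (forall y, S (rho y) -> exists x, f x = y) -> S 0%N -> S (rho \top%O) ->
  nonpos_rooted C P.
Proof.
move=> Lr rhoP f_mono fS f_surj S0 Sr.
have [gr h] := resolvable_roots Lr rhoP f_mono fS f_surj S0 Sr.
by split=> //; split=> z; case: (h z).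
Qed.

Lemma resolvable_graded d (L : finTBPOrderType d) :
  resolvable C L -> is_rank_function (@rk _ L).
Proof.
case=> rho [rhoP _]; have e := rkE rhoP; split=> [|s t st]; rewrite !e.
  exact: rhoP.1.
exact: rhoP.2.
Qed.

Lemma nonpos_rooted_iso d (P : finTBPOrderType d) d' (L : finTBPOrderType d') :
  resolvable C L -> poset_iso P L -> nonpos_rooted C P.
Proof.
move=> Lr [f [[g fK gK] f_mono]].
apply: (nonpos_rooted_embedding Lr (resolvable_graded Lr) f_mono (S := predT)) => // y _.
by exists (g y).
Qed.

Lemma nonpos_rooted_selection d (P : finTBPOrderType d) d' (L : finTBPOrderType d') :
  resolvable C L -> selection_of P L -> nonpos_rooted C P.
Proof.
move=> Lr [|[S [_ [f [[g fK gK] f_mono]]]]]; first exact: nonpos_rooted_iso.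
pose T i := i \in [:: 0%N, rk (\top%O : L) & S].
apply: (nonpos_rooted_embedding (f := fun x => val (f x)) (S := T) Lr (resolvable_graded Lr)).
- by move=> x y; rewrite Order.le_val f_mono.
- by move=> x; have := valP (f x); rewrite inE.
- move=> y Ty; have yin : y \in bs_set (rank_selection L S) by rewrite inE.
  by exists (g (Induced yin)); rewrite gK.
- by rewrite /T inE eqxx.
- by rewrite /T !inE eqxx orbT.
Qed.

(** A one-element poset is the Boolean lattice of rank 0. *)
Lemma nonpos_rooted_point d (P : finTBPOrderType d) : (forall x : P, x = \bot%O) -> nonpos_rooted C P.
Proof.
move=> P1; have A0 (A : {set 'I_0}) : A = set0 by apply/setP => -[].
apply: (nonpos_rooted_embedding (f := fun=> set0) (S := predT) (boolean_resolvable 0 C)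
  (boolean_rank 0)) => //.
- by move=> x y; rewrite [x]P1 [y]P1 !lexx.
- by move=> y _; exists \bot%O; rewrite [y]A0.
Qed.

(** Ranks 0, ..., k - 1 and n of the Boolean lattice are selected. *)
Lemma nonpos_rooted_uniform d (P : finTBPOrderType d) n k : (1 <= k <= n)%N ->
  poset_iso P (induced (uniform_lattice n k)) -> nonpos_rooted C P.
Proof.
move=> /andP[k1 kn] [f [[g fK gK] f_mono]].
pose T i := (i <= k.-1)%N || (i == n).
apply: (nonpos_rooted_embedding (f := fun x => val (f x)) (S := T) (boolean_resolvable n C)
  (boolean_rank n)).
- by move=> x y; rewrite Order.le_val f_mono.
- move=> x; have := valP (f x); rewrite -[bs_set _]/(uniform_set n k) inE /T.
  by case/orP=> [->//|/eqP e]; rewrite [val (f x)]e cardsT card_ord eqxx orbT.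
- move=> y Ty; have yin : y \in bs_set (uniform_lattice n k).
    rewrite -[bs_set _]/(uniform_set n k) inE; case/orP: Ty => [->//|/eqP yn].
    by rewrite eqEcard subsetT cardsT card_ord yn leqnn orbT.
  by exists (g (Induced yin)); rewrite gK.
- by [].
- by rewrite /T cardsT card_ord eqxx orbT.
Qed.

(** As for uniform matroids; for k = 0 rank 0 would not be selected, but the
poset is then a point. *)
Lemma nonpos_rooted_qniform d (P : finTBPOrderType d) (F : finFieldType) n k : (k <= n)%N ->
  poset_iso P (induced (qniform_lattice F n k)) -> nonpos_rooted C P.
Proof.
move=> kn [f [[g fK gK] f_mono]].
have [k0|k0] := posnP k.
  apply: nonpos_rooted_point => x; apply: (can_inj fK); apply: val_inj.
  have all1 (z : induced (qniform_lattice F n k)) : val z = setT.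
    have := valP z; rewrite -[bs_set _]/(qniform_set F n k) => /setU1P[//|].
    case/imsetP => U; rewrite inE => Uk _.
    by have := leq_trans Uk (eq_leq k0); rewrite ltn0.
  by rewrite !all1.
have lin x : val (f x) \in bs_set (projective_lattice F n).
  have := valP (f x); rewrite -[bs_set _]/(qniform_set F n k) => /setU1P[->|].
    exact: linear_max_in.
  by case/imsetP => U _ ->; apply: row_space_in.
pose T i := (i < k)%N || (i == n).
apply: (nonpos_rooted_embedding (f := fun x => Induced (lin x)) (S := T)
  (projective_resolvable F n C) (@proj_rank_function F n)).
- by move=> x y; rewrite -Order.le_val /= Order.le_val f_mono.
- move=> x; rewrite /T; have := valP (f x).
  rewrite -[bs_set _]/(qniform_set F n k) => /setU1P[e|/imsetP[U]].
    have -> : Induced (lin x) = \top%O by apply: val_inj.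
    by rewrite proj_top eqxx orbT.
  rewrite inE => Uk e; have -> : Induced (lin x) = of_mx U by apply: val_inj.
  by rewrite proj_rank_of Uk.
- move=> y Ty; have yin : val y \in bs_set (qniform_lattice F n k).
    change (val y \in qniform_set F n k); rewrite -mx_ofE; apply/setU1P.
    case/orP: Ty => [yk|/eqP yn]; first by right; apply: imset_f; rewrite inE.
    left; rewrite -row_space1; apply/eqP; rewrite eqEsubset !row_spaceS submx1 /=.
    by apply: submx_cap_eq; rewrite ?submx1 // mxrank1 (eq_leq (esym yn)).
  by exists (g (Induced yin)); apply: val_inj; rewrite /= gK.
- by rewrite /T k0.
- by rewrite /T proj_top eqxx orbT.
Qed.

Lemma listed_nonpos_rooted d (P : finTBPOrderType d) : listed_poset P -> nonpos_rooted C P.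
Proof.
case=> [[n [k [kn]]]|]; first exact: nonpos_rooted_uniform.
case=> [[F [n [|[k [kn]]]]]|].
- exact: nonpos_rooted_iso (projective_resolvable F n C).
- exact: nonpos_rooted_qniform.
case=> [[F [n]]|]; first exact: nonpos_rooted_selection (affine_resolvable F n C).
case=> [[n]|]; first exact: nonpos_rooted_selection (partition_resolvable n C).
case=> [[n [_]]|]; first exact: nonpos_rooted_selection (dowling_resolvable n _ C).
case=> [[n [G [_]]]|]; first exact: nonpos_rooted_selection (dowling_resolvable n G C).
case=> d' [L [Lg Ls Lu]]; apply: nonpos_rooted_selection.
exact: supersolvable_resolvable.
Qed.

End Families.

Section Isomorphism.
Variables (d : Order.disp_t) (P : finTBPOrderType d).
Variables (d' : Order.disp_t) (Q : finTBPOrderType d').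
Variables (g : P -> Q) (g' : Q -> P).
Hypotheses (gK : cancel g g') (g'K : cancel g' g).
Hypothesis g_mono : {mono g : x y / (x <= y)%O}.
Variable rho : P -> nat.
Hypothesis rhoP : is_rank_function rho.

Let g_lt x y : (g x < g y)%O = (x < y)%O. Proof. exact: (leW_mono g_mono). Qed.

Lemma iso_bot : g \bot%O = \bot%O.
Proof. by apply/le_anti; rewrite le0x andbT -[X in (_ <= X)%O]g'K g_mono le0x. Qed.

Lemma iso_top : g \top%O = \top%O.
Proof. by apply/le_anti; rewrite lex1 /= -[X in (X <= _)%O]g'K g_mono lex1. Qed.

Lemma iso_rank_function : is_rank_function (rho \o g').
Proof.
split=> [|s t /andP[st /forallP no]] /=; first by rewrite -iso_bot gK rhoP.1.
apply: rhoP.2; rewrite /covers -!g_lt !g'K st; apply/forallP => w.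
by rewrite -!g_lt !g'K; apply: no.
Qed.

Lemma iso_rk x : rk (g x) = rk x.
Proof. by rewrite (rkE iso_rank_function) (rkE rhoP) /= gK. Qed.

Let rkP_lt (s t : P) : (s < t)%O -> (rk s < rk t)%N.
Proof. by rewrite !(rkE rhoP); apply: (rank_function_lt rhoP). Qed.

Let rkQ_lt (s t : Q) : (s < t)%O -> (rk s < rk t)%N.
Proof. by rewrite !(rkE iso_rank_function); apply: (rank_function_lt iso_rank_function). Qed.

Lemma iso_chow_from s : chow_from (g s) = chow_from s.
Proof.
elim/(@up_ind _ P): s => s IH; rewrite !chow_from_rec //; congr (_ + _).
rewrite (reindex g) /=; last by exists g' => x _.
by apply: eq_big => w; rewrite g_lt // => sw; rewrite IH // !iso_rk.
Qed.

Lemma iso_chow : chow P = chow Q.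
Proof. by rewrite /chow -iso_bot iso_chow_from. Qed.

Lemma iso_augmented : augmented_chow P = augmented_chow Q.
Proof.
rewrite /augmented_chow [RHS](reindex g) /=; last by exists g' => x _.
by apply: eq_bigr => s _; rewrite iso_rk iso_chow_from.
Qed.

Lemma iso_h : h_polynomial (order_complex [set: P]) = h_polynomial (order_complex [set: Q]).
Proof.
rewrite !h_polynomialE !max_chain_card -iso_top iso_rk.
rewrite [RHS](reindex (fun C : {set P} => g @: C)) /=; last first.
  exists (fun C : {set Q} => g' @: C) => C _; rewrite -imset_comp.
    by rewrite (eq_imset (g := id)) ?imset_id.
  by rewrite (eq_imset (g := id)) ?imset_id.
apply: eq_big => C; last by rewrite card_imset //; apply: can_inj gK.
rewrite !inE !subsetT /=; apply/chainP/chainP => h x y.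
  by move=> /imsetP[a aC ->] /imsetP[b bC ->]; rewrite /Order.comparable !g_mono; apply: h.
move=> xC yC; have := h (g x) (g y) (imset_f g xC) (imset_f g yC).
by rewrite /Order.comparable !g_mono.
Qed.

End Isomorphism.

(** The top and the bottom are cone points.  If there are loops then no flat is
empty, and only the top is left out. *)
Lemma h_bergman (E : finType) (M : matroid E) :
  h_polynomial (bergman_complex M) = h_polynomial (order_complex [set: flats M]).
Proof.
have top F : (val F == setT) = (F == \top%O :> flats M) by rewrite -(inj_eq val_inj).
rewrite -[RHS](h_cone (v := \top%O)); last by move=> x _; rewrite ge_comparable ?lex1.
rewrite /bergman_complex.
have [l0|l0] := eqVneq (loops M) set0; last first.
  congr (h_polynomial (order_complex _)); apply/setP => F; rewrite !inE top andbT.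
  rewrite (_ : val F != set0) //.
  have := le0x F; rewrite flat_le => lF; apply: contraNneq l0 => F0.
  by rewrite -subset0 -F0.
rewrite -[RHS](h_cone (v := \bot%O)); last by move=> x _; rewrite le_comparable ?le0x.
congr (h_polynomial (order_complex _)); apply/setP => F; rewrite !inE top andbT.
by rewrite -(inj_eq val_inj F \bot%O) /= l0.
Qed.

Lemma nonpos_roots_real (R : realType) p :
  nonpos_roots R[i] p -> all_roots_real_nonpos R p.
Proof. by move=> h z /h; rewrite lecE /= => /andP[/eqP <-]. Qed.

Theorem theorem1p8 (R : realType) (d : Order.disp_t) (P : finTBPOrderType d)
    (HP : listed_poset P) :
  [/\ all_roots_real R (chow P),
      all_roots_real R (augmented_chow P) &
      all_roots_real R (h_polynomial (order_complex [set: P]))] /\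
  forall (E : finType) (M : matroid E), poset_iso P (flats M) ->
    [/\ chow P = chow (flats M),
        augmented_chow P = augmented_chow (flats M) &
        h_polynomial (order_complex [set: P]) = h_polynomial (bergman_complex M)] /\
    all_roots_real_nonpos R (chow (flats M)) /\
    all_roots_real_nonpos R (h_polynomial (bergman_complex M)).
Proof.
have [[rho rhoP] [/nonpos_roots_real cP /nonpos_roots_real aP /nonpos_roots_real hP]] :=
  listed_nonpos_rooted R[i] HP.
split; first by split=> z zr; [case: (cP z zr)|case: (aP z zr)|case: (hP z zr)].
move=> E M [g [[g' gK g'K] g_mono]].
have ch := iso_chow gK g'K g_mono rhoP.
have au := iso_augmented gK g'K g_mono rhoP.
have hh := iso_h gK g'K g_mono rhoP.
by rewrite h_bergman -hh -ch.
Qed.
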